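(* Let $t\ge1$ and let $\mathfrak g$ be a nonsolvable complex Lie algebra with nilradical $\mathfrak n_{2,t}$. Then $\mathfrak g$ is (up to isomorphism) one of the following Lie algebras: a) $\mathfrak g=\mathfrak s\oplus\mathfrak r$, a direct sum as ideals of a semisimple Lie algebra $\mathfrak s$ and a solvable Lie algebra $\mathfrak r$ with nilradical $\mathfrak n_{2,t}$; b) $\mathfrak g=\mathfrak s\oplus\mathfrak g_{2,t}$, a direct sum as ideals, where $\mathfrak s$ is either the null algebra or an arbitrary semisimple Lie algebra; or c) $\mathfrak g=\mathfrak s\oplus\mathfrak g(\delta)$, a direct sum as ideals, where $\mathfrak s$ is either the null algebra or an arbitrary semisimple Lie algebra and $\mathfrak g(\delta)$ is the Lie algebra $\mathfrak g(\delta)=\mathfrak g_{2,t}\oplus\mathbb C\cdot x$ (direct sum of vector spaces) with $[\mathrm{Der}_1^0\,\mathfrak n_{2,t},x]=0$ and $\mathrm{ad}_{\mathfrak n_{2,t}}x=id_{2,t}+\delta$, for some $\delta\in\mathfrak N_{2,t}$ with $\delta\in C_{\mathrm{Der}\,\mathfrak n_{2,t}}(\mathrm{Der}_1^0\,\mathfrak n_{2,t})$.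
   Context: Lie algebras are finite-dimensional over $\mathbb C$ (except the free Lie algebra $\mathfrak{FL}_2$). The nilradical is the largest nilpotent ideal. $\mathfrak n_{2,t}=\mathfrak{FL}_2/\mathfrak{FL}_2^{t+1}$ is the free $t$-nilpotent Lie algebra on two generators $x_1,x_2$: $\mathfrak{FL}_2$ is the free Lie algebra on $x_1,x_2$ and $\mathfrak{FL}_2^{t+1}$ is the ideal spanned by all brackets of length at least $t+1$ in the generators. Put $\mathfrak m=\mathrm{span}\langle x_1,x_2\rangle$ and let $\mathfrak m^k$ be the span of the left-normed brackets of length $k$ in $x_1,x_2$; then $\mathfrak n_{2,t}=\mathfrak m\oplus\mathfrak m^2\oplus\dots\oplus\mathfrak m^t$. Every linear map $\delta:\mathfrak m\to\mathfrak n_{2,t}$ extends uniquely to a derivation $\widehat\delta$ of $\mathfrak n_{2,t}$. Put $\mathrm{Der}_j\,\mathfrak n_{2,t}=\{\widehat\delta:\delta\in\mathrm{Hom}(\mathfrak m,\mathfrak m^j)\}$; $\mathrm{Der}\,\mathfrak n_{2,t}=\bigoplus_{j=1}^t\mathrm{Der}_j\,\mathfrak n_{2,t}$; $\mathrm{Der}_1^0\,\mathfrak n_{2,t}=\{\widehat\delta:\delta\in\mathfrak{sl}(\mathfrak m)\}\cong\mathfrak{sl}_2(\mathbb C)$; $id_{2,t}=\widehat{id_{\mathfrak m}}$; $\mathfrak N_{2,t}=\bigoplus_{j=2}^t\mathrm{Der}_j\,\mathfrak n_{2,t}$ (the nilradical of $\mathrm{Der}\,\mathfrak n_{2,t}$).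 $\mathfrak g_{2,t}=\mathrm{Der}_1^0\,\mathfrak n_{2,t}\oplus_{id}\mathfrak n_{2,t}$ is the semidirect product with $[d_1,d_2]=d_1d_2-d_2d_1$ and $[d,a]=d(a)$ for $d,d_1,d_2\in\mathrm{Der}_1^0\,\mathfrak n_{2,t}$, $a\in\mathfrak n_{2,t}$, and the usual product on $\mathfrak n_{2,t}$. $\mathrm{ad}_{\mathfrak n_{2,t}}x$ is the derivation $b\mapsto[x,b]$ of $\mathfrak n_{2,t}$, and $C_{\mathrm{Der}\,\mathfrak n_{2,t}}(\cdot)$ denotes the centralizer in $\mathrm{Der}\,\mathfrak n_{2,t}$. *)

(* Defs.v *)
From HB Require Import structures.
From mathcomp Require Import all_boot all_order all_algebra.
From mathcomp Require Import boolp.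

Set Implicit Arguments.
Unset Strict Implicit.
Unset Printing Implicit Defensive.

Import GRing.Theory.
Local Open Scope ring_scope.
Local Open Scope quotient_scope.

Reserved Notation "[ 'Lie' x , y ]"
  (at level 0, x, y at level 99, format "[ 'Lie'  x ,  y ]").

HB.mixin Record isLie (K : fieldType) L of GRing.Lmodule K L := {
  lie : L -> L -> L;
  liePl : forall a x y z, lie (a *: x + y) z = a *: lie x z + lie y z;
  liePr : forall a x y z, lie z (a *: x + y) = a *: lie z x + lie z y;
  liexx : forall x, lie x x = 0;
  jacobi : forall x y z,
    lie x (lie y z) + lie y (lie z x) + lie z (lie x y) = 0
}.

#[short(type="lieType")]
HB.structure Definition LieAlg (K : fieldType) :=
  {L of isLie K L & GRing.Lmodule K L}.

#[short(type="finLieType")]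
HB.structure Definition FinLieAlg (K : fieldType) :=
  {L of isLie K L & Vector K L}.

Notation "[ 'Lie' x , y ]" := (lie x y) : ring_scope.

Section LieBasics.
Variables (K : fieldType) (L : lieType K).
Implicit Types (x y z : L) (a : K).

Lemma lieDl x y z : [Lie x + y, z] = [Lie x, z] + [Lie y, z].
Proof. by have := liePl 1 x y z; rewrite !scale1r. Qed.

Lemma lieDr x y z : [Lie z, x + y] = [Lie z, x] + [Lie z, y].
Proof. by have := liePr 1 x y z; rewrite !scale1r. Qed.

Lemma lie0l z : [Lie 0, z] = 0.
Proof. by apply: (@addrI _ [Lie 0, z]); rewrite -lieDl !addr0. Qed.

Lemma lie0r z : [Lie z, 0] = 0.
Proof. by apply: (@addrI _ [Lie z, 0]); rewrite -lieDr !addr0. Qed.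

Lemma lieZl a x z : [Lie a *: x, z] = a *: [Lie x, z].
Proof. by have := liePl a x 0 z; rewrite lie0l !addr0. Qed.

Lemma lieZr a x z : [Lie z, a *: x] = a *: [Lie z, x].
Proof. by have := liePr a x 0 z; rewrite lie0r !addr0. Qed.

Lemma lieNl x z : [Lie - x, z] = - [Lie x, z].
Proof. by rewrite -scaleN1r lieZl scaleN1r. Qed.

Lemma lieNr x z : [Lie z, - x] = - [Lie z, x].
Proof. by rewrite -scaleN1r lieZr scaleN1r. Qed.

Lemma lieBl x y z : [Lie x - y, z] = [Lie x, z] - [Lie y, z].
Proof. by rewrite lieDl lieNl. Qed.

Lemma lieBr x y z : [Lie z, x - y] = [Lie z, x] - [Lie z, y].
Proof. by rewrite lieDr lieNr. Qed.

Lemma lieC x y : [Lie x, y] = - [Lie y, x].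
Proof.
apply/eqP; rewrite -addr_eq0; apply/eqP.
have := liexx (x + y).
by rewrite lieDl !lieDr !liexx add0r addr0.
Qed.

Lemma jacobiD x y z : [Lie x, [Lie y, z]] = [Lie [Lie x, y], z] + [Lie y, [Lie x, z]].
Proof.
have := jacobi x y z; rewrite (lieC z x) lieNr (lieC z [Lie x, y]).
by move=> /eqP; rewrite -addrA addr_eq0 opprD !opprK addrC => /eqP.
Qed.

End LieBasics.

Section FinLie.
Variables (K : fieldType) (L : finLieType K).
Implicit Types (U V I : {vspace L}).

Definition lie_ideal I := forall x y, y \in I -> [Lie x, y] \in I.

Definition liev U V : {vspace L} :=
  <<[seq [Lie u, v] | u <- vbasis U, v <- vbasis V]>>%VS.

Lemma memv_lie U V u v : u \in U -> v \in V -> [Lie u, v] \in liev U V.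
Proof.
move=> uU vV; rewrite (coord_vbasis uU) (coord_vbasis vV).
pose P w := [Lie w, \sum_i coord (vbasis V) i v *: (vbasis V)`_i] \in liev U V.
apply: (big_ind P) => [|w w' Pw Pw'|i _]; rewrite /P ?lie0l ?rpred0 //.
  by rewrite lieDl rpredD.
rewrite lieZl rpredZ //.
pose Q w := [Lie (vbasis U)`_i, w] \in liev U V.
apply: (big_ind Q) => [|w w' Pw Pw'|j _]; rewrite /Q ?lie0r ?rpred0 //.
  by rewrite lieDr rpredD.
by rewrite lieZr rpredZ // memv_span //; apply: allpairs_f; rewrite mem_nth ?size_tuple.
Qed.

Lemma liev_sub U V (W : {vspace L}) :
  (forall u v, u \in U -> v \in V -> [Lie u, v] \in W) -> (liev U V <= W)%VS.
Proof.
move=> sub; apply/span_subvP => _ /allpairsP[[u v] /= [uU vV ->]].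
by apply: sub; apply: vbasis_mem.
Qed.

Definition lie_nilpotent U := exists k, iter k (liev U) U = 0%VS.

Definition lie_solvable U := exists k, iter k (fun V => liev V V) U = 0%VS.

Definition is_nilradical (N : {vspace L}) :=
  [/\ lie_ideal N, lie_nilpotent N
    & forall I, lie_ideal I -> lie_nilpotent I -> (I <= N)%VS].

Definition lie_der (D : 'End(L)) :=
  forall x y, D [Lie x, y] = [Lie D x, y] + [Lie x, D y].

End FinLie.

Definition solvable_lie (K : fieldType) (L : finLieType K) :=
  lie_solvable {:L}.

Definition null_lie (K : fieldType) (L : finLieType K) :=
  {:L}%VS = 0%VS.

(* The null algebra is not counted as semisimple. *)
Definition semisimple_lie (K : fieldType) (L : finLieType K) :=
  ~ null_lie L /\
  forall I : {vspace L}, lie_ideal I -> lie_solvable I -> I = 0%VS.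

Definition lie_isog (K : fieldType) (L1 L2 : finLieType K) :=
  exists2 f : 'Hom(L1, L2),
    bijective f & forall x y, f [Lie x, y] = [Lie f x, f y].

Definition has_nilradical (K : fieldType) (L n : finLieType K) :=
  exists f : 'Hom(n, L),
    [/\ injective f, forall x y, f [Lie x, y] = [Lie f x, f y]
      & is_nilradical (limg f)].

Section DirectSum.
Variables (K : fieldType) (L1 L2 : finLieType K).
Implicit Types u v w : (L1 * L2)%type.

Let br u v : (L1 * L2)%type := ([Lie u.1, v.1], [Lie u.2, v.2]).

Fact prod_liePl a u v w : br (a *: u + v) w = a *: br u w + br v w.
Proof. by congr (_, _); rewrite /= liePl. Qed.
Fact prod_liePr a u v w : br w (a *: u + v) = a *: br w u + br w v.
Proof. by congr (_, _); rewrite /= liePr. Qed.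
Fact prod_liexx u : br u u = 0.
Proof. by congr (_, _); rewrite /= liexx. Qed.
Fact prod_jacobi u v w : br u (br v w) + br v (br w u) + br w (br u v) = 0.
Proof. by congr (_, _); rewrite /= jacobi. Qed.

HB.instance Definition _ := isLie.Build K (L1 * L2)%type
  prod_liePl prod_liePr prod_liexx prod_jacobi.

End DirectSum.

Inductive lterm (K : Type) : Type :=
| LVar of 'I_2
| LZero
| LAdd of lterm K & lterm K
| LScale of K & lterm K
| LBr of lterm K & lterm K.

Arguments LVar {K}.
Arguments LZero {K}.

HB.instance Definition _ (K : Type) := gen_eqMixin (lterm K).
HB.instance Definition _ (K : Type) := gen_choiceMixin (lterm K).

(* The least congruence on terms forcing the axioms of Lie algebras. *)
Inductive leqv (K : fieldType) : lterm K -> lterm K -> Prop :=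
| leqv_refl u : leqv u u
| leqv_sym u v : leqv u v -> leqv v u
| leqv_trans v u w : leqv u v -> leqv v w -> leqv u w
| leqv_add u u' v v' : leqv u u' -> leqv v v' -> leqv (LAdd u v) (LAdd u' v')
| leqv_scale a u u' : leqv u u' -> leqv (LScale a u) (LScale a u')
| leqv_br u u' v v' : leqv u u' -> leqv v v' -> leqv (LBr u v) (LBr u' v')
| leqv_addA u v w : leqv (LAdd u (LAdd v w)) (LAdd (LAdd u v) w)
| leqv_addC u v : leqv (LAdd u v) (LAdd v u)
| leqv_add0 u : leqv (LAdd LZero u) u
| leqv_scale0 u : leqv (LScale 0 u) LZero
| leqv_scale1 u : leqv (LScale 1 u) u
| leqv_scaleA a b u : leqv (LScale a (LScale b u)) (LScale (a * b) u)
| leqv_scaleDr a u v :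
    leqv (LScale a (LAdd u v)) (LAdd (LScale a u) (LScale a v))
| leqv_scaleDl a b u :
    leqv (LScale (a + b) u) (LAdd (LScale a u) (LScale b u))
| leqv_brPl a u v w :
    leqv (LBr (LAdd (LScale a u) v) w) (LAdd (LScale a (LBr u w)) (LBr v w))
| leqv_brPr a u v w :
    leqv (LBr w (LAdd (LScale a u) v)) (LAdd (LScale a (LBr w u)) (LBr w v))
| leqv_brxx u : leqv (LBr u u) LZero
| leqv_jacobi u v w :
    leqv (LAdd (LAdd (LBr u (LBr v w)) (LBr v (LBr w u))) (LBr w (LBr u v)))
         LZero.

Section LSpan.
Variables (K : fieldType) (V : lmodType K) (P : V -> Prop).
Implicit Types (a : K) (u v : V).

Inductive in_lspan : V -> Prop :=
| in_lspan0 : in_lspan 0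
| in_lspanP a (u v : V) : P u -> in_lspan v -> in_lspan (a *: u + v).

Lemma in_lspanD u v : in_lspan u -> in_lspan v -> in_lspan (u + v).
Proof.
elim=> [|a x y Px _ IH] Pv; first by rewrite add0r.
by rewrite -addrA; apply: in_lspanP => //; apply: IH.
Qed.

Lemma in_lspanZ a u : in_lspan u -> in_lspan (a *: u).
Proof.
elim=> [|b x y Px _ IH]; first by rewrite scaler0; apply: in_lspan0.
by rewrite scalerDr scalerA; apply: in_lspanP.
Qed.

Lemma in_lspan_gen u : P u -> in_lspan u.
Proof.
move=> Pu; rewrite -[u]scale1r -[_ *: u]addr0.
by apply: in_lspanP => //; apply: in_lspan0.
Qed.

End LSpan.

Section FreeLie.
Variable K : fieldType.

Definition leqvb (u v : lterm K) : bool := `[< leqv u v >].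

Fact leqvb_equiv : equiv_class_of leqvb.
Proof.
split=> [u|u v|v u w].
- by apply/asboolP; apply: leqv_refl.
- by apply/asboolP/asboolP; apply: leqv_sym.
- by move=> /asboolP uv /asboolP vw; apply/asboolP; apply: leqv_trans vw.
Qed.

Canonical leqvb_equivRel := EquivRelPack leqvb_equiv.
Canonical leqvb_encModRel := defaultEncModRel leqvb.

(* The free Lie algebra, as the initial model of the axioms of Lie algebras. *)
Definition free_lie : Type := {eq_quot leqvb}.

HB.instance Definition _ : EqQuotient _ leqvb free_lie := EqQuotient.on free_lie.
HB.instance Definition _ := Choice.on free_lie.

Implicit Types (s r : lterm K) (u v w : free_lie).

Local Notation pi := (\pi_free_lie).

Lemma free_lie_eqP s r : leqv s r <-> pi s = pi r.
Proof.
split=> [sr|/eqmodP /asboolP //].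
by apply/eqmodP/asboolP.
Qed.

Let rK s : leqv (repr (pi s)) s.
Proof. by apply/free_lie_eqP; rewrite reprK. Qed.

Definition fl_add u v : free_lie := pi (LAdd (repr u) (repr v)).
Definition fl_scale a u : free_lie := pi (LScale a (repr u)).
Definition fl_br u v : free_lie := pi (LBr (repr u) (repr v)).
Definition fl_opp u : free_lie := fl_scale (-1) u.

Lemma pi_fl_add s r : pi (LAdd s r) = fl_add (pi s) (pi r).
Proof. by apply/free_lie_eqP/leqv_sym/leqv_add; apply: rK. Qed.
Lemma pi_fl_scale a s : pi (LScale a s) = fl_scale a (pi s).
Proof. by apply/free_lie_eqP/leqv_sym/leqv_scale; apply: rK. Qed.
Lemma pi_fl_br s r : pi (LBr s r) = fl_br (pi s) (pi r).
Proof. by apply/free_lie_eqP/leqv_sym/leqv_br; apply: rK. Qed.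

Let piE := (pi_fl_add, pi_fl_scale, pi_fl_br).

Lemma free_lieW (P : free_lie -> Prop) : (forall s, P (pi s)) -> forall u, P u.
Proof. by move=> Ps u; rewrite -[u]reprK. Qed.

Fact fl_addA : associative fl_add.
Proof.
do 3!elim/free_lieW => ?; rewrite -!piE; apply/free_lie_eqP; exact: leqv_addA.
Qed.
Fact fl_addC : commutative fl_add.
Proof.
do 2!elim/free_lieW => ?; rewrite -!piE; apply/free_lie_eqP; exact: leqv_addC.
Qed.
Fact fl_add0 : left_id (pi LZero) fl_add.
Proof.
elim/free_lieW => ?; rewrite -!piE; apply/free_lie_eqP; exact: leqv_add0.
Qed.
Fact fl_addN : left_inverse (pi LZero) fl_opp fl_add.
Proof.
elim/free_lieW => s; rewrite /fl_opp.
have {2}-> : pi s = pi (LScale 1 s).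
  by apply/free_lie_eqP/leqv_sym/leqv_scale1.
rewrite -!piE; apply/free_lie_eqP; apply: leqv_trans (leqv_scale0 s).
by rewrite -(addNr 1); apply/leqv_sym/leqv_scaleDl.
Qed.

HB.instance Definition _ :=
  GRing.isZmodule.Build free_lie fl_addA fl_addC fl_add0 fl_addN.

Fact fl_scaleA a b u : fl_scale a (fl_scale b u) = fl_scale (a * b) u.
Proof.
elim/free_lieW: u => ?; rewrite -!piE; apply/free_lie_eqP; exact: leqv_scaleA.
Qed.
Fact fl_scale1 : left_id 1 fl_scale.
Proof.
elim/free_lieW => ?; rewrite -!piE; apply/free_lie_eqP; exact: leqv_scale1.
Qed.
Fact fl_scaleDr : right_distributive fl_scale +%R.
Proof.
move=> a; do 2!elim/free_lieW => ?; rewrite -[+%R]/fl_add -!piE.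
apply/free_lie_eqP; exact: leqv_scaleDr.
Qed.
Fact fl_scaleDl u : {morph fl_scale^~ u : a b / a + b}.
Proof.
elim/free_lieW: u => s a b; rewrite -[RHS]/(fl_add _ _) -!piE.
apply/free_lie_eqP; exact: leqv_scaleDl.
Qed.

HB.instance Definition _ := GRing.Zmodule_isLmodule.Build K free_lie
  fl_scaleA fl_scale1 fl_scaleDr fl_scaleDl.

Fact fl_brPl a u v w : fl_br (a *: u + v) w = a *: fl_br u w + fl_br v w.
Proof.
rewrite -[_ *: u + v]/(fl_add (fl_scale _ _) _).
rewrite -[RHS]/(fl_add (fl_scale _ _) _).
elim/free_lieW: u => ?; elim/free_lieW: v => ?; elim/free_lieW: w => ?.
rewrite -!piE; apply/free_lie_eqP; exact: leqv_brPl.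
Qed.
Fact fl_brPr a u v w : fl_br w (a *: u + v) = a *: fl_br w u + fl_br w v.
Proof.
rewrite -[_ *: u + v]/(fl_add (fl_scale _ _) _).
rewrite -[RHS]/(fl_add (fl_scale _ _) _).
elim/free_lieW: u => ?; elim/free_lieW: v => ?; elim/free_lieW: w => ?.
rewrite -!piE; apply/free_lie_eqP; exact: leqv_brPr.
Qed.
Fact fl_brxx u : fl_br u u = 0.
Proof.
elim/free_lieW: u => ?; rewrite -!piE; apply/free_lie_eqP; exact: leqv_brxx.
Qed.
Fact fl_jacobi u v w :
  fl_br u (fl_br v w) + fl_br v (fl_br w u) + fl_br w (fl_br u v) = 0.
Proof.
rewrite -[LHS]/(fl_add (fl_add _ _) _).
elim/free_lieW: u => ?; elim/free_lieW: v => ?; elim/free_lieW: w => ?.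
rewrite -!piE; apply/free_lie_eqP; exact: leqv_jacobi.
Qed.

HB.instance Definition _ := isLie.Build K free_lie
  fl_brPl fl_brPr fl_brxx fl_jacobi.

Definition fl_gen (i : 'I_2) : free_lie := pi (LVar i).

Lemma free_lie_ind (P : free_lie -> Prop) :
  (forall i, P (fl_gen i)) -> P 0 ->
  (forall u v, P u -> P v -> P (u + v)) ->
  (forall a u, P u -> P (a *: u)) ->
  (forall u v, P u -> P v -> P [Lie u, v]) -> forall u, P u.
Proof.
move=> Pg P0 PD PZ PB; elim/free_lieW; elim=> //.
- by move=> s Ps r Pr; rewrite pi_fl_add; apply: PD.
- by move=> a s Ps; rewrite pi_fl_scale; apply: PZ.
- by move=> s Ps r Pr; rewrite pi_fl_br; apply: PB.
Qed.

Inductive is_bracket : nat -> free_lie -> Prop :=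
| is_bracket_gen i : is_bracket 1 (fl_gen i)
| is_bracket_br p q u v :
    is_bracket p u -> is_bracket q v -> is_bracket (p + q) [Lie u, v].

Definition bracket_ge k u := exists2 n, (k <= n)%N & is_bracket n u.

(* The ideal FL_2^k, spanned by the brackets of length at least k, with any
   bracketing. *)
Definition fl_pow k : pred free_lie :=
  fun u => `[< in_lspan (bracket_ge k) u >].

Lemma fl_powP k u : reflect (in_lspan (bracket_ge k) u) (u \in fl_pow k).
Proof. exact: asboolP. Qed.

Fact fl_pow_submod k : submod_closed (fl_pow k).
Proof.
split=> [|a u v /fl_powP Pu /fl_powP Pv]; first by apply/fl_powP/in_lspan0.
by apply/fl_powP/in_lspanD => //; apply: in_lspanZ.
Qed.
HB.instance Definition _ k :=
  GRing.isSubmodClosed.Build K free_lie (fl_pow k) (fl_pow_submod k).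

Lemma bracket_ge1 u : in_lspan (bracket_ge 1) u.
Proof.
elim/free_lie_ind: u.
- by move=> i; apply: in_lspan_gen; exists 1%N => //; apply: is_bracket_gen.
- exact: in_lspan0.
- exact: in_lspanD.
- exact: in_lspanZ.
move=> u v; elim=> [|a x y [p p1 xp] _ IH] Pv; first by rewrite lie0l; apply: in_lspan0.
rewrite liePl; apply: in_lspanD (IH Pv); apply: in_lspanZ.
elim: Pv => [|b z t [q q1 zq] _ IH']; first by rewrite lie0r; apply: in_lspan0.
rewrite liePr; apply: in_lspanD IH'; apply/in_lspanZ/in_lspan_gen.
by exists (p + q)%N; [apply: leq_trans p1 (leq_addr _ _) | apply: is_bracket_br].
Qed.

Lemma fl_pow_lie p q u v :
  u \in fl_pow p -> v \in fl_pow q -> [Lie u, v] \in fl_pow (p + q).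
Proof.
move=> /fl_powP Pu /fl_powP Pv; apply/fl_powP.
elim: Pu => [|a x y [p' p1 xp] _ IH]; first by rewrite lie0l; apply: in_lspan0.
rewrite liePl; apply: in_lspanD IH; apply: in_lspanZ.
elim: Pv => [|b z t [q' q1 zq] _ IH']; first by rewrite lie0r; apply: in_lspan0.
rewrite liePr; apply: in_lspanD IH'; apply/in_lspanZ/in_lspan_gen.
by exists (p' + q')%N; [apply: leq_add | apply: is_bracket_br].
Qed.

Lemma fl_pow1 u : u \in fl_pow 1.
Proof. exact/fl_powP/bracket_ge1. Qed.

Lemma fl_powS p q u : (q <= p)%N -> u \in fl_pow p -> u \in fl_pow q.
Proof.
move=> qp /fl_powP Pu; apply/fl_powP.
elim: Pu => [|a x y [p' p1 xp] _ IH]; first exact: in_lspan0.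
by apply: in_lspanP => //; exists p' => //; apply: leq_trans p1.
Qed.

Lemma fl_pow_ideal k u v : v \in fl_pow k -> [Lie u, v] \in fl_pow k.
Proof.
move=> vk; apply: (@fl_powS (1 + k)); first exact: leq_addl.
exact: fl_pow_lie (fl_pow1 u) vk.
Qed.

End FreeLie.

Section FreeNil.
Variables (K : fieldType) (t : nat).

Let I : zmodClosed (free_lie K) :=
  GRing.ZmodClosed.clone _ (@fl_pow K t.+1) _.

(* n_(2,t) = FL_2 / FL_2^(t+1) *)
Definition free_nil : Type := Quotient.quot I.

HB.instance Definition _ := Choice.on free_nil.
HB.instance Definition _ := GRing.Zmodule.on free_nil.

Definition fn_pi (u : free_lie K) : free_nil := \pi_(Quotient.quot I) u.

Implicit Types (u v w : free_lie K) (x y z : free_nil).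

Lemma fn_pi_eq u v : (fn_pi u == fn_pi v) = (u - v \in @fl_pow K t.+1).
Proof. by rewrite /fn_pi -Quotient.idealrBE. Qed.

Lemma fn_piD u v : fn_pi (u + v) = fn_pi u + fn_pi v.
Proof. by rewrite /fn_pi; apply: (raddfD (\pi_(Quotient.quot I))). Qed.

Lemma fn_pi_repr x : fn_pi (repr x) = x.
Proof. exact: reprK. Qed.

Lemma free_nilW (P : free_nil -> Prop) : (forall u, P (fn_pi u)) -> forall x, P x.
Proof. by move=> Pu x; rewrite -[x]fn_pi_repr. Qed.

Definition fn_scale (a : K) x : free_nil := fn_pi (a *: repr x).
Definition fn_br x y : free_nil := fn_pi [Lie repr x, repr y].

Let rK u : repr (fn_pi u) - u \in @fl_pow K t.+1.
Proof. by rewrite -fn_pi_eq fn_pi_repr. Qed.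

Lemma fn_piZ a u : fn_pi (a *: u) = fn_scale a (fn_pi u).
Proof.
apply/esym/eqP; rewrite fn_pi_eq -scalerBr rpredZ //.
Qed.

Lemma fn_pi_br u v : fn_pi [Lie u, v] = fn_br (fn_pi u) (fn_pi v).
Proof.
apply/esym/eqP; rewrite fn_pi_eq.
set u' := repr _; set v' := repr _.
have -> : [Lie u', v'] - [Lie u, v] = [Lie u', v' - v] - [Lie v, u' - u].
  rewrite !lieBr (lieC v u') (lieC v u) !opprK opprD opprK.
  by rewrite addrA subrK.
by rewrite rpredB ?fl_pow_ideal ?rK.
Qed.

Fact fn_scaleA a b x : fn_scale a (fn_scale b x) = fn_scale (a * b) x.
Proof. by elim/free_nilW: x => u; rewrite -!fn_piZ scalerA. Qed.
Fact fn_scale1 : left_id 1 fn_scale.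
Proof. by elim/free_nilW => u; rewrite -!fn_piZ scale1r. Qed.
Fact fn_scaleDr : right_distributive fn_scale +%R.
Proof.
move=> a; elim/free_nilW => u; elim/free_nilW => v.
by rewrite -fn_piD -!fn_piZ scalerDr fn_piD.
Qed.
Fact fn_scaleDl x : {morph fn_scale^~ x : a b / a + b}.
Proof. by elim/free_nilW: x => u a b; rewrite -!fn_piZ scalerDl fn_piD. Qed.

HB.instance Definition _ := GRing.Zmodule_isLmodule.Build K free_nil
  fn_scaleA fn_scale1 fn_scaleDr fn_scaleDl.

Fact fn_pi_linear : linear fn_pi.
Proof. by move=> a u v; rewrite fn_piD fn_piZ. Qed.
HB.instance Definition _ :=
  GRing.isLinear.Build K (free_lie K) free_nil _ fn_pi fn_pi_linear.

Fact fn_brPl a x y z : fn_br (a *: x + y) z = a *: fn_br x z + fn_br y z.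
Proof.
elim/free_nilW: x => u; elim/free_nilW: y => v; elim/free_nilW: z => w.
by rewrite -linearP -!fn_pi_br -linearP liePl.
Qed.
Fact fn_brPr a x y z : fn_br z (a *: x + y) = a *: fn_br z x + fn_br z y.
Proof.
elim/free_nilW: x => u; elim/free_nilW: y => v; elim/free_nilW: z => w.
by rewrite -linearP -!fn_pi_br -linearP liePr.
Qed.
Fact fn_brxx x : fn_br x x = 0.
Proof. by elim/free_nilW: x => u; rewrite -!fn_pi_br liexx linear0. Qed.
Fact fn_jacobi x y z :
  fn_br x (fn_br y z) + fn_br y (fn_br z x) + fn_br z (fn_br x y) = 0.
Proof.
elim/free_nilW: x => u; elim/free_nilW: y => v; elim/free_nilW: z => w.
by rewrite -!fn_pi_br -!linearD jacobi linear0.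
Qed.

HB.instance Definition _ := isLie.Build K free_nil
  fn_brPl fn_brPr fn_brxx fn_jacobi.

Lemma fn_piB u v : fn_pi [Lie u, v] = [Lie fn_pi u, fn_pi v].
Proof. exact: fn_pi_br. Qed.

End FreeNil.

Section FinDim.
Variables (K : fieldType) (V : lmodType K).

Let spanned n := exists f : 'I_n -> V, forall v, exists c : 'I_n -> K,
  v = \sum_i c i *: f i.

Fact spanned_pred n (f : 'I_n -> V) (r : 'rV[K]_n) i :
  (forall v, exists c : 'I_n -> K, v = \sum_i c i *: f i) ->
  \sum_i r 0 i *: f i = 0 -> r 0 i != 0 -> spanned n.-1.
Proof.
case: n f r i => [|n] f r i fP r0 ri0 /=; first by case: i {ri0}.
exists (f \o lift i) => v; have [c ->] := fP v.
exists (fun j => c (lift i j) - c i * (r 0 i)^-1 * r 0 (lift i j)).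
have -> : \sum_i c i *: f i = \sum_j (c j - c i * (r 0 i)^-1 * r 0 j) *: f j.
  under [RHS]eq_bigr do rewrite scalerBl -scalerA.
  by rewrite sumrB -scaler_sumr r0 scaler0 subr0.
by rewrite (bigD1_ord i) //= divfK // subrr scale0r add0r.
Qed.

Fact findim_axiom (s : seq V) :
  (forall v, in_lspan (fun u => u \in s) v) -> exists n, inhabited (Vector.axiom n V).
Proof.
move=> span_s.
have ex : exists n, `[< spanned n >].
  exists (size s); apply/asboolP; exists (tnth (in_tuple s)) => v.
  elim: (span_s v) => [|a u w us _ [c ->]].
    by exists (fun=> 0); rewrite big1 // => i _; rewrite scale0r.
  have /tnthP[i Eu] : u \in in_tuple s by [].
  exists (fun j => (if j == i then a else 0) + c j).
  under [RHS]eq_bigr do rewrite scalerDl.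
  rewrite big_split /=; congr (_ + _).
  rewrite (bigD1 i) //= eqxx big1 ?addr0 -?Eu // => j /negPf ->.
  by rewrite scale0r.
case: (ex_minnP ex) => n /asboolP[f fP] nmin; exists n.
pose r2v (r : 'rV[K]_n) := \sum_i r 0 i *: f i.
have r2v_lin : linear r2v.
  move=> a r r'; rewrite /r2v scaler_sumr -big_split /=.
  by apply: eq_bigr => i _; rewrite !mxE scalerDl scalerA.
have r2v0 r : r2v r = 0 -> r = 0.
  move=> r0; apply/rowP => i; rewrite mxE; apply/eqP/negP => /negP ri0.
  have /asboolP/nmin := spanned_pred fP r0 ri0.
  by rewrite leqNgt ltn_predL (leq_ltn_trans (leq0n i) (ltn_ord i)).
pose v2r v : 'rV[K]_n := \row_i sval (cid (fP v)) i.
have v2rK : cancel v2r r2v.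
  move=> v; rewrite /r2v {2}(svalP (cid (fP v))).
  by apply: eq_bigr => i _; rewrite mxE.
have r2v_inj r r' : r2v r = r2v r' -> r = r'.
  move=> E; apply/eqP; rewrite -subr_eq0; apply/eqP/r2v0.
  by rewrite addrC -scaleN1r r2v_lin E scaleN1r addNr.
have r2vK : cancel r2v v2r by move=> r; apply: r2v_inj; rewrite v2rK.
constructor; exists v2r; last by exists r2v.
by move=> a u v; apply: r2v_inj; rewrite r2v_lin !v2rK.
Qed.

End FinDim.

Section FreeNilVector.
Variables (K : fieldType) (t : nat).
Local Notation n := (free_nil K t).

Definition fn_gen (i : 'I_2) : n := fn_pi t (fl_gen K i).

Fixpoint fl_brackets k : seq (free_lie K) :=
  if k is k'.+1 then
    codom (fl_gen K) ++ [seq [Lie u, v] | u <- fl_brackets k', v <- fl_brackets k']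
  else [::].

Lemma fl_bracketsS j k : (j <= k)%N -> {subset fl_brackets j <= fl_brackets k}.
Proof.
elim: k j => [|k IH] [|j] //= jk u; rewrite !mem_cat => /orP[->//|].
move=> /allpairsP[[x y] /= [xj yj ->]].
by apply/orP; right; apply: allpairs_f; apply: IH xj || apply: IH yj.
Qed.

Lemma is_bracket_gt0 k (u : free_lie K) : is_bracket k u -> (0 < k)%N.
Proof. by elim=> // p q ? ? _ p0 _ _; rewrite ltn_addr. Qed.

Lemma mem_fl_brackets k u : is_bracket k u -> u \in fl_brackets k.
Proof.
elim=> [i|p q x y /is_bracket_gt0 p0 xp /is_bracket_gt0 q0 yq].
  by rewrite /= mem_cat codom_f.
case: p p0 xp => // p _ xp; rewrite addSn /= mem_cat.
apply/orP; right; apply: allpairs_f.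
  by apply: fl_bracketsS xp; rewrite -addn1 leq_add2l.
by apply: fl_bracketsS yq; rewrite leq_addl.
Qed.

Fact fn_span (x : n) :
  in_lspan (fun y => y \in [seq fn_pi t u | u <- fl_brackets t]) x.
Proof.
elim/free_nilW: x => u; elim: (bracket_ge1 u) => [|a {}u v [k k1 ku] _ IH].
  by rewrite linear0; apply: in_lspan0.
rewrite linearP /=; have [kt|tk] := leqP k t.
  by apply: in_lspanP IH; apply: map_f; apply: fl_bracketsS kt _ (mem_fl_brackets ku).
suff -> : fn_pi t u = 0 by rewrite scaler0 add0r.
apply/eqP; rewrite -(linear0 (fn_pi t)) fn_pi_eq subr0.
by apply/fl_powP/in_lspan_gen; exists k.
Qed.

Definition fn_dim : nat := sval (cid (findim_axiom fn_span)).
Definition fn_axiom : Vector.axiom fn_dim n :=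
  inhabited_witness (svalP (cid (findim_axiom fn_span))).

HB.instance Definition _ := Lmodule_hasFinDim.Build K n fn_axiom.

End FreeNilVector.

Section ExtDer.
Variables (K : fieldType) (t : nat).
Local Notation n := (free_nil K t).
Variable v : 'I_2 -> n.

Implicit Types (s r : lterm K) (u w : free_lie K) (x y : n).

Let tpi s : n := fn_pi t (\pi_(free_lie K) s).

(* The derivation of the term algebra with values in n sending the generator
   i to v i; it is compatible with leqv, then with the quotient by fl_pow. *)
Fixpoint term_der s : n :=
  match s with
  | LVar i => v i
  | LZero => 0
  | LAdd s r => term_der s + term_der r
  | LScale a s => a *: term_der s
  | LBr s r => [Lie term_der s, tpi r] + [Lie tpi s, term_der r]
  end.

Let tpiD s r : tpi (LAdd s r) = tpi s + tpi r.
Proof. by rewrite /tpi pi_fl_add -fn_piD. Qed.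
Let tpiZ a s : tpi (LScale a s) = a *: tpi s.
Proof. by rewrite /tpi pi_fl_scale; apply: fn_piZ. Qed.
Let tpiB s r : tpi (LBr s r) = [Lie tpi s, tpi r].
Proof. by rewrite /tpi pi_fl_br -fn_piB. Qed.
Let tpi_eqv s r : leqv s r -> tpi s = tpi r.
Proof. by rewrite /tpi => /free_lie_eqP ->. Qed.

Let tpiE := (tpiD, tpiZ, tpiB).

Fact term_der_eqv s r : leqv s r -> term_der s = term_der r.
Proof.
elim=> //=.
- by move=> a b c _ -> _ ->.
- by move=> a b c d _ -> _ ->.
- by move=> a b c _ ->.
- by move=> a b c d /tpi_eqv -> -> /tpi_eqv -> ->.
- by move=> *; rewrite addrA.
- by move=> *; rewrite addrC.
- by move=> *; rewrite add0r.
- by move=> *; rewrite scale0r.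
- by move=> *; rewrite scale1r.
- by move=> *; rewrite scalerA.
- by move=> *; rewrite scalerDr.
- by move=> *; rewrite scalerDl.
- by move=> *; rewrite !tpiE !liePl scalerDr addrACA.
- by move=> *; rewrite !tpiE !liePr scalerDr addrACA.
- by move=> a; rewrite (lieC (tpi a)) subrr.
- move=> a b c; rewrite !tpiE !lieDr.
  rewrite (AC ((1*2)*(1*2)*(1*2)) ((1*6*8)*(4*9*2)*(7*3*5))) /=.
  by rewrite !jacobi !addr0.
Qed.

Definition fl_der u : n := term_der (repr u).

Lemma fl_der_pi s : fl_der (\pi_(free_lie K) s) = term_der s.
Proof. by apply/term_der_eqv/free_lie_eqP; rewrite reprK. Qed.

Lemma fl_der_gen i : fl_der (fl_gen K i) = v i.
Proof. exact: fl_der_pi. Qed.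

Fact fl_der_linear : linear fl_der.
Proof.
move=> a; elim/free_lieW => s; elim/free_lieW => r.
have -> : a *: \pi_(free_lie K) s + \pi_(free_lie K) r
        = \pi_(free_lie K) (LAdd (LScale a s) r).
  by rewrite pi_fl_add pi_fl_scale.
by rewrite !fl_der_pi.
Qed.
HB.instance Definition _ :=
  GRing.isLinear.Build K (free_lie K) n _ fl_der fl_der_linear.

Lemma fl_derB u w :
  fl_der [Lie u, w] = [Lie fl_der u, fn_pi t w] + [Lie fn_pi t u, fl_der w].
Proof.
elim/free_lieW: u => s; elim/free_lieW: w => r.
have -> : [Lie \pi_(free_lie K) s, \pi_(free_lie K) r]
        = \pi_(free_lie K) (LBr s r) by rewrite pi_fl_br.
by rewrite !fl_der_pi.
Qed.

Lemma fl_der_bracket k u : is_bracket k u ->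
  exists2 w, w \in @fl_pow K k & fl_der u = fn_pi t w.
Proof.
elim=> [i|p q x y xp [x' x'p Ex] yq [y' y'q Ey]].
  by exists (repr (v i)); [apply: fl_pow1 | rewrite fl_der_gen fn_pi_repr].
exists ([Lie x', y] + [Lie x, y']); last by rewrite fl_derB Ex Ey -!fn_piB linearD.
apply: rpredD; apply: fl_pow_lie => //; apply/fl_powP/in_lspan_gen.
  by exists q.
by exists p.
Qed.

Lemma fn_pi_eq0 u : (fn_pi t u == 0) = (u \in @fl_pow K t.+1).
Proof. by rewrite -(linear0 (fn_pi t)) fn_pi_eq subr0. Qed.

Lemma fl_der_pow u : u \in @fl_pow K t.+1 -> fl_der u = 0.
Proof.
move=> /fl_powP; elim=> [|a x y [k tk /fl_der_bracket [w wk Ex]] _ IH].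
  exact: linear0.
rewrite linearP /= IH addr0 Ex; apply/eqP; rewrite scaler_eq0 fn_pi_eq0.
by rewrite (fl_powS tk wk) orbT.
Qed.

Definition fn_der x : n := fl_der (repr x).

Lemma fn_der_pi u : fn_der (fn_pi t u) = fl_der u.
Proof.
apply/eqP; rewrite -subr_eq0 -linearB /= fl_der_pow //.
by rewrite -fn_pi_eq fn_pi_repr.
Qed.

Fact fn_der_linear : linear fn_der.
Proof.
move=> a; elim/free_nilW => u; elim/free_nilW => w.
by rewrite -linearP !fn_der_pi linearP.
Qed.
HB.instance Definition _ := GRing.isLinear.Build K n n _ fn_der fn_der_linear.

Definition ext_der : 'End(n) := linfun fn_der.

Lemma ext_der_gen i : ext_der (fn_gen K t i) = v i.
Proof. by rewrite lfunE /= fn_der_pi fl_der_gen. Qed.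

Lemma ext_der_der : lie_der ext_der.
Proof.
move=> x y; rewrite !lfunE /=.
elim/free_nilW: x => u; elim/free_nilW: y => w.
by rewrite -fn_piB !fn_der_pi fl_derB.
Qed.

End ExtDer.

Lemma lie_der_gen_inj (K : fieldType) (t : nat) (D E : 'End(free_nil K t)) :
  lie_der D -> lie_der E ->
  (forall i, D (fn_gen K t i) = E (fn_gen K t i)) -> D = E.
Proof.
move=> dD dE DE; apply/lfunP; elim/free_nilW; elim/free_lie_ind.
- exact: DE.
- by rewrite !linear0.
- by move=> u w Hu Hw; rewrite !linearD /= Hu Hw.
- by move=> a u Hu; rewrite !linearZ /= Hu.
- by move=> u w Hu Hw; rewrite fn_piB dD dE Hu Hw.
Qed.

Section LieCommutator.
Variables (K : fieldType) (L : finLieType K).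
Implicit Types D E : 'End(L).

Definition lfun_comm D E : 'End(L) := (D \o E)%VF - (E \o D)%VF.

Lemma lfun_commE D E x : lfun_comm D E x = D (E x) - E (D x).
Proof. by rewrite /lfun_comm add_lfunE opp_lfunE !comp_lfunE. Qed.

Lemma lfun_commPl a D E F :
  lfun_comm (a *: D + E) F = a *: lfun_comm D F + lfun_comm E F.
Proof.
by apply/lfunP => x; rewrite !(lfun_commE, add_lfunE, scale_lfunE) linearP
  scalerBr opprD addrACA.
Qed.

Lemma lfun_commPr a D E F :
  lfun_comm F (a *: D + E) = a *: lfun_comm F D + lfun_comm F E.
Proof.
by apply/lfunP => x; rewrite !(lfun_commE, add_lfunE, scale_lfunE) linearP
  scalerBr opprD addrACA.
Qed.

Lemma lfun_commxx D : lfun_comm D D = 0.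
Proof. by rewrite /lfun_comm subrr. Qed.

Lemma lfun_comm0l D : lfun_comm 0 D = 0.
Proof. by apply/lfunP => x; rewrite lfun_commE !zero_lfunE linear0 subrr. Qed.

Lemma lfun_comm0r D : lfun_comm D 0 = 0.
Proof. by apply/lfunP => x; rewrite lfun_commE !zero_lfunE linear0 subrr. Qed.

Lemma lfun_comm_jacobi D E F :
  lfun_comm D (lfun_comm E F) + lfun_comm E (lfun_comm F D)
    + lfun_comm F (lfun_comm D E) = 0.
Proof.
apply/lfunP => x; rewrite zero_lfunE !(lfun_commE, add_lfunE) !linearB /=.
rewrite !opprK (AC ((2*2)*(2*2)*(2*2))
  ((1*11)*(5*3)*(9*7)*((4*10)*(8*2)*(12*6)))) /=.
by rewrite !subrr !addr0.
Qed.


Lemma lie_der_comm D E : lie_der D -> lie_der E -> lie_der (lfun_comm D E).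
Proof.
move=> dD dE x y; rewrite !lfun_commE dE dD !linearD /= !dD !dE.
rewrite lieBl lieBr !opprD.
by rewrite (AC ((2*2)*(2*2)) ((1*5)*(4*8)*((2*7)*(3*6)))) /= !subrr !addr0.
Qed.

Lemma lie_derD D E : lie_der D -> lie_der E -> lie_der (D + E).
Proof. by move=> dD dE x y; rewrite !lfunE /= dD dE lieDl lieDr addrACA. Qed.

Lemma lie_derZ a D : lie_der D -> lie_der (a *: D).
Proof. by move=> dD x y; rewrite !lfunE /= dD lieZl lieZr scalerDr. Qed.

(* The centralizer of S in Der L. *)
Definition der_cent (S : {vspace 'End(L)}) D :=
  lie_der D /\ forall E, E \in S -> lfun_comm D E = 0.

Lemma der_centD S D E : der_cent S D -> der_cent S E -> der_cent S (D + E).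
Proof.
move=> [dD cD] [dE cE]; split=> [|F FS]; first exact: lie_derD.
by rewrite -[D]scale1r lfun_commPl cD ?cE // scaler0 addr0.
Qed.

Lemma der_centE S D E x : der_cent S D -> E \in S -> D (E x) = E (D x).
Proof.
by move=> [_ cD] /cD /lfunP/(_ x); rewrite lfun_commE zero_lfunE => /subr0_eq.
Qed.

End LieCommutator.

Section Trace.
Variables (K : fieldType) (V : vectType K).

Definition lfun_trace (f : 'End(V)) : K^o :=
  \tr (passmx.mxof (vbasis {:V}) (vbasis {:V}) f).

Fact lfun_trace_linear : linear lfun_trace.
Proof. by move=> a f g; rewrite /lfun_trace passmx.mxof_linear mxtraceD mxtraceZ. Qed.
HB.instance Definition _ :=
  GRing.isLinear.Build K 'End(V) K^o _ lfun_trace lfun_trace_linear.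

Lemma lfun_traceC (f g : 'End(V)) :
  lfun_trace (f \o g)%VF = lfun_trace (g \o f)%VF.
Proof. by rewrite /lfun_trace !(passmx.mxof_comp _ _ (vbasisP _)) mxtrace_mulC. Qed.

Definition lfun_sl : {vspace 'End(V)} := lker (linfun lfun_trace).

Lemma memv_lfun_sl f : (f \in lfun_sl) = (lfun_trace f == 0).
Proof. by rewrite memv_ker lfunE. Qed.

End Trace.

Section FreeNilDer.
Variables (K : fieldType) (t : nat).
Local Notation n := (free_nil K t).

Definition fn_m : {vspace n} := <<codom (fn_gen K t)>>%VS.

Definition left_bracket (w : seq 'I_2) : n :=
  if w is i :: w' then
    foldl (fun x j => [Lie x, fn_gen K t j]) (fn_gen K t i) w'
  else 0.

Definition fn_mpow k : {vspace n} :=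
  <<[seq left_bracket w | w : k.-tuple 'I_2]>>%VS.

Lemma mem_fn_gen i : fn_gen K t i \in fn_m.
Proof. by rewrite memv_span ?codom_f. Qed.

(* The unique derivation of n extending d : m -> n; see fn_hatE, fn_hat_uniq. *)
Definition fn_hat (d : 'Hom(subvs_of fn_m, n)) : 'End(n) :=
  ext_der (fun i => d (vsproj fn_m (fn_gen K t i))).

Lemma fn_hat_der d : lie_der (fn_hat d).
Proof. exact: ext_der_der. Qed.

Lemma fn_hatE d (u : subvs_of fn_m) : fn_hat d (vsval u) = d u.
Proof.
suff E : {in fn_m, fn_hat d =1 (d \o linfun (vsproj fn_m))%VF}.
  by rewrite E ?subvsP // comp_lfunE lfunE /= vsvalK.
apply/span_lfunP => _ /codomP[i ->].
by rewrite ext_der_gen comp_lfunE lfunE.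
Qed.

Lemma fn_hat_gen d i : fn_hat d (fn_gen K t i) = d (vsproj fn_m (fn_gen K t i)).
Proof. exact: ext_der_gen. Qed.

Lemma fn_hat_uniq (d : 'Hom(subvs_of fn_m, n)) (D : 'End(n)) : lie_der D ->
  (forall u, D (vsval u) = d u) -> D = fn_hat d.
Proof.
move=> dD Dd; apply: lie_der_gen_inj (dD) (fn_hat_der d) _ => i.
by rewrite -[fn_gen K t i](vsprojK (mem_fn_gen i)) Dd fn_hatE.
Qed.

Fact fn_hat_linear : linear fn_hat.
Proof.
move=> a d e; apply/esym/fn_hat_uniq; last first.
  by move=> u; rewrite !add_lfunE !scale_lfunE !fn_hatE.
by apply: lie_derD; [apply: lie_derZ|]; apply: fn_hat_der.
Qed.
HB.instance Definition _ :=
  GRing.isLinear.Build K 'Hom(subvs_of fn_m, n) 'End(n) _ fn_hat fn_hat_linear.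

Definition fn_incl (U : {vspace n}) : 'Hom(subvs_of U, n) := linfun vsval.

(* The derivation extending d : m -> U, for a subspace U of n. *)
Definition fn_hat_in (U : {vspace n}) (d : 'Hom(subvs_of fn_m, subvs_of U)) :
  'End(n) := fn_hat (fn_incl U \o d)%VF.

Fact fn_hat_in_linear U : linear (@fn_hat_in U).
Proof. by move=> a d e; rewrite /fn_hat_in comp_lfunDr -comp_lfunZr linearP. Qed.
HB.instance Definition _ U := GRing.isLinear.Build K
  'Hom(subvs_of fn_m, subvs_of U) 'End(n) _ (@fn_hat_in U) (@fn_hat_in_linear U).

Lemma fn_hat_inE U d (u : subvs_of fn_m) : @fn_hat_in U d (vsval u) = vsval (d u).
Proof. by rewrite fn_hatE comp_lfunE lfunE. Qed.

Definition fn_Der j : {vspace 'End(n)} := limg (linfun (@fn_hat_in (fn_mpow j))).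

Definition fn_Der10 : {vspace 'End(n)} :=
  (linfun (@fn_hat_in fn_m) @: lfun_sl (subvs_of fn_m))%VS.

Definition fn_id : 'End(n) := fn_hat (fn_incl fn_m).

Definition fn_N : {vspace 'End(n)} := (\sum_(2 <= j < t.+1) fn_Der j)%VS.

Lemma fn_Der10P D :
  reflect (exists2 d : 'End(subvs_of fn_m), lfun_trace d = 0 & D = fn_hat_in d)
          (D \in fn_Der10).
Proof.
apply: (iffP memv_imgP) => [[d ds ->]|[d d0 ->]]; exists d.
- by apply/eqP; rewrite -memv_lfun_sl.
- by rewrite lfunE.
- by rewrite memv_lfun_sl d0.
- by rewrite lfunE.
Qed.

Lemma fn_Der10_der D : D \in fn_Der10 -> lie_der D.
Proof. by move=> /fn_Der10P[d _ ->]; apply: fn_hat_der. Qed.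

Lemma fn_Der10_comm D E :
  D \in fn_Der10 -> E \in fn_Der10 -> lfun_comm D E \in fn_Der10.
Proof.
move=> D1 E1; have /fn_Der10P[d d0 ED] := D1; have /fn_Der10P[e e0 EE] := E1.
apply/fn_Der10P; exists ((d \o e)%VF - (e \o d)%VF).
  by rewrite linearB /= lfun_traceC subrr.
apply: fn_hat_uniq => [|u]; first by apply: lie_der_comm; apply: fn_Der10_der.
rewrite lfun_commE ED EE !fn_hat_inE comp_lfunE lfunE /=.
by rewrite !lfunE /= !lfunE /= !lfunE.
Qed.

Lemma fn_idE (u : subvs_of fn_m) : fn_id (vsval u) = vsval u.
Proof. by rewrite fn_hatE lfunE. Qed.

Lemma fn_id_cent : der_cent fn_Der10 fn_id.
Proof.
split=> [|D D1]; first exact: fn_hat_der.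
have dD := fn_Der10_der D1; apply: lie_der_gen_inj.
- by apply: lie_der_comm => //; apply: fn_hat_der.
- by move=> x y; rewrite !lfunE /= lie0l lie0r addr0.
move=> i; have /fn_Der10P[d _ ->] := D1.
rewrite lfun_commE [RHS]lfunE /= -(vsprojK (mem_fn_gen i)).
by rewrite fn_idE fn_hat_inE fn_idE subrr.
Qed.

End FreeNilDer.

Section G2.
Variables (K : fieldType) (t : nat).
Local Notation n := (free_nil K t).
Local Notation S := (fn_Der10 K t).

(* The semidirect product of Der_1^0 n and n. The type is named because plain
   products carry the Lie structure of the direct sum of ideals. *)
Definition g2 : Type := (subvs_of S * n)%type.

HB.instance Definition _ := Vector.on g2.

Implicit Types p q r : g2.

Definition g2_br p q : g2 :=
  (vsproj S (lfun_comm (vsval p.1) (vsval q.1)),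
   vsval p.1 q.2 - vsval q.1 p.2 + [Lie p.2, q.2]).

Lemma g2_br1 p q : vsval (g2_br p q).1 = lfun_comm (vsval p.1) (vsval q.1).
Proof. by rewrite /= vsprojK // fn_Der10_comm ?subvsP. Qed.

Lemma g2_br2 p q :
  (g2_br p q).2 = vsval p.1 q.2 - vsval q.1 p.2 + [Lie p.2, q.2].
Proof. by []. Qed.

Lemma g2_eq p q : vsval p.1 = vsval q.1 -> p.2 = q.2 -> p = q.
Proof.
by case: p q => [p1 p2] [q1 q2] /= /val_inj -> ->.
Qed.

Let fstP a p q : vsval (a *: p + q).1 = a *: vsval p.1 + vsval q.1.
Proof. by []. Qed.
Let sndP a p q : (a *: p + q).2 = a *: p.2 + q.2.
Proof. by []. Qed.
Let fstD p q : vsval (p + q).1 = vsval p.1 + vsval q.1.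
Proof. by []. Qed.
Let sndD p q : (p + q).2 = p.2 + q.2.
Proof. by []. Qed.

Fact g2_brPl a p q r : g2_br (a *: p + q) r = a *: g2_br p r + g2_br q r.
Proof.
apply: g2_eq; first by rewrite fstP !g2_br1 fstP lfun_commPl.
rewrite sndP !g2_br2 fstP sndP liePl linearP add_lfunE scale_lfunE.
rewrite opprD !scalerDr scalerN (AC ((2*2)*2) (((1*3)*5)*((2*4)*6))) /=.
by [].
Qed.

Fact g2_brPr a p q r : g2_br r (a *: p + q) = a *: g2_br r p + g2_br r q.
Proof.
apply: g2_eq; first by rewrite fstP !g2_br1 fstP lfun_commPr.
rewrite sndP !g2_br2 fstP sndP liePr linearP add_lfunE scale_lfunE.
rewrite opprD !scalerDr scalerN (AC ((2*2)*2) (((1*3)*5)*((2*4)*6))) /=.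
by [].
Qed.

Fact g2_brxx p : g2_br p p = 0.
Proof.
apply: g2_eq; first by rewrite g2_br1 lfun_commxx linear0.
by rewrite /= subrr liexx addr0.
Qed.

Fact g2_jacobi p q r :
  g2_br p (g2_br q r) + g2_br q (g2_br r p) + g2_br r (g2_br p q) = 0.
Proof.
apply: g2_eq; first by rewrite !fstD !g2_br1 lfun_comm_jacobi linear0.
have dp := fn_Der10_der (subvsP p.1); have dq := fn_Der10_der (subvsP q.1).
have dr := fn_Der10_der (subvsP r.1).
rewrite !sndD !g2_br2 !g2_br1 !lfun_commE.
rewrite !linearD !linearN /= dp dq dr !lieDr !lieNr.
rewrite (lieC r.2 (vsval p.1 q.2)) (lieC (vsval q.1 r.2)) (lieC (vsval r.1 p.2)).
rewrite !opprK (AC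
  (((2*2)*2*(2*1))*((2*2)*2*(2*1))*((2*2)*2*(2*1)))
  ((1*23)*(15*2)*(10*5)*(6*20)*(24*11)*(19*14)*(4*17)*(22*8)*(13*26)
    *(3*25)*(7*12)*(16*21)*(9*18*27))) /=.
by rewrite !subrr jacobi !addr0.
Qed.

HB.instance Definition _ := isLie.Build K g2 g2_brPl g2_brPr g2_brxx g2_jacobi.

End G2.

(* L (+) K x with [x, u] = D u. *)
Definition der_ext (K : fieldType) (L : finLieType K) (D : 'End(L))
  (hD : lie_der D) : Type := (L * K^o)%type.

Section DerExt.
Variables (K : fieldType) (L : finLieType K) (D : 'End(L)) (hD : lie_der D).
Local Notation E := (der_ext hD).
Implicit Types p q r : E.

HB.instance Definition _ := Vector.on E.

Definition der_ext_br p q : E :=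
  ([Lie p.1, q.1] + ((p.2 : K) *: D q.1 - (q.2 : K) *: D p.1), 0).

Lemma der_ext_br1 p q : (der_ext_br p q).1 =
  [Lie p.1, q.1] + ((p.2 : K) *: D q.1 - (q.2 : K) *: D p.1).
Proof. by []. Qed.

Lemma der_ext_br2 p q : (der_ext_br p q).2 = 0.
Proof. by []. Qed.

Lemma der_ext_eq p q : p.1 = q.1 -> p.2 = q.2 -> p = q.
Proof. by case: p q => [p1 p2] [q1 q2] /= -> ->. Qed.

Let fstP a p q : (a *: p + q).1 = a *: p.1 + q.1.
Proof. by []. Qed.
Let sndP a p q : (a *: p + q).2 = a * p.2 + q.2.
Proof. by []. Qed.
Let fstD p q : (p + q).1 = p.1 + q.1.
Proof. by []. Qed.
Let sndD p q : (p + q).2 = p.2 + q.2.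
Proof. by []. Qed.

Fact der_ext_brPl a p q r :
  der_ext_br (a *: p + q) r = a *: der_ext_br p r + der_ext_br q r.
Proof.
apply: der_ext_eq; last by rewrite sndP mulr0 addr0.
rewrite fstP !der_ext_br1 fstP sndP liePl linearP.
rewrite !scalerDl !scalerDr !scalerN opprD !scalerA [a * r.2]mulrC.
by rewrite (AC (2*(2*2)) ((1*(3*5))*(2*(4*6)))).
Qed.

Fact der_ext_brPr a p q r :
  der_ext_br r (a *: p + q) = a *: der_ext_br r p + der_ext_br r q.
Proof.
apply: der_ext_eq; last by rewrite sndP mulr0 addr0.
rewrite fstP !der_ext_br1 fstP sndP liePr linearP.
rewrite !scalerDl !scalerDr !scalerN opprD !scalerA [a * r.2]mulrC.
by rewrite (AC (2*(2*2)) ((1*(3*5))*(2*(4*6)))).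
Qed.

Fact der_ext_brxx p : der_ext_br p p = 0.
Proof.
by apply: der_ext_eq; rewrite // der_ext_br1 liexx subrr addr0.
Qed.

Fact der_ext_jacobi p q r :
  der_ext_br p (der_ext_br q r) + der_ext_br q (der_ext_br r p)
    + der_ext_br r (der_ext_br p q) = 0.
Proof.
apply: der_ext_eq; last by rewrite !sndD !addr0.
rewrite !fstD !der_ext_br1 !der_ext_br2 !scale0r !subr0.
rewrite !linearD !linearN !linearZ /= !hD.
rewrite (lieC (D q.1) r.1) (lieC (D r.1) p.1) (lieC (D p.1) q.1).
rewrite !lieDr !lieZr !lieNr !scalerDr !scalerN (AC
  ((1*2*(2*2))*(1*2*(2*2))*(1*2*(2*2)))
  ((2*11)*(19*3)*(16*4)*(5*10)*(6*14)*(20*7)*(9*18)*(12*17)*(13*21)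
    *(1*8*15))) /=.
by rewrite !subrr jacobi !addr0.
Qed.

HB.instance Definition _ := isLie.Build K E
  der_ext_brPl der_ext_brPr der_ext_brxx der_ext_jacobi.

End DerExt.


Section GDelta.
Variables (K : fieldType) (t : nat) (d : 'End(free_nil K t)).
Hypothesis hd : der_cent (fn_Der10 K t) d.
Local Notation n := (free_nil K t).
Local Notation g2 := (g2 K t).

(* The action of x on g2: zero on Der_1^0 n, and id + delta on n. *)
Definition gdelta_fun (p : g2) : g2 := (0, (fn_id K t + d) p.2).

Fact gdelta_fun_linear : linear gdelta_fun.
Proof.
move=> a p q; apply: g2_eq; last exact: linearP.
by apply/esym/eqP; rewrite /= scaler0 addr0.
Qed.
HB.instance Definition _ :=
  GRing.isLinear.Build K g2 g2 _ gdelta_fun gdelta_fun_linear.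

Definition gdelta_ad : 'End(g2) := linfun gdelta_fun.

Fact gdelta_ad_der : lie_der gdelta_ad.
Proof.
have hE := der_centD (fn_id_cent K t) hd; have [dE _] := hE.
move=> p q; rewrite !lfunE; apply: g2_eq => /=.
  by rewrite lfun_comm0l lfun_comm0r !linear0 addr0.
rewrite linearD linearB /= dE !(der_centE _ hE (subvsP _)) !zero_lfunE.
by rewrite sub0r subr0 (AC (2*2) ((2*3)*(1*4))).
Qed.

Definition gdelta : finLieType K := der_ext gdelta_ad_der.

End GDelta.

(* Main.v *)
From HB Require Import structures.
From mathcomp Require Import all_boot all_order all_algebra.
From mathcomp Require Import boolp spectral generic_quotient ring.
From mathcomp Require Import reals complex.
Require Import Defs.

(** Let R be the radical of g, N its nilradical (a copy of the free nilpotent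
    algebra n on two generators), m the span of the generators of n, and
    S a Levi subalgebra, so that g = S + R.  The structure of g is read off the
    action of S on N, and three facts drive the argument.

    First, [g, R] is contained in N ([bracket_sub_nilradical]): the ideal [g, R]
    acts nilpotently in every representation ([lie_full_solvable_nil]), hence is
    nilpotent itself.  It follows that an element of R that maps N into [N, N]
    lies in N ([nil_element_mem]), because such an element acts nilpotently.

    Second, S is the direct sum of the ideal S0 of elements that map N into
    [N, N] and a complementary ideal S1 ([levi_split]).  The ideal S0 is perfect
    and acts nilpotently on R, so it acts by zero.  If S1 = 0, then S commutes
    with R and g is the direct sum of S and R: this is case a).

    Third, suppose that S1 is not zero.  By complete reducibility the generators
    of n can be moved inside n so that S stabilizes m ([adapted_embedding]).
    Then S1 acts faithfully on m by endomorphisms of trace zero.  As m has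
    dimension at most 2 and a nonzero perfect algebra has dimension at least 3,
    S1 is the whole of sl(m), and S1 + N is a copy of the algebra g2 ([sl2_iso],
    [assembly]).  Complete reducibility also gives a complement A of N in R that
    commutes with S.  An element of A acts on N / [N, N] by a scalar, since it
    commutes with sl(m) there ([ad_pull_scalar]), and only 0 acts by the
    scalar 0, because A meets N trivially.  Hence A has dimension at most 1.
    If A = 0 this is case b).  Otherwise A is spanned by an element that acts as
    the identity modulo [N, N], and this is case c).

    The structure theory behind these facts is developed from the definitions.
    It rests on two uses of traces.  A linear map all of whose positive powers
    have trace zero is nilpotent; with Engel's theorem this gives the nilpotent
    action of [g, R].  An endomorphism f is also nilpotent if the trace of f y
    vanishes, where y is a polynomial in f whose eigenvalues are the complex
    conjugates of those of f; this gives the criterion of Cartan ([cartan]), then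
    nondegenerate trace forms, Casimir operators, Weyl's theorem ([weyl_abs]) and
    the theorem of Levi ([levi]).

    Statements about the quotient by the radical are phrased inside g itself, as
    statements modulo R. *)

Set Implicit Arguments.
Unset Strict Implicit.
Unset Printing Implicit Defensive.

Import Order.TTheory GRing.Theory Num.Theory.
Local Open Scope ring_scope.
Local Open Scope quotient_scope.

(** * Interpolating conjugate eigenvalues by a polynomial in a matrix *)

(** The Chinese remainder theorem for the pairwise coprime polynomials
    (X - l)^N, with constant residues. *)
Lemma poly_chinese (K : fieldType) (s : seq K) (g : K -> K) N : uniq s ->
  exists q : {poly K}, forall l, l \in s -> ('X - l%:P) ^+ N %| q - (g l)%:P.
Proof.
elim: s => [_|a s IH /= /andP[as_ us]]; first by exists 0.
have [q qP] := IH us.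
pose p := \prod_(l <- s) ('X - l%:P) ^+ N.
have cop : coprimep p (('X - a%:P) ^+ N).
  rewrite /p big_seq; apply: (big_ind (fun p => coprimep p _)) => [|x y|l ls].
  - exact: coprime1p.
  - by move=> cx cy; rewrite coprimepMl cx.
  - apply/coprimep_expl/coprimep_expr/coprimep_XsubC2.
    by rewrite subr_eq0; apply: contraNneq as_ => ->.
have /Bezout_eq1_coprimepP[[u v] /= uv1] := cop.
exists (q + u * p * ((g a)%:P - q)) => l; rewrite in_cons => /predU1P[->|ls].
  have -> : q + u * p * ((g a)%:P - q) - (g a)%:P
    = (1 - u * p) * (q - (g a)%:P) by ring.
  by rewrite -uv1 addrAC subrr add0r mulrC mulrA dvdp_mull.
rewrite addrAC dvdp_add ?qP //.
apply/dvdp_mulr/dvdp_mull; rewrite /p (perm_big _ (perm_to_rem ls)) big_cons.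
exact: dvdp_mulr.
Qed.

Section Trigonal.
Variable K : numClosedFieldType.

Lemma trig_mulmx n (A B : 'M[K]_n) : is_trig_mx A -> is_trig_mx B ->
  is_trig_mx (A *m B) /\ forall i, (A *m B) i i = A i i * B i i.
Proof.
move=> /is_trig_mxP tA /is_trig_mxP tB; split=> [|i].
  apply/is_trig_mxP => i j ij; rewrite mxE big1 // => k _.
  have [ik|ki] := ltnP i k; first by rewrite tA // mul0r.
  by rewrite tB ?mulr0 // (leq_ltn_trans ki).
rewrite mxE (bigD1 i) //= big1 ?addr0 // => k ki.
have [ik|] := ltnP i k; first by rewrite tA // mul0r.
by rewrite leq_eqVlt val_eqE (negPf ki) => /= ik; rewrite tB ?mulr0.
Qed.

Lemma trig_horner n (T : 'M[K]_n.+1) p : is_trig_mx T ->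
  is_trig_mx (horner_mx T p) /\ forall i, (horner_mx T p) i i = p.[T i i].
Proof.
move=> tT; elim/poly_ind: p => [|p c [tp dp]].
  by rewrite rmorph0; split=> [|i]; rewrite ?mx0_is_trig // horner0 mxE.
have [tm dm] := trig_mulmx tp tT.
rewrite rmorphD rmorphM /= horner_mx_X horner_mx_C; split=> [|i].
  apply/is_trig_mxP => i j ij; rewrite mxE (is_trig_mxP tm) // add0r.
  exact: (is_trig_mxP (scalar_mx_is_trig _ _)).
by rewrite mxE dm dp hornerMXaddC [_%:M _ _]mxE eqxx mulr1n.
Qed.

Lemma mx_trig_form n (A : 'M[K]_n.+1) : exists P T : 'M[K]_n.+1,
  [/\ is_trig_mx T, P \in unitmx
    & forall p, horner_mx A p = invmx P *m horner_mx T p *m P].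
Proof.
have [//|P /unitarymx_unit uP tP] := @Schur K n.+1 A.
exists P, (P *m A *m invmx P); split=> //.
  by move: tP; rewrite /similar_to /= conjumx.
by move=> p; rewrite horner_mx_uconj // !mulmxA mulVmx // mul1mx mulmxKV.
Qed.

(** In a triangular form of a nilpotent matrix the diagonal entries are
    nilpotent, hence zero. *)
Lemma mx_nilp_trace n (A : 'M[K]_n) k : A ^+ k = 0 -> \tr A = 0.
Proof.
case: n A => [|n] A Ak0; first by rewrite flatmx0 mxtrace0.
have [P [T [tT uP AE]]] := mx_trig_form A.
have := AE 'X; rewrite horner_mx_X => ->.
rewrite mxtrace_mulC mulmxA mulmxV // mul1mx horner_mx_X.
have Tk0 : horner_mx T ('X^k) = 0.
  have := AE 'X^k; rewrite rmorphXn /= horner_mx_X Ak0.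
  move=> /(congr1 (fun M => P *m M *m invmx P)).
  by rewrite mulmx0 mul0mx !mulmxA mulmxV // mul1mx mulmxK.
rewrite /mxtrace big1 // => i _; have [_ /(_ i)] := trig_horner 'X^k tT.
by rewrite Tk0 mxE hornerXn => /esym/eqP; rewrite expf_eq0 => /andP[_ /eqP].
Qed.

(** The polynomial q takes the value conj(l), to order N, at each eigenvalue l of
    A.  So Y = q(A) acts by conj(l) on the generalized eigenvectors of
    eigenvalue l, and the trace of A Y is the sum of the l * conj(l) = |l|^2.  If
    this sum vanishes, all eigenvalues vanish. *)
Lemma mx_conj_part n (A : 'M[K]_n) N : exists q : {poly K},
  let Y := \sum_(i < size q) q`_i *: A ^+ i in
  (forall l (v : 'rV_n), v *m (A - l%:M) ^+ N = 0 -> v *m Y = l^* *: v)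
  /\ (\tr (A *m Y) = 0 -> exists k, A ^+ k = 0).
Proof.
case: n A => [|n] A.
  exists 0; split=> [l v _|_]; first by rewrite !thinmx0.
  by exists 0%N; rewrite flatmx0; apply/esym/flatmx0.
have [P [T [tT uP AE]]] := mx_trig_form A.
pose s := undup [seq T i i | i : 'I_n.+1].
(* The exponent N.+1 is positive, so that q takes the value conj(l) at l even
   if N = 0. *)
have [q qP] := @poly_chinese K s Num.conj N.+1 (undup_uniq _).
have hE (p : {poly K}) : \sum_(i < size p) p`_i *: A ^+ i = horner_mx A p.
  rewrite -[p in RHS]coefK poly_def linear_sum; apply: eq_bigr => i _.
  by rewrite linearZ rmorphXn /= horner_mx_X.
exists q; rewrite hE; split=> [l v vN|tr0].
  have [ls|ls] := boolP (l \in s).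
    have /dvdpP[h hq] := qP _ ls.
    have -> : q = ('X - l%:P) ^+ N * (h * ('X - l%:P)) + (l^*)%:P.
      by rewrite mulrCA -exprSr -hq subrK.
    rewrite rmorphD rmorphM rmorphXn rmorphB /= horner_mx_X !horner_mx_C.
    by rewrite mulmxDr mulmxA vN mul0mx add0r mul_mx_scalar.
  (* If l is not an eigenvalue, Cayley-Hamilton makes A - l invertible and v = 0. *)
  have cop : coprimep (char_poly A) (('X - l%:P) ^+ N).
    apply: coprimep_expr; rewrite coprimep_XsubC.
    rewrite -eigenvalue_root_char; apply: contra ls => /eigenvalueP[w wA w0].
    have {wA} wT : w *m invmx P *m T = l *: (w *m invmx P).
      have := AE 'X; rewrite !horner_mx_X => AT.
      by rewrite scalemxAl -wA AT !mulmxA mulmxK // mulmxKV.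
    have w'0 : w *m invmx P != 0.
      by apply: contraNneq w0 => w0; rewrite -[w](mulmxKV uP) w0 mul0mx.
    have : root (char_poly T) l.
      by rewrite -eigenvalue_root_char; apply/eigenvalueP; exists (w *m invmx P).
    rewrite char_poly_trig // -(big_map (fun i => T i i) xpredT (fun x => 'X - x%:P)).
    by rewrite root_prod_XsubC mem_undup /image_mem enumT.
  have /Bezout_eq1_coprimepP[[u w] /= /(congr1 (horner_mx A))] := cop.
  rewrite rmorphD !rmorphM rmorph1 /= Cayley_Hamilton mulr0 add0r.
  rewrite rmorphXn rmorphB /= horner_mx_X !horner_mx_C => /(congr1 (mulmx v)).
  rewrite mulmx1 => <-.
  have cm : GRing.comm (horner_mx A w) ((A - l%:M) ^+ N).
    have := comm_horner_mx2 A w (('X - l%:P) ^+ N).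
    by rewrite rmorphXn rmorphB /= horner_mx_X !horner_mx_C.
  by rewrite cm [v *m _]mulmxA vN !mul0mx scaler0.
exists n.+1; have {}tr0 : \sum_i T i i * (T i i)^* = 0.
  have AqE : A *m horner_mx A q = horner_mx A ('X * q).
    by rewrite rmorphM /= horner_mx_X.
  rewrite -[RHS]tr0 AqE AE mxtrace_mulC mulmxA mulmxV // mul1mx.
  apply: eq_bigr => i _; have [_ ->] := trig_horner ('X * q) tT.
  rewrite hornerM hornerX; congr (_ * _).
  have iS : T i i \in s by rewrite mem_undup; apply: (image_f (fun i => T i i)).
  have /dvdpP[h /(congr1 (horner^~ (T i i)))] := qP _ iS.
  rewrite !hornerE subrr expr0n mulr0 => /eqP.
  by rewrite subr_eq0 => /eqP.
have T0 i : T i i = 0.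
  have /psumr_eq0P : forall j : 'I_n.+1, true -> 0 <= T j j * (T j j)^*.
    by move=> j _; apply: mul_conjC_ge0.
  move=> /(_ tr0 i isT)/eqP; rewrite mul_conjC_eq0 => /eqP //.
have chT : char_poly T = 'X^(n.+1).
  rewrite char_poly_trig // (eq_bigr (fun=> 'X)) => [|i _]; last by rewrite T0 subr0.
  by rewrite prodr_const card_ord.
have := Cayley_Hamilton T; rewrite chT => T1.
by have := AE 'X^(n.+1); rewrite T1 mulmx0 mul0mx rmorphXn /= horner_mx_X.
Qed.
End Trigonal.

(** * Fitting decomposition and generalized eigenvectors *)

Lemma linfun_ex (K : fieldType) (U V : vectType K) (f : U -> V) : linear f ->
  exists g : 'Hom(U, V), g =1 f.
Proof.
move=> fl; pose F := GRing.isLinear.Build K U V *:%R f fl.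
by exists (linfun (HB.pack f F : {linear U -> V})) => u; rewrite lfunE.
Qed.

Section VspaceOf.
Variables (K : fieldType) (V : vectType K).

(** A predicate that is closed under linear combinations is membership in a
    subspace: take a subspace of maximal dimension among those on which the
    predicate holds. *)
Lemma vspace_of (P : V -> Prop) : P 0 -> (forall a u v, P u -> P v -> P (a *: u + v)) ->
  exists U : {vspace V}, forall v, v \in U <-> P v.
Proof.
move=> P0 PL.
pose Q n := `[< exists2 U : {vspace V}, \dim U = n & forall v, v \in U -> P v >].
have exQ : exists n, Q n.
  exists 0%N; apply/asboolP; exists 0%VS => [|v]; first exact: dimv0.
  by rewrite memv0 => /eqP ->.
have leQ n : Q n -> (n <= \dim {:V})%N.
  by move=> /asboolP[U <- _]; apply/dimvS/subvf.
have [n /asboolP[U Un UP] nmax] := ex_maxnP exQ leQ.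
exists U => v; split=> [/UP //|Pv].
have PUv : forall w, w \in (<[v]> + U)%VS -> P w.
  move=> _ /memv_addP[_ /vlineP[a ->] [u /UP Pu ->]]; exact: PL.
have /nmax : Q (\dim (<[v]> + U)) by apply/asboolP; exists (<[v]> + U)%VS.
rewrite -Un => dU; have /eqP EU : U == (<[v]> + U)%VS by rewrite eqEdim addvSr.
by rewrite EU; apply: (subvP (addvSl _ _)); apply: memv_line.
Qed.

End VspaceOf.

Section Fitting.
Variables (K : fieldType) (V : vectType K).
Implicit Types (f g : 'End(V)) (U X : {vspace V}) (v : V).

Definition lpow f k : 'End(V) := iter k (comp_lfun f) \1%VF.

Lemma lpowE f k v : lpow f k v = iter k f v.
Proof. by elim: k => [|k IH]; rewrite /= ?id_lfunE // comp_lfunE IH. Qed.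

Definition lfun_nilp f := exists k, forall v, iter k f v = 0.

Lemma iter_lin0 f k : iter k f 0 = 0.
Proof. by rewrite -lpowE linear0. Qed.

Lemma iter_eq0_leq f j k v : (j <= k)%N -> iter j f v = 0 -> iter k f v = 0.
Proof. by move=> /subnK <- jv; rewrite iterD jv iter_lin0. Qed.

(** The kernels of the powers of f increase; k is chosen where they have become
    stationary, so that the kernel and the image of f^k are complementary in
    every stable subspace U. *)
Lemma fitting f U : (forall v, v \in U -> f v \in U) ->
  exists k, [/\ (0 < k)%N, forall v, v \in U -> exists w u,
      [/\ w \in U, u \in U, v = w + iter k f u & iter k f w = 0]
    & forall j v, iter j f v = 0 -> iter k f v = 0].
Proof.
move=> fU.
pose Q n := `[< exists k, \dim (lker (lpow f k)) = n >].
have exQ : exists n, Q n by exists (\dim (lker (lpow f 0))); apply/asboolP; exists 0%N.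
have leQ n : Q n -> (n <= \dim {:V})%N.
  by move=> /asboolP[U' <-]; apply/dimvS/subvf.
have [n /asboolP[k' Ek'] nmax] := ex_maxnP exQ leQ.
(* The successor makes k positive, so that the image of f^k lies in that of f. *)
pose k := k'.+1; exists k.
have Ek : \dim (lker (lpow f k)) = n.
  apply/eqP; rewrite eqn_leq nmax; last by apply/asboolP; exists k.
  rewrite -Ek' dimvS //; apply/subvP => v; rewrite !memv_ker !lpowE => /eqP v0.
  by rewrite /= v0 linear0.
have k2 j v : iter j f v = 0 -> iter k f v = 0.
  have sub : (lker (lpow f k) <= lker (lpow f (j + k)))%VS.
    apply/subvP => w; rewrite !memv_ker !lpowE iterD => /eqP ->.
    by rewrite iter_lin0.
  have /eqP Ek2 : lker (lpow f k) == lker (lpow f (j + k)).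
    by rewrite eqEdim sub Ek nmax //; apply/asboolP; exists (j + k)%N.
  move=> v0; apply/eqP; rewrite -lpowE -memv_ker Ek2 memv_ker lpowE.
  by apply/eqP; apply: iter_eq0_leq v0; apply: leq_addr.
split=> // v vU; set F := lpow f k in Ek.
have fkU w : w \in U -> iter k f w \in U by move=> wU; elim: (k) => //= i; apply: fU.
have FU : (F @: U <= U)%VS.
  by apply/subvP => _ /memv_imgP[w wU ->]; rewrite lpowE fkU.
have dir : ((U :&: lker F) :&: (F @: U) = 0)%VS.
  apply/eqP; rewrite -subv0; apply/subvP => w; rewrite memv0 !memv_cap.
  move=> /andP[/andP[_ wk] /memv_imgP[u _ wE]]; move: wk; rewrite wE memv_ker !lpowE.
  by rewrite -iterD => /eqP/k2 ->.
have EU : (U :&: lker F + F @: U)%VS = U.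
  apply/eqP; rewrite eqEdim subv_add capvSl FU /=.
  by rewrite dimv_disjoint_sum // limg_ker_dim.
have : v \in (U :&: lker F + F @: U)%VS by rewrite EU.
move=> /memv_addP[w]; rewrite memv_cap memv_ker => /andP[wU /eqP w0].
move=> [_ /memv_imgP[u uU ->] ->]; exists w, u; split=> //; first by rewrite lpowE.
by rewrite -lpowE.
Qed.

Definition shift f l : 'End(V) := f - l *: \1%VF.
Lemma shiftE f l v : shift f l v = f v - l *: v.
Proof. by rewrite /shift add_lfunE opp_lfunE scale_lfunE id_lfunE. Qed.
End Fitting.

HB.instance Definition _ (K : fieldType) (V : vectType K) (e : (\dim {:V}).-tuple V) :=
  GRing.isLinear.Build K V 'rV[K]_(\dim {:V}) _ (passmx.rVof e) (passmx.rVof_linear e).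
HB.instance Definition _ (K : fieldType) (V : vectType K) (e : (\dim {:V}).-tuple V) :=
  GRing.isLinear.Build K 'rV[K]_(\dim {:V}) V _ (passmx.vecof e) (passmx.vecof_linear e).
HB.instance Definition _ (K : fieldType) (U V : vectType K)
  (e : (\dim {:U}).-tuple U) (e' : (\dim {:V}).-tuple V) :=
  GRing.isLinear.Build K 'Hom(U, V) 'M[K]_(\dim {:U}, \dim {:V}) _
    (passmx.mxof e e') (passmx.mxof_linear e e').

Section ClosedLin.
Variables (K : numClosedFieldType) (V : vectType K).
Implicit Types (f g : 'End(V)) (U X : {vspace V}) (v : V).

Local Notation e := (vbasis {:V}).
Let eb : basis_of {:V} e := vbasisP _.
Local Notation mx f := (passmx.mxof e e f).

Lemma rVof_iter f k v : passmx.rVof e (iter k f v) = passmx.rVof e v *m (mx f) ^+ k.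
Proof.
elim: k => [|k IH]; first by rewrite expr0 mulmx1.
by rewrite /= (passmx.rVof_app _ eb) IH exprSr mulmxA.
Qed.

Lemma lfun_nilp_mx f k : (mx f) ^+ k = 0 -> lfun_nilp f.
Proof.
move=> fk; exists k => v; apply/eqP; rewrite -(passmx.rVof_eq0 eb) rVof_iter fk.
by rewrite mulmx0.
Qed.

Lemma lfun_nilp_trace f : lfun_nilp f -> lfun_trace f = 0.
Proof.
move=> [k fk]; apply: (@mx_nilp_trace _ _ _ k).
apply/row_matrixP => i; rewrite rowE row0.
by rewrite -(passmx.vecofK eb (delta_mx 0 i)) -rVof_iter fk; apply/eqP; rewrite passmx.rVof_eq0.
Qed.

Lemma conj_part f N : exists (q : {poly K}) (y : 'End(V)),
  [/\ forall v, y v = \sum_(i < size q) q`_i *: iter i f v,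
      forall l v, iter N (shift f l) v = 0 -> y v = l^* *: v
    & lfun_trace (f \o y)%VF = 0 -> lfun_nilp f].
Proof.
have [q [qv qt]] := mx_conj_part (mx f) N; exists q.
set Y := \sum_(i < _) _ in qv qt; exists (passmx.hommx e e Y); split.
- move=> v; apply: (can_inj (passmx.rVofK eb)).
  rewrite -(passmx.rVof_mul eb eb) mulmx_sumr linear_sum.
  by apply: eq_bigr => i _; rewrite [RHS]linearZ /= rVof_iter scalemxAr.
- move=> l v lv; apply: (can_inj (passmx.rVofK eb)).
  rewrite -(passmx.rVof_mul eb eb) linearZ /=.
  apply: qv; have := rVof_iter (shift f l) N v; rewrite lv linear0 => E; rewrite [RHS]E.
  congr (_ *m _ ^+ N); rewrite /shift linearB linearZ /= passmx.mxof1 ?(basis_free eb) //.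
  by rewrite scalemx1.
rewrite lfun_traceC /lfun_trace (passmx.mxof_comp _ _ eb) passmx.hommxK //.
by move=> /qt[k]; apply: lfun_nilp_mx.
Qed.

(** The conjugate part of f is a polynomial in f, so its product with f is a
    combination of positive powers of f and has trace zero. *)
Lemma lfun_nilp_of_trace f :
  (forall m, lfun_trace (f \o lpow f m)%VF = 0) -> lfun_nilp f.
Proof.
move=> tr0; have [q [y [yE _ yt]]] := conj_part f 0; apply: yt.
have -> : y = \sum_(i < size q) q`_i *: lpow f i.
  apply/lfunP => v; rewrite yE sum_lfunE; apply: eq_bigr => i _.
  by rewrite scale_lfunE lpowE.
elim: (size q) => [|n IH]; first by rewrite big_ord0 comp_lfun0r linear0.
rewrite big_ord_recr comp_lfunDr linearD /= IH add0r.
by rewrite -comp_lfunZr linearZ /= tr0 scaler0.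
Qed.

Lemma eigenvector_in f U : (forall v, v \in U -> f v \in U) -> U != 0%VS ->
  exists l v, [/\ v \in U, v != 0 & f v = l *: v].
Proof.
move=> fU U0.
pose g : 'End(subvs_of U) := linfun (vsproj U \o f \o vsval).
have gE w : vsval (g w) = f (vsval w).
  by rewrite lfunE /= vsprojK // fU ?subvsP.
pose b := vbasis {: subvs_of U}; have bb : basis_of {: subvs_of U} b := vbasisP _.
have d0 : (0 < \dim {: subvs_of U})%N.
  by rewrite dimvf lt0n /dim /= dimv_eq0.
have [l] : exists l, eigenvalue (passmx.mxof b b g) l.
  have /closed_rootP[l rl] : size (char_poly (passmx.mxof b b g)) != 1%N.
    by rewrite size_char_poly eqSS -lt0n.
  by exists l; rewrite eigenvalue_root_char.
move=> /eigenvalueP[w wE w0].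
exists l, (vsval (passmx.vecof b w)); split; first exact: subvsP.
  by rewrite (inj_eq val_inj (_ : subvs_of U) 0) passmx.vecof_eq0.
rewrite -gE (passmx.hom_vecof _ bb) wE linearZ //=.
Qed.

(** Over an algebraically closed field a stable subspace is spanned by the
    generalized eigenvectors that it contains, with a common bound N on their
    exponents.  At an eigenvalue l, the Fitting decomposition of f - l splits off
    the generalized eigenspace; the rest has smaller dimension. *)
Lemma geig_span f U : (forall v, v \in U -> f v \in U) ->
  exists N, forall X, (forall l u, u \in U -> iter N (shift f l) u = 0 -> u \in X) ->
    (U <= X)%VS.
Proof.
have [n] := ubnP (\dim U); elim: n U => // n IH U Un fU.
have [->|U0] := eqVneq U 0%VS; first by exists 0%N => X _; apply: sub0v.
have [l [v [vU v0 fv]]] := eigenvector_in fU U0.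
have shU u : u \in U -> shift f l u \in U.
  by move=> uU; rewrite shiftE rpredB ?rpredZ ?fU.
have [k [_ kdec k2]] := fitting shU.
have shc u j : f (iter j (shift f l) u) = iter j (shift f l) (f u).
  elim: j => //= j IHj; rewrite -IHj !shiftE linearB linearZ /=; done.
pose U' := (lpow (shift f l) k @: U)%VS.
have U'U : (U' <= U)%VS.
  apply/subvP => _ /memv_imgP[u uU ->]; rewrite lpowE.
  by elim: (k) => //= j; apply: shU.
have fU' u : u \in U' -> f u \in U'.
  by move=> /memv_imgP[w wU ->]; rewrite lpowE shc -lpowE memv_img // fU.
have U'n : (\dim U' < n)%N.
  apply: (@leq_trans (\dim U)); last by rewrite -ltnS.
  rewrite ltn_neqAle dimvS // andbT.
  apply/negP => /eqP dE; have /eqP EU : U' == U by rewrite eqEdim U'U dE /=.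
  have : v \in U' by rewrite EU.
  move=> /memv_imgP[w wU]; rewrite lpowE => vE.
  have /k2 : iter (1 + k) (shift f l) w = 0.
    by rewrite iterD -vE /= shiftE fv subrr.
  by rewrite -vE => v00; rewrite v00 eqxx in v0.
have [N HN] := IH U' U'n fU'.
exists (maxn k N) => X HX; apply/subvP => u uU.
have [w [z [wU zU -> wk]]] := kdec u uU; apply: rpredD.
  by apply: (HX l) => //; apply: iter_eq0_leq wk; apply: leq_maxl.
have /subvP : (U' <= X)%VS; last by apply; rewrite -lpowE memv_img.
apply: HN => l' u' u'U' u'0; apply: (HX l'); first exact: (subvP U'U).
by apply: iter_eq0_leq u'0; apply: leq_maxr.
Qed.
End ClosedLin.

(** * Representations, nilpotent actions and the theorem of Engel *)

Record lierep (K : fieldType) (L : finLieType K) (V : vectType K) := LieRep {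
  act :> L -> V -> V;
  act_linl : forall a x y v, act (a *: x + y) v = a *: act x v + act y v;
  act_linr : forall a x u v, act x (a *: u + v) = a *: act x u + act x v;
  act_br : forall x y v, act [Lie x, y] v = act x (act y v) - act y (act x v) }.

Section Reps.
Variables (K : fieldType) (L : finLieType K) (V : vectType K) (r : lierep L V).
Implicit Types (x y : L) (u v : V) (S H : {vspace L}) (U W : {vspace V}).

HB.instance Definition _ x := GRing.isLinear.Build K V V _ (act r x)
  (fun a u v => act_linr r a x u v).

Definition actl v x := r x v.
HB.instance Definition _ v := GRing.isLinear.Build K L V _ (actl v)
  (fun a x y => act_linl r a x y v).

Lemma actDl x y v : r (x + y) v = r x v + r y v.
Proof. exact: (linearD (actl v)). Qed.
Lemma actBl x y v : r (x - y) v = r x v - r y v.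
Proof. exact: (linearB (actl v)). Qed.
Lemma actZl a x v : r (a *: x) v = a *: r x v.
Proof. by rewrite -[LHS]/(actl v _) linearZ. Qed.
Lemma act0l v : r 0 v = 0.
Proof. exact: (linear0 (actl v)). Qed.

Lemma act0r x : r x 0 = 0. Proof. exact: linear0. Qed.
Lemma actZr a x v : r x (a *: v) = a *: r x v.
Proof. by rewrite -[a *: v]addr0 act_linr act0r addr0. Qed.
Lemma actDr x u v : r x (u + v) = r x u + r x v. Proof. exact: linearD. Qed.
Lemma actBr x u v : r x (u - v) = r x u - r x v. Proof. exact: linearB. Qed.

Definition act_op x : 'End(V) := linfun (r x).
Lemma act_opE x v : act_op x v = r x v. Proof. exact: lfunE. Qed.

Lemma act_op_linear : linear act_op.
Proof.
by move=> a x y; apply/lfunP => v; rewrite act_opE add_lfunE scale_lfunE !act_opE act_linl.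
Qed.
HB.instance Definition _ := GRing.isLinear.Build K L 'End(V) _ act_op act_op_linear.

Lemma act_op_br x y : act_op [Lie x, y] = (act_op x \o act_op y)%VF - (act_op y \o act_op x)%VF.
Proof.
by apply/lfunP => v; rewrite add_lfunE opp_lfunE !comp_lfunE !act_opE act_br.
Qed.

Definition actv S U : {vspace V} :=
  <<[seq r x u | x <- vbasis S, u <- vbasis U]>>%VS.

Lemma actv_sub S U W : (forall x u, x \in S -> u \in U -> r x u \in W) ->
  (actv S U <= W)%VS.
Proof.
move=> sub; apply/span_subvP => _ /allpairsP[[x u] /= [xS uU ->]].
by apply: sub; apply: vbasis_mem.
Qed.

Lemma memv_act S U x u : x \in S -> u \in U -> r x u \in actv S U.
Proof.
move=> xS uU; rewrite (coord_vbasis xS) -[r _ u]/(actl u _) linear_sum.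
apply: rpred_sum => i _ /=; rewrite linearZ /= rpredZ // /actl (coord_vbasis uU).
rewrite linear_sum; apply: rpred_sum => j _; rewrite linearZ rpredZ //.
by rewrite memv_span // allpairs_f ?mem_nth ?size_tuple.
Qed.

Lemma actvS S S' U U' : (S <= S')%VS -> (U <= U')%VS -> (actv S U <= actv S' U')%VS.
Proof.
move=> /subvP SS /subvP UU; apply: actv_sub => x u xS uU.
by apply: memv_act; [apply: SS|apply: UU].
Qed.

Definition act_chain S k : {vspace V} := iter k (actv S) {:V}%VS.

Definition acts_nil S := exists k, act_chain S k = 0%VS.

Lemma mem_act_chainS S k x v : x \in S -> v \in act_chain S k -> r x v \in act_chain S k.+1.
Proof. exact: memv_act. Qed.

Lemma act_chain_leq S j k : (j <= k)%N -> (act_chain S k <= act_chain S j)%VS.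
Proof.
elim: j k => [|j IH] [|k] //; first by rewrite subvf.
by rewrite ltnS => jk; apply: actvS => //; apply: IH.
Qed.

Lemma act_chain_sub S k (F : nat -> {vspace V}) : F 0%N = {:V}%VS ->
  (forall i x v, x \in S -> v \in F i -> r x v \in F i.+1) -> (act_chain S k <= F k)%VS.
Proof.
move=> F0 FS; elim: k => [|k /subvP IH]; first by rewrite F0.
by apply: actv_sub => x v xS /IH; apply: FS.
Qed.

Lemma acts_nilS S S' : (S <= S')%VS -> acts_nil S' -> acts_nil S.
Proof.
move=> SS [k k0]; exists k; apply/eqP; rewrite -subv0 -k0.
by elim: k {k0} => //= k IH; apply: actvS.
Qed.

Lemma act_chain_norm S y k v : (forall h, h \in S -> [Lie y, h] \in S) ->
  v \in act_chain S k -> r y v \in act_chain S k.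
Proof.
move=> yS; elim: k v => [|k IH] v; first by move=> _; apply: memvf.
rewrite -(act_opE y) memv_preim; move: v; apply/subvP/actv_sub => x u xS uk.
rewrite -memv_preim act_opE.
have -> : r y (r x u) = r [Lie y, x] u + r x (r y u) by rewrite act_br subrK.
by rewrite rpredD // mem_act_chainS ?yS ?IH.
Qed.

(** If y normalizes S, it preserves the chain V, S V, S (S V), ...; on each
    quotient of consecutive terms S acts by zero, so that n applications of
    S + <y>, where y^n = 0, lead from one term into the next. *)
Lemma nil_extend S y : acts_nil S -> (forall h, h \in S -> [Lie y, h] \in S) ->
  lfun_nilp (act_op y) -> acts_nil (S + <[y]>).
Proof.
move=> [k k0] yS [n n0]; exists (n * k)%N; apply/eqP; rewrite -subv0 -k0 {k0}.
elim: k => [|k IH]; first by rewrite muln0.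
pose T := (S + <[y]>)%VS.
have step j : (iter j (actv T) (act_chain S k) <=
    act_chain S k.+1 + lpow (act_op y) j @: act_chain S k)%VS.
  elim: j => [|j IHj].
    by apply: subv_trans (addvSr _ _); rewrite lim1g.
  apply: actv_sub => x v /memv_addP[h hS [_ /vlineP[c ->] ->]] /(subvP IHj).
  move=> /memv_addP[w wk [_ /memv_imgP[u uk ->] ->]]; rewrite lpowE.
  have uk' : iter j (act_op y) u \in act_chain S k.
    by elim: (j) => //= i; rewrite act_opE; apply: act_chain_norm.
  have wk' := subvP (act_chain_leq S (leqnSn k)) _ wk.
  rewrite actDl actZl !linearD /= addrA.
  apply: memv_add.
    have cw : r y w \in act_chain S k.+1 by apply: act_chain_norm.
    by apply: rpredD; [apply: rpredD; apply: memv_act | apply: rpredZ].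
  by rewrite rpredZ // -act_opE -[act_op y _]/(iter j.+1 (act_op y) u) -lpowE memv_img.
have last_sub : (iter n (actv T) (act_chain S k) <= act_chain S k.+1)%VS.
  apply: subv_trans (step n) _; rewrite subv_add subvv /=.
  by apply/subvP => _ /memv_imgP[u _ ->]; rewrite lpowE n0 mem0v.
apply: subv_trans last_sub; rewrite mulnSr addnC /act_chain; set m := (n * k)%N.
rewrite iterD; elim: (n) => [|i IHi]; first exact: IH.
exact: actvS.
Qed.

(** A product x y - y x of two elements of P moves two steps down the chain.  As P
    is spanned by brackets, the chain is constant from the first term on, and it
    reaches zero. *)
Lemma perfect_nil P : (P <= liev P P)%VS -> acts_nil P ->
  forall x v, x \in P -> r x v = 0.
Proof.
move=> PP [k k0] x v xP.
have step i : (act_chain P i.+1 <= act_chain P i.+2)%VS.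
  apply: actv_sub => y u /(subvP PP) yP ui; rewrite -[r y u]/(actl u y) -lfunE memv_preim.
  move: y yP; apply/subvP/liev_sub => a b aP bP.
  by rewrite -memv_preim lfunE /= /actl act_br; apply: rpredB; do 2!apply: memv_act => //.
have : (act_chain P 1 <= act_chain P k)%VS.
  case: (k) => [|i]; first exact: subvf.
  by elim: i => // i IH; apply: subv_trans IH (step i).
rewrite k0 subv0 => /eqP c0; apply/eqP; rewrite -memv0 -c0.
by apply: mem_act_chainS => //; apply: memvf.
Qed.

End Reps.

Section Adjoint.
Variables (K : fieldType) (L : finLieType K).

Definition ad_rep : lierep L L.
refine (@LieRep K L L (fun x y => [Lie x, y]) _ _ _).
- by move=> a x y v; rewrite liePl.
- by move=> a x u v; rewrite liePr.
- by move=> x y v; rewrite (jacobiD x y v) addrK.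
Defined.

Lemma ad_repE x y : ad_rep x y = [Lie x, y]. Proof. by []. Qed.

Lemma lievS (S S' U U' : {vspace L}) :
  (S <= S')%VS -> (U <= U')%VS -> (liev S U <= liev S' U')%VS.
Proof. exact: (@actvS _ _ _ ad_rep). Qed.

Lemma liev_ideal (I J : {vspace L}) : lie_ideal I -> lie_ideal J -> lie_ideal (liev I J).
Proof.
move=> II JJ x y; rewrite -(ad_repE x) -act_opE memv_preim; move: y.
apply/subvP/liev_sub => u v uI vJ; rewrite -memv_preim act_opE /= jacobiD.
by rewrite rpredD ?memv_lie ?II ?JJ.
Qed.

Definition derived (U : {vspace L}) := liev U U.

Lemma derived_ideal k (I : {vspace L}) : lie_ideal I -> lie_ideal (iter k derived I).
Proof. by move=> II; elim: k => //= k IH; apply: liev_ideal. Qed.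

Lemma lie_idealr (I : {vspace L}) x y : lie_ideal I -> x \in I -> [Lie x, y] \in I.
Proof. by move=> II xI; rewrite lieC rpredN II. Qed.

Lemma ideal0 : lie_ideal (0 : {vspace L})%VS.
Proof. by move=> x y; rewrite memv0 => /eqP ->; rewrite lie0r mem0v. Qed.

Lemma idealf : lie_ideal (fullv : {vspace L}).
Proof. by move=> x y _; apply: memvf. Qed.

Lemma derived_sub k (I : {vspace L}) : lie_ideal I -> (iter k derived I <= I)%VS.
Proof.
move=> II; elim: k => //= k IH; apply: subv_trans IH.
by apply: liev_sub => u v _ vI; apply: derived_ideal.
Qed.

Lemma derivedS k (I J : {vspace L}) :
  (I <= J)%VS -> (iter k derived I <= iter k derived J)%VS.
Proof. by move=> IJ; elim: k => //= k IH; apply: lievS. Qed.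

End Adjoint.

Section Engel.
Variables (K : fieldType) (L : finLieType K) (V : vectType K) (r : lierep L V).

Definition subalg (S : {vspace L}) := forall x y, x \in S -> y \in S -> [Lie x, y] \in S.

(** Among the subalgebras of S that act nilpotently and contain the kernel K0 of
    the action, take H of maximal dimension.  If H is not S, some element of S
    outside H normalizes H, and adding it contradicts maximality by
    [nil_extend]. *)
Lemma engel (S : {vspace L}) : subalg S ->
  (forall x, x \in S -> lfun_nilp (act_op r x)) ->
  acts_nil r S.
Proof.
move=> SS Snil.
have [K0 K0P] : exists U : {vspace L}, forall x, x \in U <-> x \in S /\ forall v, r x v = 0.
  apply: vspace_of => [|a x y [xS x0] [yS y0]].
    by split=> [|v]; rewrite ?mem0v ?act0l.
  split=> [|v]; first by rewrite rpredD ?rpredZ.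
  by rewrite act_linl x0 y0 scaler0 addr0.
pose good (H : {vspace L}) := [/\ (K0 <= H)%VS, (H <= S)%VS, subalg H & acts_nil r H].
pose Q n := `[< exists2 H, good H & \dim H = n >].
have exQ : exists n, Q n.
  exists (\dim K0); apply/asboolP; exists K0 => //; split=> //.
  - by apply/subvP => x /K0P[].
  - move=> x y /K0P[xS x0] /K0P[yS y0]; apply/K0P; split=> [|v]; first exact: SS.
    by rewrite act_br x0 y0 subrr.
  - exists 1%N; apply/eqP; rewrite -subv0; apply: actv_sub => x v /K0P[_ ->] _.
    exact: mem0v.
have leQ n : Q n -> (n <= \dim {:L})%N.
  by move=> /asboolP[H _ <-]; apply/dimvS/subvf.
have [n /asboolP[H [KH HS HH Hnil] Hn] nmax] := ex_maxnP exQ leQ.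
have [SH|SH] := boolP (S <= H)%VS; first exact: acts_nilS SH Hnil.
have [k k0] := Hnil.
pose T i := iter i (liev H) S.
have TS i : (T i <= S)%VS.
  elim: i => //= i IH; apply: liev_sub => h x hH /(subvP IH) xS.
  by apply: SS => //; apply: (subvP HS).
have chnk0 i : (k <= i)%N -> act_chain r H i = 0%VS.
  by move=> ki; apply/eqP; rewrite -subv0 -k0 act_chain_leq.
(* Iterated brackets of S with elements of H move down the chain of H by
   arbitrarily many steps, and so eventually act by zero; this yields T j
   inside K0. *)
have TF m x : x \in T m -> forall i v, v \in act_chain r H i ->
    r x v \in act_chain r H (i + m - k).
  have [F FP] : exists U : {vspace L}, forall x, x \in U <->
      forall i v, v \in act_chain r H i -> r x v \in act_chain r H (i + m - k).
    apply: vspace_of => [i v _|a y z Py Pz i v vi]; first by rewrite act0l mem0v.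
    by rewrite act_linl rpredD ?rpredZ ?Py ?Pz.
  move=> xT; apply/FP; move: x xT; apply/subvP.
  elim: m F FP => [|m IH] F FP.
    apply/subvP => x _; apply/FP => i v vi; rewrite addn0.
    have [ik|ki] := leqP i k; first by rewrite (eqnP ik) memvf.
    by move: vi; rewrite chnk0 ?memv0 1?ltnW // => /eqP ->; rewrite linear0 mem0v.
  have [G GP] : exists U : {vspace L}, forall x, x \in U <->
      forall i v, v \in act_chain r H i -> r x v \in act_chain r H (i + m - k).
    apply: vspace_of => [i v _|a y z Py Pz i v vi]; first by rewrite act0l mem0v.
    by rewrite act_linl rpredD ?rpredZ ?Py ?Pz.
  apply: liev_sub => h x hH /(subvP (IH G GP))/GP xG; apply/FP => i v vi.
  rewrite act_br rpredB //.
    apply: (subvP (act_chain_leq _ _ _)) (mem_act_chainS hH (xG i v vi)).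
    by rewrite addnS leq_subLR addnS ltnS -leq_subLR.
  by rewrite addnS -addSn xG // mem_act_chainS.
have [j] : exists j, (T j <= H)%VS.
  exists (k + k)%N; apply: subv_trans KH; apply/subvP => x xT; apply/K0P.
  split=> [|v]; first exact: (subvP (TS _)) xT.
  by have := TF _ _ xT 0%N v (memvf v); rewrite add0n addKn k0 memv0 => /eqP.
(* At the last j with T j not inside H, [H, T j] lies in H. *)
elim: j => [TH|j IHj TjH]; first by rewrite TH in SH.
have [/IHj //|/subvPn[y yT yH]] := boolP (T j <= H)%VS.
have yS := subvP (TS j) y yT.
have Hy h : h \in H -> [Lie y, h] \in H.
  by move=> hH; rewrite lieC rpredN; apply: (subvP TjH); apply: memv_lie.
suff /nmax : Q (\dim (H + <[y]>)).
  rewrite -Hn => dH; have /eqP EH : H == (H + <[y]>)%VS by rewrite eqEdim addvSl.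
  by rewrite EH (subvP (addvSr _ _)) ?memv_line in yH.
apply/asboolP; exists (H + <[y]>)%VS => //; split.
- exact: subv_trans KH (addvSl _ _).
- by rewrite subv_add HS -memvE.
- move=> _ _ /memv_addP[h hH [_ /vlineP[c ->] ->]]
    /memv_addP[h' hH' [_ /vlineP[c' ->] ->]].
  apply: (subvP (addvSl _ _)); rewrite lieDl !lieDr !lieZr !lieZl liexx !scaler0 addr0.
  have hy : [Lie h, y] \in H by rewrite lieC rpredN Hy.
  apply: rpredD; [apply: rpredD|]; rewrite ?rpredZ ?hy ?Hy ?HH //.
- by apply: nil_extend => //; apply: Snil.
Qed.
End Engel.

(** * Trace arguments: solvable ideals and the criterion of Cartan *)

Section Commutators.
Variables (K : numClosedFieldType) (L : finLieType K) (V : vectType K).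
Variable r : lierep L V.
Implicit Types (A C B X P : {vspace L}).

Lemma linear_kernel (W : vectType K) (f : W -> K^o) : linear f ->
  exists U : {vspace W}, forall w, w \in U <-> f w = 0.
Proof.
move=> fl; have f0 : f 0 = 0.
  have := fl (-1) 0 0; rewrite scaler0 addr0 scaleN1r => E.
  by rewrite E addNr.
apply: vspace_of => // a u v u0 v0; by rewrite fl u0 v0 scaler0 addr0.
Qed.

(** For b in [C, A] the trace of b^m [c, a] is, up to sign, that of [a, b^m] c.
    The commutator of a with b^m is a sum of products that contain a factor [a, b]
    in X, so it moves one step down the chain of X, and the trace vanishes.  By
    linearity the positive powers of b have trace zero, and the theorem of Engel
    applies. *)
Lemma commutator_nil A C X : subalg (liev C A) -> lie_ideal X -> acts_nil r X ->
  (forall a b, a \in A -> b \in liev C A -> [Lie a, b] \in X) ->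
  acts_nil r (liev C A).
Proof.
move=> BB IX [k k0] ABX; apply: engel => // b bB; apply: lfun_nilp_of_trace => m.
have [U UP] := @linear_kernel L
  (fun z => lfun_trace (act_op r z \o lpow (act_op r b) m)%VF)
  ltac:(by move=> a x y; rewrite linearP comp_lfunDl -comp_lfunZl linearP).
apply/UP; move: b bB U UP => b bB U UP; apply: (subvP _ _ bB).
apply: liev_sub => c a cC aA; apply/UP; rewrite act_op_br.
set f := act_op r c; set g := act_op r a; set h := lpow _ m.
have -> : (((f \o g) - (g \o f)) \o h)%VF = ((f \o (g \o h)) - (g \o (f \o h)))%VF.
  by apply/lfunP => v; rewrite !(comp_lfunE, add_lfunE, opp_lfunE).
have trE : lfun_trace (g \o (f \o h))%VF = lfun_trace (f \o (h \o g))%VF.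
  by rewrite lfun_traceC comp_lfunA.
rewrite linearB /= trE -linearB /=.
apply: lfun_nilp_trace; exists k => v; apply/eqP; rewrite -memv0 -k0.
have comm i w : w \in act_chain r X i -> g (h w) - h (g w) \in act_chain r X i.+1.
  rewrite /h; elim: m {UP h trE} i w => [|m IH] i w wi.
    by rewrite !id_lfunE subrr mem0v.
  have hw : lpow (act_op r b) m w \in act_chain r X i.
    elim: (m) => [|j IHj]; first by rewrite id_lfunE.
    by rewrite comp_lfunE act_opE; apply: act_chain_norm => // x xX; apply: IX.
  have -> : g (lpow (act_op r b) m.+1 w) - lpow (act_op r b) m.+1 (g w) =
    r [Lie a, b] (lpow (act_op r b) m w)
    + r b (g (lpow (act_op r b) m w) - lpow (act_op r b) m (g w)).
    by rewrite act_br !comp_lfunE !act_opE !linearB /= addrA subrK.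
  apply: rpredD; first by apply: memv_act => //; apply: ABX.
  by apply: act_chain_norm; [move=> x xX; apply: IX | apply: IH].
elim: (k) => [|i IH]; first exact: memvf.
rewrite iterS; set w := iter i _ v in IH *.
rewrite add_lfunE opp_lfunE !comp_lfunE -linearB /= /f [act_op r c _]act_opE.
apply: (@act_chain_norm _ _ _ r X c i.+1); [by move=> x xX; apply: IX | exact: comm].
Qed.

End Commutators.

Section SolvableIdeal.
Variables (K : numClosedFieldType) (L : finLieType K) (V : vectType K).
Variable r : lierep L V.

Lemma ideal_subalg (I : {vspace L}) : lie_ideal I -> subalg I.
Proof. by move=> II x y _ yI; apply: II. Qed.

(** Two applications of [commutator_nil]: by induction [L, [R, R]] acts
    nilpotently, which controls [R, R], which in turn controls [L, R]. *)
Lemma lie_full_solvable_nil (R : {vspace L}) : lie_ideal R -> lie_solvable R ->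
  acts_nil r (liev fullv R).
Proof.
move=> IR [k]; elim: k R IR => [|k IH] R IR.
  move=> /= ->; exists 1%N; apply/eqP; rewrite -subv0; apply: actv_sub => x u.
  have /eqP -> : liev (fullv : {vspace L}) 0%VS == 0%VS.
    rewrite -subv0; apply: liev_sub => a b _; rewrite memv0 => /eqP ->.
    by rewrite lie0r mem0v.
  by rewrite !memv0 => /eqP -> _; rewrite act0l.
rewrite iterSr => Rk.
have ID := liev_ideal IR IR; have IF := liev_ideal (@idealf K L) IR.
have nD : acts_nil r (liev R R).
  apply: (@commutator_nil _ _ _ r R R (liev fullv (liev R R))).
  - exact: ideal_subalg.
  - exact: liev_ideal (@idealf K L) ID.
  - exact: IH.
  - by move=> a b _ bD; apply: memv_lie; rewrite ?memvf.
apply: (@commutator_nil _ _ _ r R fullv (liev R R)) => //.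
  exact: ideal_subalg.
move=> a b aR bF; apply: memv_lie => //; move: b bF; apply/subvP/liev_sub => x y _.
exact: IR.
Qed.

End SolvableIdeal.

Section Cartan.
Variables (K : numClosedFieldType) (L : finLieType K) (V : vectType K).
Variable r : lierep L V.

(** The generalized eigenvectors of x multiply: ad x - mu on b and x - l on v act
    as the two terms of the Leibniz rule for x - (l + mu). *)
Lemma shift_act x b v (l mu : K) i j :
  iter i (shift (act_op (ad_rep L) x) mu) b = 0 -> iter j (shift (act_op r x) l) v = 0 ->
  iter (i + j) (shift (act_op r x) (l + mu)) (r b v) = 0.
Proof.
have [n] := ubnP (i + j); elim: n i j b v => // n IH [|i] [|j] b v ij.
- by move=> /= -> _; rewrite act0l.
- by move=> b0 _; rewrite (b0 : b = 0) act0l iter_lin0.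
- by move=> _ v0; rewrite (v0 : v = 0) linear0 iter_lin0.
move=> bi vj.
have E : shift (act_op r x) (l + mu) (r b v) =
   r (shift (act_op (ad_rep L) x) mu b) v + r b (shift (act_op r x) l v).
  rewrite !shiftE !act_opE actBr actZr actBl actZl act_br scalerDl opprD.
  by rewrite [RHS]addrACA subrK [- (mu *: _) - _]addrC.
have ijn : (i + j.+1 < n)%N by rewrite addSn ltnS in ij.
rewrite addSn iterSr E -!lpowE linearD /= !lpowE.
rewrite (IH i j.+1) //; last by rewrite -iterSr.
rewrite add0r addnS -addSn (IH i.+1 j) //; first by rewrite addSn -addnS.
by rewrite -iterSr.
Qed.

(** For x in P with conjugate part y, the trace of [a, b] y is that of a [b, y].
    If b is a generalized eigenvector of ad x for mu, then [b, y] is the multiple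
    of b by - conj(mu), as it sends the space for l into that for l + mu; so the
    trace is that of a b up to a scalar, and vanishes.  As x is a sum of brackets
    [a, b], the trace of x y vanishes and x is nilpotent.  A perfect algebra of
    nilpotent operators is zero. *)
Lemma cartan P : subalg P -> (P <= liev P P)%VS ->
  (forall x y, x \in P -> y \in P -> lfun_trace (act_op r x \o act_op r y)%VF = 0) ->
  forall x v, x \in P -> r x v = 0.
Proof.
move=> SP PP tr0; apply: perfect_nil => //; apply: engel => // x xP.
have [N1 g1] := @geig_span _ _ (act_op (ad_rep L) x) P
   ltac:(by move=> y yP; rewrite act_opE; apply: SP).
have [N2 g2] := @geig_span _ _ (act_op r x) fullv ltac:(by move=> *; apply: memvf).
have [q [y [_ yE yt]]] := conj_part (act_op r x) (N1 + N2); apply: yt.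
have [U UP] := @linear_kernel _ L (fun z => lfun_trace (act_op r z \o y)%VF)
  ltac:(by move=> a z z'; rewrite linearP comp_lfunDl -comp_lfunZl linearP).
apply/UP; have := subvP PP _ xP; apply/subvP/liev_sub => a b aP; move: b.
have [W WP] := @linear_kernel _ L (fun b =>
    lfun_trace (act_op r a \o ((act_op r b \o y) - (y \o act_op r b)))%VF)
  ltac:(move=> c z z'; rewrite -linearP; congr lfun_trace; apply/lfunP => v;
    rewrite !(comp_lfunE, add_lfunE, opp_lfunE, scale_lfunE, act_opE) !(actDl, actZl);
    by rewrite linearP opprD addrACA -scalerBr actDr actZr).
have : (P <= W)%VS.
  apply: g1 => mu b bP b0; apply/WP.
  have -> : ((act_op r b \o y) - (y \o act_op r b))%VF = - mu^* *: act_op r b.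
    apply/eqP; rewrite -subr_eq0; apply/eqP/lfunP => v; rewrite [RHS]lfunE /=.
    apply/eqP; rewrite -memv_ker; apply: (subvP _ _ (memvf v)); apply: g2 => l u _ u0.
    rewrite memv_ker !(add_lfunE, opp_lfunE, comp_lfunE, scale_lfunE) !act_opE.
    have -> : y u = l^* *: u.
      by apply: yE; apply: iter_eq0_leq u0; apply: leq_addl.
    have -> : y (r b u) = (l + mu)^* *: r b u by apply: yE; apply: shift_act.
    by rewrite linearZ /= rmorphD scalerDl opprD addrA subrr sub0r scaleNr opprK addNr.
  by rewrite -comp_lfunZr linearZ /= tr0 // scaler0.
move=> /subvP PW b /PW/WP bW; apply/UP; rewrite act_op_br.
rewrite -{}[RHS]bW.
have -> : (act_op r a \o ((act_op r b \o y) - (y \o act_op r b)))%VF =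
   (act_op r a \o act_op r b \o y)%VF - (act_op r a \o y \o act_op r b)%VF.
  by apply/lfunP => v; rewrite !(comp_lfunE, add_lfunE, opp_lfunE, linearB).
rewrite comp_lfunDl comp_lfunNl !linearB /=; congr (_ - _).
by rewrite [RHS]lfun_traceC !comp_lfunA.
Qed.

End Cartan.

Section SubQuotient.
Variables (K : fieldType) (L : finLieType K) (V : vectType K) (r : lierep L V).

(** The representation on T / X, carried by a complement of X in T.  The map pi is
    defined on all of V, but is meaningful on T only. *)
Lemma subquotient_rep (T X : {vspace V}) :
  (forall x v, v \in T -> r x v \in T) -> (forall x v, v \in X -> r x v \in X) ->
  (X <= T)%VS ->
  exists (Q : vectType K) (rQ : lierep L Q) (pi : 'Hom(V, Q)),
  [/\ forall x v, v \in T -> pi (r x v) = rQ x (pi v),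
      forall q, exists2 v, v \in T & pi v = q
    & forall v, v \in T -> (pi v == 0) = (v \in X)].
Proof.
move=> rT rX XT; pose C := (T :\: X)%VS.
have CX : (C :&: X = 0)%VS := capv_diff T X.
have CT : (C + X = T)%VS by rewrite /C addv_diff; apply/addv_idPl.
pose pi : 'Hom(V, subvs_of C) := (linfun (vsproj C) \o daddv_pi C X)%VF.
have piE v : vsval (pi v) = daddv_pi C X v.
  by rewrite comp_lfunE lfunE /= vsprojK // memv_pi.
have piX v : v \in T -> v - vsval (pi v) \in X.
  move=> vT; rewrite piE; have : v \in (C + X)%VS by rewrite CT.
  by move=> /(daddv_pi_add CX) {1}<-; rewrite addrAC subrr add0r memv_pi.
have pi0 v : v \in T -> (pi v == 0) = (v \in X).
  move=> vT; apply/eqP/idP => [p0|vX]; first by have := piX v vT; rewrite p0 subr0.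
  apply: val_inj => /=; apply/eqP; rewrite -memv0 -CX memv_cap subvsP /=.
  have <- : v - (v - vsval (pi v)) = vsval (pi v) by rewrite opprB addrC subrK.
  by rewrite rpredB // piX.
have CsT (c : subvs_of C) : vsval c \in T by apply: (subvP (diffvSl _ _)) (subvsP c).
have pi_id (c : subvs_of C) : pi (vsval c) = c.
  by apply: val_inj; rewrite /= piE daddv_pi_id ?subvsP.
have piact x v : v \in T -> pi (r x v) = pi (r x (vsval (pi v))).
  move=> vT; apply/eqP; rewrite -subr_eq0 -!linearB /= pi0 ?rX ?piX //.
  by rewrite rT // rpredB.
have Al a x y (v : subvs_of C) :
    pi (r (a *: x + y) (vsval v)) = a *: pi (r x (vsval v)) + pi (r y (vsval v)).
  by rewrite act_linl linearP.
have Ar a x (u v : subvs_of C) :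
    pi (r x (vsval (a *: u + v))) = a *: pi (r x (vsval u)) + pi (r x (vsval v)).
  by rewrite /= actDr actZr linearP.
have Ab x y (v : subvs_of C) : pi (r [Lie x, y] (vsval v)) =
    pi (r x (vsval (pi (r y (vsval v))))) - pi (r y (vsval (pi (r x (vsval v))))).
  by rewrite act_br linearB /= !(piact _ (r _ _)) // rT.
exists (subvs_of C), (LieRep Al Ar Ab), pi; split=> //.
by move=> q; exists (vsval q); rewrite ?CsT ?pi_id.
Qed.

End SubQuotient.

(** * Radical, trace forms and Casimir operators *)

Section Radical.
Variables (K : fieldType) (L : finLieType K).
Implicit Types (I J R P : {vspace L}).

Definition is_radical R := [/\ lie_ideal R, lie_solvable R
  & forall I, lie_ideal I -> lie_solvable I -> (I <= R)%VS].

Lemma solvable_ext k I J : lie_ideal I ->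
  (iter k (@derived K L) I <= J)%VS -> lie_solvable J -> lie_solvable I.
Proof.
move=> II IJ [l l0]; exists (l + k)%N; rewrite iterD; apply/eqP; rewrite -subv0 -l0.
exact: derivedS.
Qed.

Lemma ideal_add I J : lie_ideal I -> lie_ideal J -> lie_ideal (I + J)%VS.
Proof.
move=> II IJ x _ /memv_addP[u uI [v vJ ->]]; rewrite lieDr memv_add ?II ?IJ //.
Qed.

Lemma ideal_cap I J : lie_ideal I -> lie_ideal J -> lie_ideal (I :&: J)%VS.
Proof. by move=> II IJ x y; rewrite !memv_cap => /andP[yI yJ]; rewrite II ?IJ. Qed.

Lemma derived_add k I J : lie_ideal J ->
  (iter k (@derived K L) (I + J) <= iter k (@derived K L) I + J)%VS.
Proof.
move=> IJ; elim: k => [|k IH]; first exact: subvv.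
apply: liev_sub => x y /(subvP IH) /memv_addP[a aI [b bJ ->]].
move=> /(subvP IH) /memv_addP[a' aI' [b' bJ' ->]].
rewrite lieDl lieDr -addrA; apply: memv_add; first exact: memv_lie.
by apply: rpredD; [apply: IJ | apply: lie_idealr].
Qed.

Lemma solvable_add I J : lie_ideal I -> lie_ideal J -> lie_solvable I -> lie_solvable J ->
  lie_solvable (I + J)%VS.
Proof.
move=> II IJ [k k0]; apply: (@solvable_ext k); first exact: ideal_add.
by apply: subv_trans (derived_add k I IJ) _; rewrite /derived k0 add0v.
Qed.

Lemma radical_exists : exists R, is_radical R.
Proof.
pose good R := lie_ideal R /\ lie_solvable R.
pose Q n := `[< exists2 R, good R & \dim R = n >].
have exQ : exists n, Q n.
  exists 0%N; apply/asboolP; exists 0%VS; last exact: dimv0.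
  by split; [exact: ideal0 | exists 0%N].
have leQ n : Q n -> (n <= \dim {:L})%N.
  by move=> /asboolP[R _ <-]; apply/dimvS/subvf.
have [n /asboolP[R [IR SR] Rn] nmax] := ex_maxnP exQ leQ.
exists R; split=> // I II SI.
have /nmax : Q (\dim (R + I)).
  apply/asboolP; exists (R + I)%VS => //.
  by split; [exact: ideal_add | exact: solvable_add].
rewrite -Rn => dR; have /eqP -> : R == (R + I)%VS by rewrite eqEdim addvSl.
exact: addvSr.
Qed.

(** The dimensions of the derived series decrease, hence become stationary. *)
Lemma perfect_core I : lie_ideal I ->
  exists k, let P := iter k (@derived K L) I in (P <= liev P P)%VS.
Proof.
move=> II; pose Q n := `[< exists k, \dim (iter k (@derived K L) I) = n >].
have exQ : exists n, Q n by exists (\dim I); apply/asboolP; exists 0%N.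
have [n /asboolP[k kn] nmin] := ex_minnP exQ; exists k.
have /nmin : Q (\dim (iter k.+1 (@derived K L) I)) by apply/asboolP; exists k.+1.
rewrite -kn => dk.
have sub : (iter k.+1 (@derived K L) I <= iter k (@derived K L) I)%VS.
  by apply: liev_sub => x y _ yI; apply: derived_ideal.
have /eqP EI : iter k.+1 (@derived K L) I == iter k (@derived K L) I by rewrite eqEdim sub.
by cbv zeta; rewrite -[X in (X <= _)%VS]EI subvv.
Qed.

End Radical.

Section TraceForm.
Variables (K : numClosedFieldType) (L : finLieType K) (V : vectType K).
Variable r : lierep L V.
Implicit Types (x y z : L) (J X : {vspace L}).

Definition tform x y : K^o := lfun_trace (act_op r x \o act_op r y)%VF.

Lemma tformC x y : tform x y = tform y x.
Proof. exact: lfun_traceC. Qed.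

Lemma tform_linl y : linear (tform^~ y).
Proof. by move=> a u v; rewrite /tform linearP comp_lfunDl -comp_lfunZl linearP. Qed.
Definition tforml y x := tform x y.
HB.instance Definition _ y := GRing.isLinear.Build K L K^o _ (tforml y) (tform_linl y).

Lemma tform0l y : tform 0 y = 0. Proof. exact: (linear0 (tforml y)). Qed.
Lemma tformNl x y : tform (- x) y = - tform x y. Proof. exact: (linearN (tforml y)). Qed.
Lemma tform_suml (I : finType) (a : I -> K) (c : I -> L) y :
  tform (\sum_i a i *: c i) y = \sum_i a i * tform (c i) y.
Proof.
rewrite -[LHS]/(tforml y _) linear_sum; apply: eq_bigr => i _; by rewrite linearZ.
Qed.

Lemma tform_linr x : linear (tform x).
Proof. by move=> a u v; rewrite !(tformC x) tform_linl. Qed.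
HB.instance Definition _ x := GRing.isLinear.Build K L K^o _ (tform x) (tform_linr x).

Lemma tform_inv x y z : tform [Lie x, y] z = tform x [Lie y, z].
Proof.
rewrite /tform !act_op_br comp_lfunDl comp_lfunDr comp_lfunNl comp_lfunNr !linearB /=.
by rewrite !comp_lfunA; congr (_ - _); rewrite -comp_lfunA lfun_traceC.
Qed.

Lemma tform0 x y : (forall v, r x v = 0) -> tform x y = 0.
Proof.
move=> x0; rewrite /tform; have -> : act_op r x = 0.
  by apply/lfunP => v; rewrite act_opE x0 lfunE.
by rewrite comp_lfun0l linear0.
Qed.

Lemma perp_exists J : exists J' : {vspace L},
  forall y, y \in J' <-> forall z, z \in J -> tform y z = 0.
Proof.
apply: vspace_of => [z _|a u v u0 v0 z zJ]; first exact: tform0l.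
by rewrite tform_linl u0 ?v0 // scaler0 addr0.
Qed.

Lemma perp_ideal J J' : lie_ideal J ->
  (forall y, y \in J' <-> forall z, z \in J -> tform y z = 0) -> lie_ideal J'.
Proof.
move=> IJ JP x y /JP y0; apply/JP => z zJ.
by rewrite lieC tformNl tform_inv y0 ?oppr0 // IJ.
Qed.

(** X is the radical of the trace form on J.  A basis c of a complement of X in J
    has an invertible Gram matrix B, which replaces a dual basis in the
    constructions below. *)
Lemma gram J X : (X <= J)%VS ->
  (forall x y, x \in X -> y \in J -> tform x y = 0) ->
  (forall x, x \in J -> (forall y, y \in J -> tform x y = 0) -> x \in X) ->
  exists m (c : 'I_m -> L) (B : 'M[K]_m),
  [/\ m = \dim (J :\: X), forall i, c i \in J, B \in unitmx,
      forall i j, B i j = tform (c i) (c j)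
    & forall x, x \in J -> exists a : 'I_m -> K, x - \sum_i a i *: c i \in X].
Proof.
move=> XJ X0 XP; pose C := (J :\: X)%VS; pose c := (vbasis C)`_(_ : 'I_(\dim C)).
have cC i : c i \in C by apply: vbasis_mem; rewrite mem_nth ?size_tuple.
have CJ := subvP (diffvSl J X).
have dec x : x \in J -> exists a : 'I_(\dim C) -> K, x - \sum_i a i *: c i \in X.
  have : (J <= C + X)%VS by rewrite /C addv_diff addvSl.
  move=> /subvP sub /sub/memv_addP[w wC [u uX ->]]; exists (fun i => coord (vbasis C) i w).
  by rewrite {1}(coord_vbasis wC) addrAC subrr add0r.
exists (\dim C), c, (\matrix_(i, j) tform (c i) (c j)); split=> //.
- by move=> i; apply: CJ.
- rewrite -row_free_unit; apply/inj_row_free => v v0.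
  pose w := \sum_i v 0 i *: c i.
  have wC : w \in C by apply: rpred_sum => i _; rewrite rpredZ.
  have wc j : tform w (c j) = 0.
    have /rowP/(_ j) := v0; rewrite !mxE => E; rewrite -[RHS]E.
    by rewrite /w tform_suml; apply: eq_bigr => i _; rewrite mxE.
  have wX : w \in X.
    apply: XP => [|y yJ]; first exact: CJ.
    have [a ax] := dec y yJ; rewrite -[y](subrK (\sum_i a i *: c i)) linearD /=.
    rewrite [X in X + _]tformC X0 ?add0r //; last exact: CJ.
    by rewrite linear_sum big1 // => i _; rewrite linearZ /= wc scaler0.
  have w0 : w = 0 by apply/eqP; rewrite -memv0 -(capv_diff J X) memv_cap wC.
  apply/rowP => i; rewrite mxE.
  by have /freeP/(_ _ w0 i) := basis_free (vbasisP C).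
- by move=> i j; rewrite mxE.
Qed.

(** The Casimir operator is the sum of the D i j * c i * c j, where c is a basis
    modulo the kernel of the representation and D the inverse of the Gram matrix B.
    Invariance of the form says A B + B A^T = 0 for the matrix A of ad x; then
    D A + A^T D = 0, and the operator commutes with x.  Its trace is that of D B,
    the dimension of the image of the representation. *)
Lemma casimir : (forall x, (forall y, tform x y = 0) -> forall v, r x v = 0) ->
  (exists x v, r x v != 0) ->
  exists Om : 'End(V),
  [/\ forall x v, Om (r x v) = r x (Om v),
      forall W : {vspace V}, (forall x v, r x v \in W) -> forall v, Om v \in W
    & lfun_trace Om != 0].
Proof.
move=> nd [x0 [v0 xv0]].
have [X XP] : exists X : {vspace L}, forall x, x \in X <-> forall v, r x v = 0.
  apply: vspace_of => [v|a x y x0' y0 v]; first exact: act0l.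
  by rewrite act_linl x0' y0 scaler0 addr0.
have [m [c [B [mE _ uB BE dec]]]] := @gram fullv X (subvf X)
  ltac:(by move=> x y /XP x00 _; apply: tform0)
  ltac:(by move=> x _ x00; apply/XP/nd => y; apply: x00; apply: memvf).
have {}dec x : exists a : 'I_m -> K, forall v, r x v = \sum_i a i *: r (c i) v.
  have [a ax] := dec x (memvf x); exists a => v.
  have /XP/(_ v) := ax; rewrite actBl => /eqP; rewrite subr_eq0 => /eqP ->.
  rewrite -[LHS]/(actl r v _) linear_sum; apply: eq_bigr => i _.
  by rewrite linearZ.
pose D := invmx B.
exists (\sum_i \sum_j D i j *: (act_op r (c i) \o act_op r (c j))%VF).
have OmE v : (\sum_i \sum_j D i j *: (act_op r (c i) \o act_op r (c j))%VF) v
   = \sum_i \sum_j D i j *: r (c i) (r (c j) v).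
  rewrite sum_lfunE; apply: eq_bigr => i _; rewrite sum_lfunE; apply: eq_bigr => j _.
  by rewrite scale_lfunE comp_lfunE !act_opE.
split.
- move=> x v; rewrite !OmE.
  have [a aP] : exists a : 'I_m -> 'I_m -> K,
      forall i v, r [Lie x, c i] v = \sum_k a i k *: r (c k) v.
    by have [a aP] := fin_all_exists (fun i => dec [Lie x, c i]); exists a.
  pose A := \matrix_(i, j) a i j.
  have tA i y : tform [Lie x, c i] y = \sum_k a i k * tform (c k) y.
    rewrite /tform; have -> : act_op r [Lie x, c i] = \sum_k a i k *: act_op r (c k).
      apply/lfunP => u; rewrite act_opE aP sum_lfunE; apply: eq_bigr => k _.
      by rewrite scale_lfunE act_opE.
    have -> : ((\sum_k a i k *: act_op r (c k)) \o act_op r y)%VF =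
        \sum_k a i k *: (act_op r (c k) \o act_op r y)%VF.
      apply/lfunP => u; rewrite comp_lfunE !sum_lfunE; apply: eq_bigr => k _.
      by rewrite !scale_lfunE comp_lfunE.
    by rewrite linear_sum; apply: eq_bigr => k _; rewrite linearZ.
  have AB : A *m B + B *m A^T = 0.
    apply/matrixP => i j; rewrite !mxE.
    have -> : \sum_k A i k * B k j = tform [Lie x, c i] (c j).
      by rewrite tA; apply: eq_bigr => k _; rewrite mxE BE.
    have -> : \sum_k B i k * A^T k j = tform [Lie x, c j] (c i).
      by rewrite tA; apply: eq_bigr => k _; rewrite !mxE BE mulrC tformC.
    by rewrite !tform_inv (lieC (c i) (c j)) linearN addNr.
  have DA : D *m A + A^T *m D = 0.
    have := congr1 (fun M => D *m M *m D) AB.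
    by rewrite mulmxDr mulmxDl mulmx0 mul0mx !mulmxA mulVmx // mul1mx mulmxK // .
  pose T i j := r (c i) (r (c j) v).
  have E i j : r x (T i j) = r (c i) (r (c j) (r x v))
      + (\sum_k a i k *: T k j + \sum_k a j k *: T i k).
    rewrite /T -aP act_br.
    have -> : \sum_k a j k *: r (c i) (r (c k) v) = r (c i) (r [Lie x, c j] v).
      by rewrite aP linear_sum; apply: eq_bigr => k _; rewrite /= actZr.
    by rewrite act_br actBr addrC addrA !subrK.
  have -> : r x (\sum_i \sum_j D i j *: r (c i) (r (c j) v)) =
      \sum_i \sum_j D i j *: r x (T i j).
    rewrite linear_sum; apply: eq_bigr => i _; rewrite linear_sum; apply: eq_bigr => j _.
    by rewrite /= actZr.
  have -> : \sum_i \sum_j D i j *: r x (T i j) =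
     \sum_i \sum_j D i j *: r (c i) (r (c j) (r x v)) +
     \sum_i \sum_j ((D *m A) i j + (A^T *m D) i j) *: T i j.
    under eq_bigr do (under eq_bigr do rewrite E !scalerDr; rewrite !big_split /=).
    rewrite !big_split /= addrC [in RHS]addrC; congr (_ + _).
    under [in RHS]eq_bigr do (under eq_bigr do rewrite scalerDl; rewrite big_split /=).
    rewrite big_split /= addrC; congr (_ + _).
      apply: eq_bigr => i _.
      under [RHS]eq_bigr do rewrite mxE scaler_suml.
      rewrite exchange_big /=; apply: eq_bigr => k _.
      rewrite scaler_sumr; apply: eq_bigr => j _; by rewrite mxE scalerA.
    rewrite exchange_big [RHS]exchange_big /=; apply: eq_bigr => j _.
    under [RHS]eq_bigr do rewrite mxE scaler_suml.
    rewrite exchange_big /=; apply: eq_bigr => k _.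
    rewrite scaler_sumr; apply: eq_bigr => i _; by rewrite !mxE scalerA mulrC.
  rewrite [X in _ = _ + X]big1 ?addr0 // => i _; rewrite big1 // => j _.
  by have /matrixP/(_ i j) := DA; rewrite !mxE => ->; rewrite scale0r.
- move=> W WP v; rewrite OmE; apply: rpred_sum => i _; apply: rpred_sum => j _.
  by rewrite rpredZ.
have -> : lfun_trace (\sum_i \sum_j D i j *: (act_op r (c i) \o act_op r (c j))%VF) =
    \tr (D *m B).
  rewrite linear_sum; apply: eq_bigr => i _; rewrite mxE linear_sum; apply: eq_bigr => j _.
  by rewrite linearZ /= BE tformC.
rewrite mulVmx // mxtrace1 pnatr_eq0 mE dimv_eq0 diffv_eq0.
apply: contra xv0 => /subvP/(_ x0 (memvf _))/XP ->; exact: eqxx.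
Qed.

End TraceForm.

(** * Semisimple quotients and invariant vectors *)

Section Semisimple.
Variables (K : numClosedFieldType) (L : finLieType K) (R : {vspace L}).
Hypothesis RR : is_radical R.
Implicit Types (x y z : L) (I J S X : {vspace L}).
Let IR : lie_ideal R. Proof. by case: RR. Qed.
Let SR : lie_solvable R. Proof. by case: RR. Qed.
Let maxR I : lie_ideal I -> lie_solvable I -> (I <= R)%VS.
Proof. by case: RR => _ _; apply. Qed.

Lemma solvable_mod k I : lie_ideal I -> (iter k (@derived K L) I <= R)%VS -> (I <= R)%VS.
Proof. by move=> II IkR; apply: maxR => //; apply: solvable_ext IkR SR. Qed.

Lemma quotient_ad : exists (Q : vectType K) (r : lierep L Q),
  forall x, (forall q, r x q = 0) <-> (forall y, [Lie x, y] \in R).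
Proof.
have [Q [r [pi [pir pis pi0]]]] := @subquotient_rep _ _ _ (ad_rep L) fullv R
  ltac:(by move=> *; apply: memvf) ltac:(by move=> x v; apply: IR) (subvf R).
exists Q, r => x; split=> [x0 y|xR q].
  by rewrite -pi0 ?memvf // pir ?memvf // x0.
have [y _ <-] := pis q; rewrite -pir ?memvf //; apply/eqP; rewrite pi0 ?memvf //.
exact: xR.
Qed.

(** By the criterion of Cartan the perfect core of I acts by zero on Q, so it
    maps L into R; hence I is solvable modulo R. *)
Lemma form_vanish_sub (Q : vectType K) (r : lierep L Q) I :
  (forall x, (forall q, r x q = 0) -> forall y, [Lie x, y] \in R) ->
  lie_ideal I -> (forall x y, x \in I -> y \in I -> tform r x y = 0) -> (I <= R)%VS.
Proof.
move=> rR II I0; have [k PP] := perfect_core II.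
pose P := iter k (@derived K L) I; have {}PP : (P <= liev P P)%VS := PP.
have PI : (P <= I)%VS by apply: derived_sub.
have IP : lie_ideal P by apply: derived_ideal.
apply: (@solvable_mod k) => //; apply: (subv_trans PP); apply: liev_sub => x y xP yP.
apply: rR => q; apply: (@cartan _ _ _ r P) => //; first exact: ideal_subalg.
by move=> a b aP bP; apply: I0; apply: (subvP PI).
Qed.

(** The ideals of the semisimple quotient L / R are direct summands: J' is the
    orthogonal of J for the trace form of the adjoint action on L / R.  The
    intersection of J and J' is in R by [form_vanish_sub], so the form is
    nondegenerate on J modulo R, and orthogonal projection to J exists. *)
Lemma perp_decomp J : lie_ideal J -> (R <= J)%VS ->
  exists J', [/\ lie_ideal J', (J + J' = fullv)%VS & (J :&: J' <= R)%VS].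
Proof.
move=> IJ RJ; have [Q [r rP]] := quotient_ad.
have [J' J'P] := perp_exists r J; exists J'.
have IJ' := perp_ideal IJ J'P.
have JJ' : (J :&: J' <= R)%VS.
  apply: (@form_vanish_sub Q r) => [x /rP //||x y]; first exact: ideal_cap.
  by rewrite !memv_cap => /andP[_ /J'P x0] /andP[/x0].
split=> //.
have R0 x y : x \in R -> tform r x y = 0.
  move=> xR; apply: tform0; apply/rP => z; exact: lie_idealr.
have [m [c [B [_ cJ uB BE dec]]]] := @gram _ _ _ r J R RJ
  ltac:(by move=> x y xR _; apply: R0)
  ltac:(by move=> x xJ x0; apply: (subvP JJ'); rewrite memv_cap xJ; apply/J'P).
apply/eqP; rewrite eqEsubv subvf; apply/subvP => y _.
(* The coefficients of the orthogonal projection of y to the span of c. *)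
pose a : 'rV_m := (\row_k tform r y (c k)) *m invmx B.
pose j := \sum_i a 0 i *: c i.
have jJ : j \in J by apply: rpred_sum => i _; rewrite rpredZ.
rewrite -[y](subrK j) addrC memv_add //; apply/J'P => z zJ.
have yc k : tform r (y - j) (c k) = 0.
  rewrite -[LHS]/(tforml r (c k) _) linearB /= {1}/tforml /j /tforml tform_suml.
  have /rowP/(_ k) : a *m B = \row_k tform r y (c k) by rewrite mulmxKV.
  by rewrite !mxE => <-; rewrite -sumrB big1 // => i _; rewrite BE subrr.
have [b bR] := dec z zJ; rewrite -[z](subrK (\sum_i b i *: c i)) linearD /=.
rewrite tformC R0 // add0r linear_sum big1 // => i _.
by rewrite linearZ /= yc scaler0.
Qed.

(** The quotient by an ideal J that contains the radical has no solvable ideals: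
    it is isomorphic to the complementary ideal J' modulo R. *)
Lemma quotient_semisimple k J S : lie_ideal J -> (R <= J)%VS -> lie_ideal S ->
  (iter k (@derived K L) S <= J)%VS -> (S <= J)%VS.
Proof.
move=> IJ RJ IS SkJ; have [J' [IJ' JJ' capR]] := perp_decomp IJ RJ.
have IT := ideal_add IS IJ.
have TR : ((S + J) :&: J' <= R)%VS.
  apply: (@solvable_mod k); first exact: ideal_cap.
  apply: subv_trans capR; rewrite subv_cap; apply/andP; split.
    apply: subv_trans (derivedS k (capvSl _ _)) _.
    by apply: subv_trans (derived_add k S IJ) _; rewrite subv_add SkJ subvv.
  by apply: subv_trans (derived_sub k _) (capvSr _ _); apply: ideal_cap.
apply/subvP => x xS; have : x \in (J + J')%VS by rewrite JJ' memvf.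
move=> /memv_addP[j jJ [j' j'J xE]]; rewrite xE rpredD //.
apply: (subvP RJ); apply: (subvP TR); rewrite memv_cap j'J andbT.
have -> : j' = x - j by rewrite xE addrAC subrr add0r.
by rewrite memv_add ?rpredN.
Qed.

(** Induction on the dimension.  If the representation r is not zero, L acts
    through a semisimple quotient and r has a Casimir operator, which is invertible
    on the Fitting complement of its generalized kernel T.  That complement lies in
    W, so W does not contain T.  As the trace of the Casimir operator is not zero,
    T is a proper subrepresentation, to which induction applies. *)
Lemma weyl_abs (V : vectType K) (r : lierep L V) (W : {vspace V}) :
  (forall x v, x \in R -> r x v = 0) -> (forall x v, r x v \in W) -> W <> fullv ->
  exists2 v, v \notin W & forall x, r x v = 0.
Proof.
have [n] := ubnP (\dim {:V}); elim: n V r W => // n IH V r W Vn rR rW Wf.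
have [r0|rN0] := pselect (forall x v, r x v = 0).
  have /subvPn[v _ vW] : ~~ (fullv <= W)%VS.
    by apply/negP => fW; apply: Wf; apply/eqP; rewrite eqEsubv subvf.
  by exists v.
have [J JP] : exists X : {vspace L}, forall x, x \in X <-> forall v, r x v = 0.
  apply: vspace_of => [v|a x y x0 y0 v]; first exact: act0l.
  by rewrite act_linl x0 y0 scaler0 addr0.
have IJ : lie_ideal J.
  by move=> x y /JP y0; apply/JP => v; rewrite act_br !y0 linear0 subrr.
have RJ : (R <= J)%VS by apply/subvP => x xR; apply/JP => v; apply: rR.
have nd x : (forall y, tform r x y = 0) -> forall v, r x v = 0.
  have [S SP] := perp_exists r fullv.
  have IS := perp_ideal (@idealf K L) SP.
  move=> x0; suff /subvP SJ : (S <= J)%VS by apply/JP/SJ/SP => y _; apply: x0.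
  have [k PP] := perfect_core IS; pose P := iter k (@derived K L) S.
  have {}PP : (P <= liev P P)%VS := PP.
  apply: (@quotient_semisimple k) => //; apply/subvP => y yP; apply/JP => v.
  apply: (@cartan _ _ _ r P) => //; first exact/ideal_subalg/derived_ideal.
  by move=> a b /(subvP (derived_sub k IS))/SP/(_ b (memvf b)).
have [Om [OmC OmW Omt]] : exists Om : 'End(V),
  [/\ forall x v, Om (r x v) = r x (Om v),
      forall W : {vspace V}, (forall x v, r x v \in W) -> forall v, Om v \in W
    & lfun_trace Om != 0].
  apply: casimir => //; apply: contrapT => H; apply: rN0 => x v; apply: contrapT => xv.
  by apply: H; exists x, v; apply/eqP.
have [k [k0 kdec k2]] := @fitting _ _ Om fullv ltac:(by move=> *; apply: memvf).
pose T := lker (lpow Om k).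
have TP v : (v \in T) = (iter k Om v == 0) by rewrite memv_ker lpowE.
have rT x v : v \in T -> r x v \in T.
  rewrite !TP => /eqP v0; have -> : iter k Om (r x v) = r x (iter k Om v).
    by elim: (k) => //= i ->; rewrite OmC.
  by rewrite v0 linear0.
have Tn : (\dim T < n)%N.
  apply: (@leq_trans (\dim {:V})); last by rewrite -ltnS.
  rewrite ltn_neqAle dimvS ?subvf // andbT; apply: contraNneq Omt => dT.
  have /eqP ET : T == fullv by rewrite eqEdim subvf dT /=.
  apply/eqP/lfun_nilp_trace; exists k => v; apply/eqP; rewrite -TP ET; exact: memvf.
have TW : ~~ (T <= W)%VS.
  apply/negP => /subvP TW; apply: Wf; apply/eqP; rewrite eqEsubv subvf /=.
  apply/subvP => v _; have [w [u [_ _ -> w0]]] := kdec v (memvf v).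
  apply: rpredD; first by apply: TW; rewrite TP w0.
  by case: (k) k0 => //= i _; apply: OmW.
have [Q [rQ [pi [pir pis pi0]]]] := @subquotient_rep _ _ _ r T 0%VS rT
  ltac:(by move=> x v; rewrite !memv0 => /eqP ->; rewrite linear0) (sub0v T).
have Qn : (\dim {:Q} < n)%N.
  apply: leq_ltn_trans Tn; have <- : (pi @: T)%VS = fullv.
    apply/eqP; rewrite eqEsubv subvf; apply/subvP => q _.
    by have [v vT <-] := pis q; apply: memv_img.
  by rewrite -(limg_ker_dim pi T) leq_addl.
have [|x q||q qW q0] := IH Q rQ (pi @: (W :&: T))%VS Qn.
- by move=> x q xR; have [v vT <-] := pis q; rewrite -pir // rR // linear0.
- have [v vT <-] := pis q; rewrite -pir //; apply: memv_img.
  by rewrite memv_cap rW rT.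
- move=> Ef; case/negP: TW; apply/subvP => v vT.
  have : pi v \in (pi @: (W :&: T))%VS by rewrite Ef memvf.
  move=> /memv_imgP[w]; rewrite memv_cap => /andP[wW wT] /eqP.
  rewrite -subr_eq0 -linearB /= pi0; last exact: rpredB.
  by rewrite memv0 subr_eq0 => /eqP ->.
have [v vT vq] := pis q; exists v.
  by apply: contra qW => vW; rewrite -vq memv_img // memv_cap vW.
move=> x; apply/eqP; rewrite -memv0 -pi0 ?rT // pir // vq q0 //.
Qed.
End Semisimple.

(** * Complete reducibility and proper supplements of the radical *)

Section EndRep.
Variables (K : fieldType) (L : finLieType K) (V : vectType K) (r : lierep L V).

Definition end_act x (f : 'End(V)) : 'End(V) :=
  locked ((act_op r x \o f)%VF - (f \o act_op r x)%VF).
Lemma end_actE x f v : end_act x f v = r x (f v) - f (r x v).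
Proof. by rewrite /end_act -lock add_lfunE opp_lfunE !comp_lfunE !act_opE. Qed.

Lemma end_act_br_aux (W : zmodType) (A B C D E F : W) :
  A - B - (C - D) = A - E - (F - D) - (B - F - (E - C)).
Proof.
rewrite !opprB (AC ((2*2)*(2*2)) (((1*8)*(3*6))*((2*5)*(4*7)))) /=.
by rewrite !addNr !addr0.
Qed.

Definition end_rep : lierep L 'End(V).
refine (@LieRep K L 'End(V) end_act _ _ _).
- move=> a x y f; apply/lfunP => v.
  by rewrite add_lfunE scale_lfunE !end_actE !act_linl linearP opprD addrACA scalerBr.
- move=> a x f g; apply/lfunP => v; rewrite add_lfunE scale_lfunE !end_actE.
  by rewrite !add_lfunE !scale_lfunE act_linr opprD addrACA scalerBr.
- move=> x y f; apply/lfunP => v.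
  rewrite add_lfunE opp_lfunE !end_actE !act_br !actBr (linearB f).
  exact: end_act_br_aux.
Defined.
Lemma end_repE x f v : end_rep x f v = r x (f v) - f (r x v).
Proof. exact: end_actE. Qed.
End EndRep.

Section Weyl.
Variables (K : numClosedFieldType) (L : finLieType K) (R : {vspace L}).
Hypothesis RR : is_radical R.

(** [weyl_abs] for the subquotient T / X. *)
Lemma weyl_rel (V : vectType K) (r : lierep L V) (T W X : {vspace V}) :
  (X <= W)%VS -> (W <= T)%VS -> (forall x v, v \in T -> r x v \in W) ->
  (forall x v, v \in X -> r x v \in X) ->
  (forall x v, x \in R -> v \in T -> r x v \in X) -> ~ (T <= W)%VS ->
  exists v, [/\ v \in T, v \notin W & forall x, r x v \in X].
Proof.
move=> XW WT rT rX rR TW.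
have [Q [rQ [pi [pir pis pi0]]]] := @subquotient_rep _ _ _ r T X
  (fun x v vT => subvP WT _ (rT x v vT)) rX (subv_trans XW WT).
have [|x q||q qW q0] := @weyl_abs _ _ _ RR Q rQ (pi @: W)%VS.
- move=> x q xR; have [v vT <-] := pis q; apply/eqP.
  by rewrite -pir // pi0 ?rR // (subvP WT) ?rT.
- by have [v vT <-] := pis q; rewrite -pir // memv_img ?rT.
- move=> Ef; apply: TW; apply/subvP => v vT.
  have : pi v \in (pi @: W)%VS by rewrite Ef memvf.
  move=> /memv_imgP[w wW] /eqP; have wT := subvP WT _ wW.
  rewrite -subr_eq0 -linearB /= pi0; last exact: rpredB.
  by move=> /(subvP XW) vwW; rewrite -[v](subrK w) rpredD.
have [v vT vq] := pis q; exists v; split=> // [|x].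
  by apply: contra qW => vW; rewrite -vq memv_img.
by rewrite -pi0 ?(subvP WT) ?rT // pir // vq q0.
Qed.

(** In the representation on endomorphisms of V, those with values in U that
    restrict to a scalar on U have as a subspace of codimension one those that
    vanish on U, and L maps the former into the latter.  A vector outside that is
    killed by L is, up to a factor, an equivariant projector onto U. *)
Lemma weyl_projector (V : vectType K) (r : lierep L V) (U : {vspace V}) :
  (forall x v, x \in R -> r x v = 0) -> (forall x u, u \in U -> r x u \in U) ->
  exists f : 'End(V), [/\ forall v, f v \in U, forall u, u \in U -> f u = u
    & forall x v, f (r x v) = r x (f v)].
Proof.
move=> rR rU.
have [->|U0] := eqVneq U 0%VS.
  exists 0; split=> [v|u|x v]; rewrite ?lfunE ?mem0v ?act0r //.
  by rewrite memv0 => /eqP ->.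
have [T TP] : exists T : {vspace 'End(V)}, forall f, f \in T <->
    (forall v, f v \in U) /\ exists c : K, forall u, u \in U -> f u = c *: u.
  apply: vspace_of.
    split=> [v|]; first by rewrite lfunE mem0v.
    by exists 0 => u _; rewrite lfunE scale0r.
  move=> a f g [fU [c fc]] [gU [d gd]]; split=> [v|].
    by rewrite add_lfunE scale_lfunE rpredD ?rpredZ.
  exists (a * c + d) => u uU; rewrite add_lfunE scale_lfunE fc // gd //.
  by rewrite scalerDl scalerA.
have [W WP] : exists T : {vspace 'End(V)}, forall f, f \in T <->
    (forall v, f v \in U) /\ forall u, u \in U -> f u = 0.
  apply: vspace_of.
    by split=> [v|u _]; rewrite lfunE ?mem0v.
  move=> a f g [fU f0] [gU g0]; split=> [v|u uU]; rewrite add_lfunE scale_lfunE.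
    by rewrite rpredD ?rpredZ.
  by rewrite f0 // g0 // scaler0 addr0.
have WT : (W <= T)%VS.
  by apply/subvP => f /WP[fU f0]; apply/TP; split=> //; exists 0 => u /f0 ->; rewrite scale0r.
have [||||f [/TP[fU [c fc]] fW f0]] := @weyl_rel _ (end_rep r) T W 0%VS (sub0v _) WT.
- move=> x f /TP[fU [c fc]]; apply/WP; split=> [v|u uU]; rewrite end_repE.
    by rewrite rpredB ?rU.
  by rewrite !fc ?rU // actZr subrr.
- by move=> x f; rewrite !memv0 => /eqP ->; rewrite act0r.
- move=> x f xR _; rewrite memv0; apply/eqP/lfunP => v.
  by rewrite end_repE !rR // linear0 subrr lfunE.
- move=> /subvP TW; have : projv U \in W.
    apply/TW/TP; split=> [v|]; first exact: memv_proj.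
    by exists 1 => u uU; rewrite projv_id // scale1r.
  move=> /WP[_ pU]; move: U0; rewrite -vpick0.
  by rewrite -(pU _ (memv_pick U)) projv_id ?memv_pick ?eqxx.
have c0 : c != 0.
  by apply: contraNneq fW => c0; apply/WP; split=> // u /fc ->; rewrite c0 scale0r.
exists (c^-1 *: f); split=> [v|u uU|x v]; rewrite !scale_lfunE.
- by rewrite rpredZ.
- by rewrite fc // scalerA mulVf // scale1r.
have := f0 x; rewrite memv0 => /eqP/lfunP/(_ v); rewrite end_repE lfunE /= => /eqP.
by rewrite subr_eq0 => /eqP <-; rewrite actZr.
Qed.

(** The argument for [weyl_projector], applied to the adjoint representation and
    U = R.  As R does not act by zero, everything is taken modulo R' = [R, R],
    and the inner maps ad z with z in R are divided out as well.  This produces a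
    linear map f from L to R that is a nonzero scalar c on R modulo R', such that
    [x, f] is inner modulo R' for all x.  The stabilizer M of f modulo R' is a
    subalgebra: if [x, f] agrees with ad z, then x + c^-1 z is in M, so that M + R
    is L.  If M is all of L, then f is equivariant modulo R' and the inverse
    image of R' is a proper subalgebra that supplements R. *)
Lemma levi_step : R != 0%VS ->
  exists M, [/\ subalg M, (M + R = fullv)%VS & M <> fullv].
Proof.
case: (RR) => IR [k Rk] maxR R0.
pose R' := liev R R; have IR' : lie_ideal R' := liev_ideal IR IR.
have R'R : (R' <= R)%VS by apply: liev_sub => x y _; apply: IR.
have R'neq : ~ (R <= R')%VS.
  move=> RR'; move: R0; rewrite -subv0 -Rk => /negP; apply.
  elim: (k) => [|i IH]; first exact: subvv.
  by apply: subv_trans RR' _; apply: lievS.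
pose r := ad_rep L.
(* The endomorphisms that are a scalar c on R modulo R'; those with c = 0; and
   the inner ones. *)
have [T TP] : exists T : {vspace 'End(L)}, forall f, f \in T <->
    (forall v, f v \in R) /\ exists c : K, forall u, u \in R -> f u - c *: u \in R'.
  apply: vspace_of.
    split=> [v|]; first by rewrite lfunE mem0v.
    by exists 0 => u _; rewrite lfunE scale0r subr0 mem0v.
  move=> a f g [fU [c fc]] [gU [d gd]]; split=> [v|].
    by rewrite add_lfunE scale_lfunE rpredD ?rpredZ.
  exists (a * c + d) => u uU; rewrite add_lfunE scale_lfunE scalerDl -scalerA.
  by rewrite opprD addrACA -scalerBr rpredD ?rpredZ ?fc ?gd.
have [W WP] : exists T : {vspace 'End(L)}, forall f, f \in T <->
    (forall v, f v \in R) /\ forall u, u \in R -> f u \in R'.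
  apply: vspace_of.
    by split=> [v|u _]; rewrite lfunE mem0v.
  move=> a f g [fU f0] [gU g0]; split=> [v|u uU]; rewrite add_lfunE scale_lfunE.
    by rewrite rpredD ?rpredZ.
  by rewrite rpredD ?rpredZ ?f0 ?g0.
have [X XP] : exists T : {vspace 'End(L)}, forall f, f \in T <->
    exists2 z, z \in R & forall v, f v - [Lie z, v] \in R'.
  apply: vspace_of.
    by exists 0 => [|v]; rewrite ?lfunE ?lie0l ?subrr mem0v.
  move=> a f g [z zR fz] [z' zR' gz]; exists (a *: z + z'); first by rewrite rpredD ?rpredZ.
  move=> v; rewrite add_lfunE scale_lfunE liePl opprD addrACA -scalerBr.
  by rewrite rpredD ?rpredZ.
have WT : (W <= T)%VS.
  by apply/subvP => f /WP[fU f0]; apply/TP; split=> //; exists 0 => u /f0; rewrite scale0r subr0.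
have XW : (X <= W)%VS.
  apply/subvP => f /XP[z zR fz]; apply/WP.
  have fE v : f v = (f v - [Lie z, v]) + [Lie z, v] by rewrite subrK.
  split=> [v|u uR]; rewrite fE.
    by rewrite rpredD ?(subvP R'R _ (fz v)) // lie_idealr.
  by rewrite rpredD ?fz ?memv_lie.
have zf c (f : 'End(L)) x z : (forall v, f v \in R) ->
    (forall u, u \in R -> f u - c *: u \in R') -> z \in R ->
   end_rep r z f x + c *: [Lie z, x] \in R'.
  move=> fR fc zR.
  have -> : end_rep r z f x + c *: [Lie z, x] =
    [Lie z, f x] - (f [Lie z, x] - c *: [Lie z, x]).
    by rewrite end_repE opprB addrA addrAC.
  rewrite rpredB ?memv_lie //; exact: fc (lie_idealr x IR zR).
have [||||f [/TP[fR [c fc]] fW fX]] := @weyl_rel _ (end_rep r) T W X XW WT.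
- move=> x f /TP[fR [c fc]]; apply/WP; split=> [v|u uR]; rewrite end_repE.
    by rewrite rpredB // IR.
  have -> : r x (f u) - f (r x u) = [Lie x, f u - c *: u] - (f [Lie x, u] - c *: [Lie x, u]).
    by rewrite lieBr lieZr opprB addrA subrK.
  by rewrite rpredB ?IR' ?fc // IR.
- move=> x f /XP[z zR fz]; apply/XP; exists [Lie x, z] => [|v]; first exact: IR.
  have -> : end_rep r x f v - [Lie [Lie x, z], v] =
      [Lie x, f v - [Lie z, v]] - (f [Lie x, v] - [Lie z, [Lie x, v]]).
    rewrite end_repE lieBr (jacobiD x z v) opprB opprD !addrA subrK.
    by rewrite addrAC.
  by rewrite rpredB ?IR'.
- move=> x f xR /TP[fR [c fc]]; apply/XP; exists (- c *: x); first by rewrite rpredZ.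
  by move=> v; rewrite lieZl scaleNr opprK zf.
- move=> /subvP TW; have : projv R \in W.
    apply/TW/TP; split=> [v|]; first exact: memv_proj.
    by exists 1 => u uU; rewrite projv_id // scale1r subrr mem0v.
  by move=> /WP[_ pR]; apply: R'neq; apply/subvP => u uR; rewrite -(projv_id uR) pR.
have c0 : c != 0.
  apply: contraNneq fW => c0; apply/WP; split=> // u /fc.
  by rewrite c0 scale0r subr0.
have [M MP] : exists M : {vspace L},
    forall x, x \in M <-> forall v, end_rep r x f v \in R'.
  apply: vspace_of => [v|a x y x0 y0 v]; first by rewrite act0l lfunE mem0v.
  by rewrite act_linl add_lfunE scale_lfunE rpredD ?rpredZ.
have MR : (M + R = fullv)%VS.
  apply/eqP; rewrite eqEsubv subvf; apply/subvP => x _.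
  have /XP[z zR xz] := fX x; pose w := c^-1 *: z.
  have wR : w \in R by rewrite rpredZ.
  rewrite -[x](addrK w) memv_add ?rpredN //; apply/MP => v.
  rewrite actDl add_lfunE -[X in X + _](subrK [Lie z, v]) -addrA rpredD //.
  have -> : [Lie z, v] = c *: [Lie w, v] by rewrite lieZl scalerA divff ?scale1r.
  by rewrite addrC zf.
have [Mf|Mf] := eqVneq M fullv; last first.
  exists M; split=> //; last by apply/eqP.
  move=> x y /MP xM /MP yM; apply/MP => v.
  rewrite act_br add_lfunE opp_lfunE (end_repE r x (end_rep r y f)).
  rewrite (end_repE r y (end_rep r x f)).
  by apply: rpredB; apply: rpredB; rewrite ?IR' ?xM ?yM.
have fE x v : [Lie x, f v] - f [Lie x, v] \in R'.
  have /MP/(_ v) : x \in M by rewrite Mf; apply: memvf.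
  by rewrite end_repE.
exists (f @^-1: R')%VS; split.
- move=> x y _; rewrite -!memv_preim => fy.
  rewrite -[f _](subKr [Lie x, f y]). apply: rpredB; [exact: IR' | exact: fE].
- apply/eqP; rewrite eqEsubv subvf; apply/subvP => x _.
  rewrite -[x](subrK (c^-1 *: f x)) memv_add ?rpredZ // -memv_preim.
  rewrite linearB linearZ /= -[X in X - _](scale1r (f x)) -(mulVf c0) -scalerA -scalerBr.
  by rewrite rpredZ // -opprB rpredN fc.
- move=> Ef; apply: R'neq; apply/subvP => u uR.
  have fu : f u \in R' by rewrite memv_preim Ef memvf.
  have := rpredB fu (fc u uR); rewrite opprB addrC subrK => cu.
  by rewrite -[u]scale1r -(mulVf c0) -scalerA rpredZ.
Qed.
End Weyl.

(** * Subalgebras and the theorem of Levi *)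

Section SubLie.
Variables (K : fieldType) (L : finLieType K) (S : {vspace L}) (hS : subalg S).

(** The proof that S is a subalgebra is an argument of the type, so that the
    bracket of the ambient algebra can be found from the type alone. *)
Definition sublie of subalg S : Type := subvs_of S.
Local Notation LS := (sublie hS).
HB.instance Definition _ := Vector.on LS.
Implicit Types x y z : LS.

Definition subval x : L := vsval (x : subvs_of S).
Definition subproj (x : L) : LS := vsproj S x.
Definition sub_br x y : LS := subproj [Lie subval x, subval y].

Lemma subvalP x : subval x \in S. Proof. exact: subvsP. Qed.
Lemma subval_inj : injective subval. Proof. exact: subvs_inj. Qed.
Lemma subprojK (x : L) : x \in S -> subval (subproj x) = x. Proof. exact: vsprojK. Qed.

Lemma subval_linear : linear subval. Proof. by []. Qed.
HB.instance Definition _ := GRing.isLinear.Build K LS L _ subval subval_linear.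
Lemma subproj_linear : linear subproj. Proof. exact: linearP. Qed.
HB.instance Definition _ := GRing.isLinear.Build K L LS _ subproj subproj_linear.

Lemma subval_br x y : subval (sub_br x y) = [Lie subval x, subval y].
Proof. by rewrite subprojK // hS ?subvalP. Qed.

Fact sub_brPl a x y z : sub_br (a *: x + y) z = a *: sub_br x z + sub_br y z.
Proof. by apply: subval_inj; rewrite subval_br 2!subval_linear !subval_br liePl. Qed.
Fact sub_brPr a x y z : sub_br z (a *: x + y) = a *: sub_br z x + sub_br z y.
Proof. by apply: subval_inj; rewrite subval_br 2!subval_linear !subval_br liePr. Qed.
Fact sub_brxx x : sub_br x x = 0.
Proof. by apply: subval_inj; rewrite subval_br liexx linear0. Qed.
Fact sub_jacobi x y z :
  sub_br x (sub_br y z) + sub_br y (sub_br z x) + sub_br z (sub_br x y) = 0.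
Proof. by apply: subval_inj; rewrite linear0 !linearD /= !subval_br jacobi. Qed.
HB.instance Definition _ := isLie.Build K LS sub_brPl sub_brPr sub_brxx sub_jacobi.

Lemma subval_lie x y : subval [Lie x, y] = [Lie subval x, subval y].
Proof. exact: subval_br. Qed.

Definition sub_incl : 'Hom(LS, L) := linfun subval.
Lemma sub_inclE x : sub_incl x = subval x. Proof. exact: lfunE. Qed.
Lemma sub_incl_lie x y : sub_incl [Lie x, y] = [Lie sub_incl x, sub_incl y].
Proof. by rewrite !sub_inclE subval_lie. Qed.
Lemma sub_incl_inj : lker sub_incl == 0%VS.
Proof. by apply/lker0P => x y; rewrite !sub_inclE; apply: subval_inj. Qed.

Lemma sub_img : limg sub_incl = S.
Proof.
apply/eqP; rewrite eqEsubv; apply/andP; split; apply/subvP => x.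
  by move=> /memv_imgP[y _ ->]; rewrite sub_inclE subvalP.
by move=> xS; rewrite -(subprojK xS) -sub_inclE memv_img ?memvf.
Qed.
End SubLie.

Section LieHom.
Variables (K : fieldType) (L1 L2 : finLieType K) (f : 'Hom(L1, L2)).
Hypothesis fH : forall x y, f [Lie x, y] = [Lie f x, f y].

Lemma img_liev U V : (f @: liev U V = liev (f @: U) (f @: V))%VS.
Proof.
apply/eqP; rewrite eqEsubv; apply/andP; split.
  apply/subvP => _ /memv_imgP[w wUV ->]; rewrite memv_preim; move: w wUV.
  by apply/subvP/liev_sub => u v uU vV; rewrite -memv_preim fH memv_lie ?memv_img.
apply: liev_sub => _ _ /memv_imgP[u uU ->] /memv_imgP[v vV ->].
by rewrite -fH memv_img ?memv_lie.
Qed.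

Lemma img_derived k U : (f @: iter k (@derived K L1) U = iter k (@derived K L2) (f @: U))%VS.
Proof. by elim: k => //= k IH; rewrite /derived img_liev IH. Qed.

Lemma img_iliev k (U V : {vspace L1}) :
  (f @: iter k (liev U) V = iter k (liev (f @: U)) (f @: V))%VS.
Proof. by elim: k => //= k IH; rewrite img_liev IH. Qed.

Lemma img_solvable U : lie_solvable U -> lie_solvable (f @: U)%VS.
Proof. by move=> [k k0]; exists k; rewrite -/(derived) -img_derived /derived k0 limg0. Qed.

Lemma img_nilpotent U : lie_nilpotent U -> lie_nilpotent (f @: U)%VS.
Proof. by move=> [k k0]; exists k; rewrite -img_iliev k0 limg0. Qed.

Hypothesis finj : lker f == 0%VS.
Lemma inj_img0 (U : {vspace L1}) : (f @: U = 0)%VS -> U = 0%VS.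
Proof. by move=> U0; apply/eqP; rewrite -(eq_limg_ker0 _ _ finj) U0 limg0. Qed.

Lemma img_solvable_inj U : lie_solvable (f @: U)%VS -> lie_solvable U.
Proof.
move=> [k k0]; exists k; apply: inj_img0.
by rewrite -[LHS]/(f @: iter k (@derived K L1) U)%VS img_derived.
Qed.

Lemma img_nilpotent_inj U : lie_nilpotent (f @: U)%VS -> lie_nilpotent U.
Proof. by move=> [k k0]; exists k; apply: inj_img0; rewrite img_iliev. Qed.
End LieHom.

Section Levi.
Variable (K : numClosedFieldType).

Lemma nilpotent_solvable (L : finLieType K) (I : {vspace L}) :
  lie_ideal I -> lie_nilpotent I -> lie_solvable I.
Proof.
move=> II [k k0]; exists k; apply/eqP; rewrite -subv0 -k0 {k0}.
elim: k => [|k IH]; first exact: subvv.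
by apply: lievS => //; apply: (derived_sub k II).
Qed.

(** A proper subalgebra M with M + R = L has radical M :&: R, and a Levi subalgebra
    of M is one of L. *)
Lemma levi (L : finLieType K) (R : {vspace L}) : is_radical R ->
  exists S, [/\ subalg S, (S + R = fullv)%VS & (S :&: R = 0)%VS].
Proof.
have [n] := ubnP (\dim {:L}); elim: n L R => // n IH L R Ln RR.
have [R0|R0] := eqVneq R 0%VS.
  by exists fullv; split; [move=> x y _ _; apply: memvf | rewrite R0 addv0 | rewrite R0 capv0].
have [M [hM MR Mf]] := levi_step RR R0; have [IR SR maxR] := RR.
pose f := sub_incl hM; pose LM : finLieType K := sublie hM.
have fH : forall x y : LM, f [Lie x, y] = [Lie f x, f y] := @sub_incl_lie _ _ _ hM.
have fI : lker f == 0%VS := sub_incl_inj hM.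
have fimg : limg f = M := sub_img hM.
pose RM : {vspace LM} := (f @^-1: R)%VS.
have RRM : is_radical RM.
  split=> [x y|| I II SI].
  - by rewrite -!memv_preim fH => yR; apply: IR.
  - apply: (img_solvable_inj fH fI); have [k k0] := SR; exists k.
    apply/eqP; rewrite -subv0 -k0; apply: derivedS.
    by apply/subvP => _ /memv_imgP[y yR ->]; rewrite memv_preim.
  have IfI : lie_ideal (f @: I + R)%VS.
    move=> x _ /memv_addP[_ /memv_imgP[i iI ->] [z zR ->]]; rewrite lieDr.
    apply: rpredD; last by apply: (subvP (addvSr _ _)); apply: IR.
    have : x \in (limg f + R)%VS by rewrite fimg MR memvf.
    move=> /memv_addP[_ /memv_imgP[m _ ->] [r rR ->]]; rewrite lieDl -fH.
    by rewrite memv_add ?memv_img ?II // lie_idealr.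
  have : (f @: I + R <= R)%VS.
    apply: maxR => //; have [k k0] := img_solvable fH SI.
    apply: (@solvable_ext _ _ k _ R) => //; apply: subv_trans (derived_add k _ IR) _.
    by rewrite /derived k0 add0v subvv.
  rewrite subv_add => /andP[fIR _]; apply/subvP => i iI; rewrite -memv_preim.
  by apply: (subvP fIR); apply: memv_img.
have dM : (\dim {:LM} < n)%N.
  apply: (@leq_trans (\dim {:L})); last by rewrite -ltnS.
  rewrite -(limg_dim_eq (f := f)) ?fimg; last by rewrite (eqP fI) capv0.
  rewrite ltn_neqAle dimvS ?subvf // andbT; apply/negP => /eqP dE.
  by apply: Mf; apply/eqP; rewrite eqEdim subvf dE /=.
have [S [hS SRM SR0]] := IH LM RM dM RRM.
exists (f @: S)%VS; split.
- move=> _ _ /memv_imgP[x xS ->] /memv_imgP[y yS ->]; rewrite -fH memv_img //.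
  exact: hS.
- apply/eqP; rewrite eqEsubv subvf /=; apply: (@subv_trans _ _ (limg f + R)%VS).
    by rewrite fimg MR subvf.
  rewrite subv_add addvSr andbT -SRM limgD addvS //.
  by apply/subvP => _ /memv_imgP[x xR ->]; rewrite memv_preim.
- apply/eqP; rewrite -subv0; apply/subvP => x; rewrite memv_cap.
  move=> /andP[/memv_imgP[y yS ->]]; rewrite memv_preim => yR.
  have : y \in (S :&: RM)%VS by rewrite memv_cap yS.
  by rewrite SR0 !memv0 => /eqP ->; rewrite linear0.
Qed.
End Levi.

(** * Free nilpotent Lie algebras on two generators *)

Section HomExt.
Variables (K : fieldType) (t : nat) (v : 'I_2 -> free_nil K t).
Local Notation n := (free_nil K t).

Fixpoint term_hom (s : lterm K) : n :=
  match s with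
  | LVar i => v i
  | LZero => 0
  | LAdd s r => term_hom s + term_hom r
  | LScale a s => a *: term_hom s
  | LBr s r => [Lie term_hom s, term_hom r]
  end.

Lemma term_hom_eqv s r : leqv s r -> term_hom s = term_hom r.
Proof.
elim=> //=.
- by move=> a b c _ -> _ ->.
- by move=> a b c d _ -> _ ->.
- by move=> a b c _ ->.
- by move=> a b c d _ -> _ ->.
- by move=> *; rewrite addrA.
- by move=> *; rewrite addrC.
- by move=> *; rewrite add0r.
- by move=> *; rewrite scale0r.
- by move=> *; rewrite scale1r.
- by move=> *; rewrite scalerA.
- by move=> *; rewrite scalerDr.
- by move=> *; rewrite scalerDl.
- by move=> *; rewrite liePl.
- by move=> *; rewrite liePr.
- by move=> *; rewrite liexx.
- by move=> *; rewrite jacobi.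
Qed.

Definition fl_hom (u : free_lie K) : n := term_hom (repr u).

Lemma fl_hom_pi s : fl_hom (\pi_(free_lie K) s) = term_hom s.
Proof. by apply/term_hom_eqv/free_lie_eqP; rewrite reprK. Qed.

Lemma fl_hom_linear : linear fl_hom.
Proof.
move=> a; elim/free_lieW => s; elim/free_lieW => r.
have -> : a *: \pi_(free_lie K) s + \pi_(free_lie K) r
        = \pi_(free_lie K) (LAdd (LScale a s) r).
  by rewrite pi_fl_add pi_fl_scale.
by rewrite !fl_hom_pi.
Qed.
HB.instance Definition _ :=
  GRing.isLinear.Build K (free_lie K) n _ fl_hom fl_hom_linear.

Lemma fl_hom_br u w : fl_hom [Lie u, w] = [Lie fl_hom u, fl_hom w].
Proof.
elim/free_lieW: u => s; elim/free_lieW: w => r.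
have -> : [Lie \pi_(free_lie K) s, \pi_(free_lie K) r]
        = \pi_(free_lie K) (LBr s r) by rewrite pi_fl_br.
by rewrite !fl_hom_pi.
Qed.

Lemma fl_hom_bracket k u : is_bracket k u ->
  exists2 w, w \in @fl_pow K k & fl_hom u = fn_pi t w.
Proof.
elim=> [i|p q x y xp [x' x'p Ex] yq [y' y'q Ey]].
  by exists (repr (v i)); [apply: fl_pow1 | rewrite fl_hom_pi fn_pi_repr].
exists [Lie x', y']; last by rewrite fl_hom_br Ex Ey -fn_piB.
exact: fl_pow_lie.
Qed.

Lemma fl_hom_pow u : u \in @fl_pow K t.+1 -> fl_hom u = 0.
Proof.
move=> /fl_powP; elim=> [|a x y [k tk /fl_hom_bracket [w wk Ex]] _ IH].
  exact: linear0.
rewrite linearP /= IH addr0 Ex; apply/eqP; rewrite scaler_eq0 fn_pi_eq0.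
by rewrite (fl_powS tk wk) orbT.
Qed.

Definition fn_hom (x : n) : n := fl_hom (repr x).

Lemma fn_hom_pi u : fn_hom (fn_pi t u) = fl_hom u.
Proof.
apply/eqP; rewrite -subr_eq0 -linearB /= fl_hom_pow //.
by rewrite -fn_pi_eq fn_pi_repr.
Qed.

Lemma fn_hom_linear : linear fn_hom.
Proof.
move=> a; elim/free_nilW => u; elim/free_nilW => w.
by rewrite -linearP !fn_hom_pi linearP.
Qed.
HB.instance Definition _ := GRing.isLinear.Build K n n _ fn_hom fn_hom_linear.

(** The universal property: terms are evaluated at v; brackets of length above t
    land in the part of degree above t, which is zero in the target. *)
Lemma free_nil_hom : exists th : 'End(n),
  (forall x y, th [Lie x, y] = [Lie th x, th y]) /\ forall i, th (fn_gen K t i) = v i.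
Proof.
exists (linfun fn_hom); split=> [x y|i]; rewrite !lfunE /=.
  elim/free_nilW: x => u; elim/free_nilW: y => w.
  by rewrite -fn_piB !fn_hom_pi fl_hom_br.
by rewrite fn_hom_pi fl_hom_pi.
Qed.

End HomExt.

Section Chains.
Variables (K : fieldType) (L : finLieType K) (N : {vspace L}).
Hypothesis sN : subalg N.
Local Notation C k := (iter k (liev N) N).

Lemma lcs_sub k : (C k <= N)%VS.
Proof.
elim: k => [|k IH]; first exact: subvv.
by apply: liev_sub => x y xN /(subvP IH); apply: sN.
Qed.

Lemma lcs1_lie k x y : x \in C 1 -> y \in C k -> [Lie x, y] \in C k.+2.
Proof.
move=> xC yC; rewrite lieC rpredN -ad_repE -act_opE memv_preim; move: x xC.
apply/subvP/liev_sub => a b aN bN; rewrite -memv_preim act_opE /= lieC rpredN.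
have -> : [Lie [Lie a, b], y] = [Lie a, [Lie b, y]] - [Lie b, [Lie a, y]].
  by rewrite (jacobiD a b y) addrK.
by rewrite rpredB //; do 2!apply: memv_lie => //.
Qed.

(** By the Leibniz rule a derivation that sends N into [N, N] raises the degree in
    the lower central series by one. *)
Lemma lcs_der (D : 'End(L)) k :
  (forall x y, x \in N -> y \in N -> D [Lie x, y] = [Lie D x, y] + [Lie x, D y]) ->
  (forall x, x \in N -> D x \in C 1) -> forall x, x \in C k -> D x \in C k.+1.
Proof.
move=> dD D1; elim: k => // k IH x; rewrite memv_preim; move: x.
apply/subvP/liev_sub => a b aN bC; rewrite -memv_preim dD //; last exact: (subvP (lcs_sub k)).
apply: rpredD; first by apply: lcs1_lie => //; apply: D1.
by apply: memv_lie => //; apply: IH.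
Qed.

End Chains.

(** If U generates L modulo [L, L], then it generates L modulo each term C i of the
    lower central series, since [U + C i, U + C i] is in U + C i.+1. *)
Lemma subalg_gen_full (K : fieldType) (L : finLieType K) (U : {vspace L}) :
  lie_nilpotent (fullv : {vspace L}) -> subalg U ->
  (U + liev fullv fullv = fullv)%VS -> U = fullv.
Proof.
move=> [k k0] sU UL; pose C k := iter k (liev fullv) (fullv : {vspace L}).
have C1 : C 1%N = liev fullv fullv by [].
suff H i : (U + C i)%VS = fullv by have := H k; rewrite /C k0 addv0.
elim: i => [|[|i] IH]; first by rewrite addvf.
  by rewrite C1.
apply/eqP; rewrite eqEsubv subvf /= -{1}UL subv_add addvSl /=.
apply: liev_sub => x y _ _.
have : x \in (U + C i.+1)%VS by rewrite IH memvf.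
have : y \in (U + C i.+1)%VS by rewrite IH memvf.
move=> /memv_addP[u uU [c cC ->]] /memv_addP[u' uU' [c' cC' ->]].
have sC z w : w \in C i.+1 -> [Lie z, w] \in C i.+2.
  by move=> wC; apply: memv_lie => //; apply: memvf.
rewrite lieDr lieDl -addrA; apply: memv_add; first exact: sU.
by apply: rpredD; [rewrite lieC rpredN|]; apply: sC.
Qed.

Section FreeNilGen.
Variables (K : fieldType) (t : nat).
Local Notation n := (free_nil K t).

Lemma fn_gen_span : (fn_m K t + liev fullv fullv = fullv)%VS.
Proof.
apply/eqP; rewrite eqEsubv subvf; apply/subvP => x _.
elim/free_nilW: x; elim/free_lie_ind.
- by move=> i; apply: (subvP (addvSl _ _)); apply: mem_fn_gen.
- by rewrite linear0 mem0v.
- by move=> u w Hu Hw; rewrite linearD rpredD.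
- by move=> a u Hu; rewrite linearZ rpredZ.
- by move=> u w _ _; rewrite fn_piB; apply: (subvP (addvSr _ _)); rewrite memv_lie ?memvf.
Qed.

(** This is the lower central series of n, but given by the spans of left-normed
    brackets, because the derivations of positive degree are described by these. *)
Definition lfil k : {vspace n} := (\sum_(j < t.+1 | (k <= j)%N) fn_mpow K t j)%VS.

Lemma lfilS j k : (j <= k)%N -> (lfil k <= lfil j)%VS.
Proof.
move=> jk; apply/subv_sumP => i ki; apply: (sumv_sup i) => //; exact: leq_trans ki.
Qed.

Lemma left_bracket_pi (w : seq 'I_2) : (0 < size w)%N ->
  exists2 u, is_bracket (size w) u & left_bracket K t w = fn_pi t u.
Proof.
elim/last_ind: w => // w i IH _; case: w IH => [|j w] IH.
  by exists (fl_gen K i) => //; apply: is_bracket_gen.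
have [//|u uB uE] := IH.
exists [Lie u, fl_gen K i].
  by rewrite size_rcons -addn1; apply: is_bracket_br => //; apply: is_bracket_gen.
by rewrite fn_piB -uE /= -cats1 foldl_cat.
Qed.

Lemma left_bracket_mem k (w : seq 'I_2) :
  (0 < size w)%N -> (k <= size w)%N -> left_bracket K t w \in lfil k.
Proof.
move=> w0 kw; have [wt|wt] := leqP (size w) t.
  have : left_bracket K t w \in fn_mpow K t (size w).
    rewrite memv_span //; apply/imageP; by exists (in_tuple w).
  apply/subvP; apply: (sumv_sup (Ordinal (wt : (size w < t.+1)%N))) => //=.
have [u uB ->] := left_bracket_pi w0.
have /eqP -> : fn_pi t u == 0; last exact: mem0v.
by rewrite fn_pi_eq0; apply/fl_powP/in_lspan_gen; exists (size w).
Qed.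

(** For a generator on the right this is the definition of a left-normed bracket;
    the general case follows by the Jacobi identity. *)
Lemma lfil_lie k x (y : n) : (0 < k)%N -> x \in lfil k -> [Lie x, y] \in lfil k.+1.
Proof.
elim/free_nilW: y => y; elim/free_lie_ind: y k x.
- move=> i k x k0; rewrite lieC rpredN -ad_repE -act_opE memv_preim; move: x.
  apply/subvP/subv_sumP => j kj; apply/span_subvP => _ /imageP[w _ ->].
  have sw : size w = j := size_tuple w.
  rewrite -memv_preim act_opE /= lieC rpredN.
  have -> : [Lie left_bracket K t w, fn_gen K t i] = left_bracket K t (rcons w i).
    case: (tval w) sw kj => [/= <-|a s _ _]; first by rewrite leqn0 => /eqP kz; rewrite kz in k0.
    by rewrite /= -cats1 foldl_cat.
  by apply: left_bracket_mem; rewrite size_rcons // sw.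
- by move=> k x _ _; rewrite linear0 lie0r mem0v.
- by move=> u w Hu Hw k x k0 xk; rewrite linearD lieDr rpredD ?Hu ?Hw.
- by move=> a u Hu k x k0 xk; rewrite linearZ lieZr rpredZ ?Hu.
- move=> u w Hu Hw k x k0 xk; rewrite fn_piB jacobiD (lieC (fn_pi t u)).
  apply: (subvP (lfilS (leqnSn _))).
  by rewrite rpredB // ?(Hu k.+1) ?(Hw k.+1) ?Hu ?Hw.
Qed.

Lemma lfil1 : (1 <= t)%N -> lfil 1 = fullv.
Proof.
move=> t1; apply/eqP; rewrite eqEsubv subvf; apply/subvP => x _.
elim/free_nilW: x; elim/free_lie_ind.
- by move=> i; rewrite -[fn_pi _ _]/(left_bracket K t [:: i]) left_bracket_mem.
- by rewrite linear0 mem0v.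
- by move=> u w Hu Hw; rewrite linearD rpredD.
- by move=> a u Hu; rewrite linearZ rpredZ.
- by move=> u w Hu _; rewrite fn_piB (subvP (lfilS (leqnSn _))) // lfil_lie.
Qed.

Lemma derived_lfil2 : (1 <= t)%N -> (liev (fullv : {vspace n}) fullv <= lfil 2)%VS.
Proof. by move=> t1; apply: liev_sub => x y _ _; rewrite lfil_lie ?lfil1 ?memvf. Qed.

Lemma mem_fn_Der j (d : 'Hom(subvs_of (fn_m K t), n)) : (forall u, d u \in fn_mpow K t j) ->
  fn_hat d \in fn_Der K t j.
Proof.
move=> dj; apply/memv_imgP.
exists (linfun (vsproj (fn_mpow K t j)) \o d)%VF; first exact: memvf.
rewrite lfunE /= /fn_hat_in; congr fn_hat; apply/lfunP => u.
by rewrite !comp_lfunE !lfunE /= vsprojK.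
Qed.

(** A derivation is determined by its restriction d to m.  The values of d lie in the
    sum of the m^j with j >= 2; splitting them along this sum splits the
    derivation. *)
Lemma mem_fn_N (D : 'End(n)) : (1 <= t)%N -> lie_der D ->
  (forall u, u \in fn_m K t -> D u \in liev fullv fullv) -> D \in fn_N K t.
Proof.
move=> t1 dD Dm; pose d : 'Hom(subvs_of (fn_m K t), n) := (D \o fn_incl (fn_m K t))%VF.
have -> : D = fn_hat d.
  by apply: fn_hat_uniq => // u; rewrite comp_lfunE lfunE.
have : forall u, d u \in (\sum_(2 <= j < t.+1) fn_mpow K t j)%VS.
  move=> u; rewrite big_geq_mkord /=; apply: (subvP (derived_lfil2 t1)).
  by rewrite comp_lfunE lfunE /= Dm ?subvsP.
rewrite /fn_N; elim: (index_iota 2 t.+1) d => [|j s IH] d.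
  rewrite !big_nil => d0; have -> : fn_hat d = 0; last exact: mem0v.
  apply/esym/fn_hat_uniq => [x y|u]; first by rewrite !lfunE /= lie0l lie0r addr0.
  by rewrite lfunE; apply/esym/eqP; rewrite -memv0.
rewrite !big_cons; set A := fn_mpow K t j; set B := (\sum_(_ <- _) _)%VS => dAB.
have -> : d = (addv_pi1 A B \o d)%VF + (addv_pi2 A B \o d)%VF.
  by apply/lfunP => u; rewrite add_lfunE !comp_lfunE addv_pi1_pi2.
have := fn_hat_linear 1 (addv_pi1 A B \o d)%VF (addv_pi2 A B \o d)%VF.
rewrite !scale1r => ->; rewrite memv_add //.
  apply: mem_fn_Der => u.
  by rewrite comp_lfunE; apply: memv_pi1.
by apply: IH => u; rewrite comp_lfunE memv_pi2.
Qed.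

End FreeNilGen.

Section SL.
Variables (K : numClosedFieldType) (W : vectType K).

Lemma trace_id : lfun_trace (\1%VF : 'End(W)) = (\dim {:W})%:R.
Proof. by rewrite /lfun_trace passmx.mxof1 ?mxtrace1 // (basis_free (vbasisP _)). Qed.

(** Adding scalars, c commutes with all endomorphisms, in particular with the
    projection to a line <v0>, so that v0 is an eigenvector; every u is the image of
    v0 under some endomorphism, so it has the same eigenvalue. *)
Lemma sl_center (c : 'End(W)) :
  (forall f : 'End(W), lfun_trace f = 0 -> forall v, c (f v) = f (c v)) ->
  exists l : K, forall v, c v = l *: v.
Proof.
move=> cc; have [/eqP|W0] := eqVneq (\dim {:W}) 0%N.
  rewrite dimv_eq0 => /eqP W0; exists 0 => v; have := memvf v; rewrite W0 memv0 => /eqP ->.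
  by rewrite linear0 scaler0.
have {}cc (f : 'End(W)) v : c (f v) = f (c v).
  pose a : K := lfun_trace f / (\dim {:W})%:R.
  have f0 : lfun_trace (f - a *: \1%VF) = 0.
    by rewrite linearB linearZ /= trace_id /a [_ *: _]divfK ?subrr // pnatr_eq0.
  have := cc _ f0 v; rewrite !(add_lfunE, opp_lfunE, scale_lfunE, id_lfunE).
  by rewrite linearB linearZ /= => /addIr.
pose v0 := vpick {:W}.
have v00 : v0 != 0 by rewrite vpick0 -dimv_eq0.
have fr : free [tuple v0] by rewrite seq1_free.
have hP (u : W) : exists h : 'End(W), forall v, h v = coord [tuple v0] ord0 v *: u.
  by apply: linfun_ex => a v w; rewrite linearP scalerDl scalerA.
exists (coord [tuple v0] ord0 (c v0)) => u.
have c0 : coord [tuple v0] ord0 v0 = 1 by have := coord_free ord0 ord0 fr.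
have [h hE] := hP u; have <- : h v0 = u by rewrite hE c0 scale1r.
have [p pE] := hP v0; have cv0 : c v0 = coord [tuple v0] ord0 (c v0) *: v0.
  by rewrite -[in LHS](scale1r v0) -c0 -pE cc pE.
by rewrite cc [in LHS]cv0 linearZ.
Qed.

Lemma dim_sl : (\dim {:W} <= 2)%N -> (\dim (lfun_sl W) <= 3)%N.
Proof.
move=> d2; have E := limg_ker_dim (linfun (@lfun_trace K W)) fullv.
rewrite capfv in E.
have dE : \dim {: 'End(W)} = (\dim {:W} * \dim {:W})%N.
  by rewrite !dimvf.
have [d0|d0] := eqVneq (\dim {:W}) 0%N.
  rewrite d0 in dE; have := dimvS (subvf (lfun_sl W)); rewrite dE leqn0 => /eqP -> //.
have : (0 < \dim (limg (linfun (@lfun_trace K W))))%N.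
  rewrite lt0n dimv_eq0; apply/negP => /eqP im0.
  have : linfun (@lfun_trace K W) \1%VF \in limg (linfun (@lfun_trace K W)).
    by rewrite memv_img ?memvf.
  by rewrite im0 memv0 lfunE /= trace_id pnatr_eq0 (negPf d0).
move: E; rewrite dE -/(lfun_sl W) => E im1.
have : (\dim (lfun_sl W) + 1 <= 4)%N.
  apply: leq_trans (leq_mul d2 d2); rewrite -E leq_add2l //.
by rewrite addn1.
Qed.
End SL.

Lemma dim_Der10 (K : numClosedFieldType) t : (\dim (fn_Der10 K t) <= 3)%N.
Proof.
apply: leq_trans (dim_sl (W := subvs_of (fn_m K t)) _).
  by rewrite -(limg_ker_dim (linfun (@fn_hat_in K t (fn_m K t))) (lfun_sl _)) leq_addl.
have -> : \dim {: subvs_of (fn_m K t)} = \dim (fn_m K t) by rewrite dimvf.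
by apply: leq_trans (dim_span _) _; rewrite size_codom card_ord.
Qed.

(** The derived algebra of an algebra spanned by two elements a and b is spanned by
    [a, b]; so a perfect algebra of dimension 2 has dimension 1, and one of dimension 1
    is zero. *)
Lemma perfect_dim (K : fieldType) (L : finLieType K) (P : {vspace L}) :
  P != 0%VS -> (P <= liev P P)%VS -> (3 <= \dim P)%N.
Proof.
move=> P0 PP.
have two a b : (P <= <[a]> + <[b]>)%VS -> (P <= <[ [Lie a, b] ]>)%VS.
  move=> /subvP Pab; apply: subv_trans PP _; apply: liev_sub => x y /Pab.
  move=> /memv_addP[_ /vlineP[c ->] [_ /vlineP[d ->] ->]] /Pab.
  move=> /memv_addP[_ /vlineP[c' ->] [_ /vlineP[d' ->] ->]].
  rewrite lieDl !lieDr !lieZl !lieZr !liexx !scaler0 add0r addr0 (lieC b a).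
  by rewrite !rpredD // !rpredZ // ?rpredN memv_line.
rewrite ltnNge; apply/negP => d2.
have P1 : exists v, (P <= <[v]>)%VS.
  exists [Lie (vbasis P)`_0, (vbasis P)`_1]; apply: two.
  apply/subvP => x /coord_vbasis ->; apply: rpred_sum => -[i /= iP] _; rewrite rpredZ //.
  case: i iP => [|[|i]] iP.
  - by apply: (subvP (addvSl _ _)); apply: memv_line.
  - by apply: (subvP (addvSr _ _)); apply: memv_line.
  - by have := leq_trans iP d2.
have [v Pv] := P1; have : (P <= <[ [Lie v, 0%R : L] ]>)%VS.
  by apply: two; apply: subv_trans Pv (addvSl _ _).
rewrite lie0r => P00; case/negP: P0; rewrite -subv0; apply: subv_trans P00 _.
by rewrite -memvE mem0v.
Qed.

(** * Nilradicals and Levi subalgebras *)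

Section Generic.
Variable K : numClosedFieldType.

Lemma lie_isog_inv (L1 L2 : finLieType K) (psi : 'Hom(L2, L1)) :
  lker psi == 0%VS -> limg psi = fullv ->
  (forall x y, psi [Lie x, y] = [Lie psi x, psi y]) -> lie_isog L1 L2.
Proof.
move=> inj surj hom.
have c1 : cancel psi (psi^-1)%VF by apply: lker0_lfunK.
have c2 : cancel (psi^-1)%VF psi by move=> x; rewrite limg_lfunVK ?surj ?memvf.
exists (psi^-1)%VF; first by exists psi.
by move=> x y; rewrite -[RHS]c1 hom !c2.
Qed.

Lemma bracket_sub_nilradical (L : finLieType K) (R N : {vspace L}) :
  is_radical R -> is_nilradical N -> (liev fullv R <= N)%VS.
Proof.
move=> [IR SR _] [_ _ maxN]; apply: maxN; first exact: liev_ideal (@idealf K L) IR.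
have [k k0] := lie_full_solvable_nil (ad_rep L) IR SR; exists k.
apply/eqP; rewrite -subv0 -k0; elim: (k) => [|i IH]; first exact: subvf.
exact: lievS.
Qed.

Lemma nilradical_sub_radical (L : finLieType K) (R N : {vspace L}) :
  is_radical R -> is_nilradical N -> (N <= R)%VS.
Proof.
move=> [IR SR maxR] [IN NN _]; apply: maxR => //; exact: nilpotent_solvable.
Qed.

(** Such an x acts nilpotently on N, hence on L as [x, L] is in N; then N + <x> is a
    nilpotent ideal by [nil_extend]. *)
Lemma nil_element_mem (L : finLieType K) (R N : {vspace L}) x :
  is_radical R -> is_nilradical N -> x \in R ->
  (forall y, y \in N -> [Lie x, y] \in liev N N) -> x \in N.
Proof.
move=> RR NR xR xN; have := bracket_sub_nilradical RR NR; have [IN [k k0] maxN] := NR.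
move=> /subvP sRN.
have RN y : [Lie x, y] \in N by rewrite lieC rpredN sRN // memv_lie ?memvf.
have sN : subalg N := ideal_subalg IN.
pose D := act_op (ad_rep L) x.
have DC i y : y \in iter i (liev N) N -> D y \in iter i.+1 (liev N) N.
  apply: (lcs_der sN) => [a b _ _|a aN]; rewrite !act_opE /=; last exact: xN.
  exact: jacobiD.
have nD : lfun_nilp D.
  exists k.+1 => y; rewrite iterSr; apply/eqP; rewrite -memv0 -k0.
  elim: (k) => [|i IH]; first by rewrite act_opE RN.
  by rewrite iterS; apply: DC.
have nN : acts_nil (ad_rep L) N.
  exists k.+1; apply/eqP; rewrite -subv0 -k0 /act_chain iterSr; elim: (k) => [|i IH].
    by apply: actv_sub => a b aN _; apply: lie_idealr.
  exact: actvS.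
have nT := nil_extend nN (fun h _ => RN h) nD.
apply: (subvP (_ : (N + <[x]> <= N)%VS)); last first.
  by apply: (subvP (addvSr _ _)); apply: memv_line.
apply: maxN.
  move=> y _ /memv_addP[a aN [_ /vlineP[c ->] ->]].
  have yx : [Lie y, x] \in N by rewrite lieC rpredN RN.
  by apply: (subvP (addvSl _ _)); rewrite lieDr lieZr rpredD ?rpredZ ?yx ?IN.
have [j j0] := nT; exists j; apply/eqP; rewrite -subv0 -j0.
elim: (j) => [|i IH]; first exact: subvf.
exact: lievS.
Qed.

(** A solvable ideal I of S gives the solvable ideal I + R of L. *)
Lemma levi_radical0 (L : finLieType K) (R S : {vspace L}) (hS : subalg S) :
  is_radical R -> (S + R = fullv)%VS -> (S :&: R = 0)%VS ->
  is_radical (0%VS : {vspace (sublie hS)}).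
Proof.
move=> [IR [k k0] maxR] SR SR0; pose f := sub_incl hS.
have fH := @sub_incl_lie _ _ _ hS; have fimg : limg f = S := sub_img hS.
split=> [|| I II SI]; [exact: ideal0 | by exists 0%N |].
have IfI : lie_ideal (f @: I + R)%VS.
  move=> x _ /memv_addP[_ /memv_imgP[i iI ->] [z zR ->]]; rewrite lieDr.
  apply: rpredD; last by apply: (subvP (addvSr _ _)); apply: IR.
  have : x \in (limg f + R)%VS by rewrite fimg SR memvf.
  move=> /memv_addP[_ /memv_imgP[m _ ->] [r rR ->]]; rewrite lieDl -fH.
  by rewrite memv_add ?memv_img ?II // lie_idealr.
have : (f @: I + R <= R)%VS.
  apply: maxR => //; have [j j0] := img_solvable fH SI.
  apply: (@solvable_ext _ _ j _ R) => //; last by exists k.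
  by apply: subv_trans (derived_add j _ IR) _; rewrite /derived j0 add0v subvv.
rewrite subv_add => /andP[fIR _]; rewrite subv0; apply/eqP.
apply: (inj_img0 (sub_incl_inj hS)); apply/eqP; rewrite -subv0 -SR0 subv_cap fIR andbT.
apply: (@subv_trans _ _ (limg f)); last by rewrite fimg subvv.
by rewrite limgS // subvf.
Qed.

Lemma radical0_semisimple (L : finLieType K) :
  is_radical (0%VS : {vspace L}) -> null_lie L \/ semisimple_lie L.
Proof.
move=> [_ _ max0]; have [L0|L0] := pselect (null_lie L); [by left | right; split=> //].
by move=> I II SI; apply/eqP; rewrite -subv0 max0.
Qed.

Lemma summand_radical0 (L : finLieType K) (A B : {vspace L}) (hA : subalg A) :
  is_radical (0%VS : {vspace L}) -> (A + B = fullv)%VS ->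
  (forall a b, a \in A -> b \in B -> [Lie b, a] = 0) ->
  is_radical (0%VS : {vspace (sublie hA)}).
Proof.
move=> [_ _ max0] AB AB0; pose f := sub_incl hA.
have fH := @sub_incl_lie _ _ _ hA; have fimg : limg f = A := sub_img hA.
split=> [|| I II SI]; [exact: ideal0 | by exists 0%N |].
rewrite subv0; apply/eqP; apply: (inj_img0 (sub_incl_inj hA)); apply/eqP.
rewrite -subv0; apply: max0; last exact: img_solvable.
move=> x _ /memv_imgP[i iI ->].
have : x \in (limg f + B)%VS by rewrite fimg AB memvf.
move=> /memv_addP[_ /memv_imgP[m _ ->] [b bB ->]]; rewrite lieDl -fH.
rewrite (AB0 (f i) b) ?addr0 ?memv_img ?II //.
by rewrite /f sub_inclE subvalP.
Qed.

Lemma radical0_perfect (L : finLieType K) (I : {vspace L}) :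
  is_radical (0%VS : {vspace L}) -> lie_ideal I -> (I <= liev I I)%VS.
Proof.
move=> R0 II; apply: (quotient_semisimple R0 (k := 1)) => //; first exact: liev_ideal.
exact: sub0v.
Qed.

(** The nilradical of R is that of L, since a nilpotent ideal of R is an ideal of L
    when S commutes with R. *)
Lemma direct_case (L n : finLieType K) (R S : {vspace L}) :
  ~ solvable_lie L -> has_nilradical L n ->
  is_radical R -> subalg S -> (S + R = fullv)%VS -> (S :&: R = 0)%VS ->
  (forall s x, s \in S -> x \in R -> [Lie s, x] = 0) ->
  exists s r : finLieType K,
     [/\ semisimple_lie s, solvable_lie r, has_nilradical r n & lie_isog L (s * r)%type].
Proof.
move=> nsol [f [finj fH NR]] RR hS SR SR0 SRc.
have [IR sR maxR] := RR; have hR : subalg R := ideal_subalg IR.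
pose iS := sub_incl hS; pose iR := sub_incl hR.
have iSH := @sub_incl_lie _ _ _ hS; have iRH := @sub_incl_lie _ _ _ hR.
have iSi : limg iS = S := sub_img hS; have iRi : limg iR = R := sub_img hR.
exists (sublie hS), (sublie hR); split.
- have [S0|//] := radical0_semisimple (levi_radical0 hS RR SR SR0).
  by case: nsol; rewrite /solvable_lie -SR -iSi S0 limg0 add0v.
- by apply: (img_solvable_inj iRH (sub_incl_inj hR)); rewrite iRi.
- have NsR := subvP (nilradical_sub_radical RR NR).
  have gE x : f x \in R by apply: NsR; apply: memv_img; apply: memvf.
  pose h : 'Hom(n, sublie hR) := (linfun (@subproj _ _ _ hR) \o f)%VF.
  have hE x : subval (h x) = f x by rewrite comp_lfunE lfunE /= subprojK.
  exists h; have [IN NN maxN] := NR.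
  have imh : (iR @: limg h)%VS = limg f.
    rewrite -limg_comp; apply: eq_in_limg => x _.
    by rewrite comp_lfunE sub_inclE hE.
  have toN y : (y \in limg h) = (subval y \in limg f).
    rewrite -imh; apply/idP/idP => [yh|/memv_imgP[z zh]].
      by rewrite -sub_inclE memv_img.
    by rewrite sub_inclE => /subval_inj ->.
  split.
  + by move=> x y xy; apply: finj; rewrite -!hE xy.
  + by move=> x y; apply: subval_inj; rewrite subval_lie !hE fH.
  split.
  + by move=> x y; rewrite !toN subval_lie; apply: IN.
  + by apply: (img_nilpotent_inj iRH (sub_incl_inj hR)); rewrite imh.
  move=> I II nI; apply/subvP => y yI; rewrite toN.
  apply: (subvP (_ : (iR @: I <= limg f)%VS)); last by rewrite -sub_inclE memv_img.
  apply: maxN; last exact: img_nilpotent.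
  move=> x _ /memv_imgP[i iI ->].
  have : x \in (S + limg iR)%VS by rewrite iRi SR memvf.
  move=> /memv_addP[s sS [_ /memv_imgP[m _ ->] ->]]; rewrite lieDl SRc ?add0r //.
    by rewrite -iRH memv_img ?II.
  by rewrite /iR sub_inclE subvalP.
have [psi psiE] : exists psi : 'Hom((sublie hS * sublie hR)%type, L),
    forall u, psi u = subval u.1 + subval u.2.
  by apply: linfun_ex => a u v; rewrite !linearP scalerDr addrACA.
apply: (@lie_isog_inv _ _ psi).
- rewrite -subv0; apply/subvP => u; rewrite memv_ker psiE memv0 => /eqP u0.
  have u1R : subval u.1 \in (S :&: R)%VS.
    rewrite memv_cap subvalP /=; move/eqP: u0; rewrite addr_eq0 => /eqP ->.
    by rewrite rpredN subvalP.
  move: u1R; rewrite SR0 memv0 => /eqP u1; move: u0; rewrite u1 add0r => u2.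
  case: u u1 u2 => a b /= a0 b0; apply/eqP; congr (_, _); apply: subval_inj.
    by rewrite a0 linear0.
  by rewrite b0 linear0.
- apply/eqP; rewrite eqEsubv subvf; apply/subvP => x _.
  have : x \in (S + R)%VS by rewrite SR memvf.
  move=> /memv_addP[s sS [z zR ->]].
  have -> : s + z = psi (subproj hS s, subproj hR z) by rewrite psiE /= !subprojK.
  by rewrite memv_img ?memvf.
move=> [a b] [a' b']; rewrite !psiE /= !subval_lie.
have ab : [Lie subval a, subval b'] = 0 by rewrite SRc ?subvalP.
have ba : [Lie subval b, subval a'] = 0 by rewrite lieC SRc ?subvalP ?oppr0.
by rewrite lieDl !lieDr ab ba addr0 add0r.
Qed.
End Generic.

(** * The Levi action on the radical *)

Section LeviAction.
Variables (K : numClosedFieldType) (L : finLieType K) (R N S : {vspace L}).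
Variable hS : subalg S.
Hypotheses (RR : is_radical R) (NR : is_nilradical N).
Hypotheses (SR : (S + R = fullv)%VS) (SR0 : (S :&: R = 0)%VS).
Local Notation LS := (sublie hS).
Local Notation N2 := (liev N N).

Let IN : lie_ideal N. Proof. by case: NR. Qed.
Let IR : lie_ideal R. Proof. by case: RR. Qed.
Let IN2 : lie_ideal N2 := liev_ideal IN IN.
Let NsR : (N <= R)%VS := nilradical_sub_radical RR NR.

Definition levi_rep : lierep LS L.
refine (@LieRep K LS L (fun (s : LS) y => [Lie subval s, y]) _ _ _).
- by move=> a x y v; rewrite subval_linear liePl.
- by move=> a x u v; rewrite liePr.
- by move=> x y v; rewrite subval_lie (jacobiD (subval x)) addrK.
Defined.

Let RS : is_radical (0%VS : {vspace LS}) := levi_radical0 hS RR SR SR0.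

Lemma levi_projector (U : {vspace L}) : lie_ideal U ->
  exists f : 'End(L), [/\ forall v, f v \in U, forall u, u \in U -> f u = u
    & forall s v, s \in S -> f [Lie s, v] = [Lie s, f v]].
Proof.
move=> IU; have [||f [f1 f2 f3]] := @weyl_projector _ _ _ RS L levi_rep U.
- by move=> x v; rewrite memv0 => /eqP ->; rewrite act0l.
- by move=> x u uU; apply: IU.
exists f; split=> // s v sS; have := f3 (subproj hS s) v.
by rewrite /= subprojK.
Qed.

Lemma bracketR_N x y : y \in R -> [Lie x, y] \in N.
Proof.
by move=> yR; apply: (subvP (bracket_sub_nilradical RR NR)); rewrite memv_lie ?memvf.
Qed.

(** S0 is the kernel of the action on N / [N, N].  It maps each term of the lower
    central series of N into the next, by [lcs_der], and it maps R into N; so it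
    acts nilpotently on R.  As an ideal of a semisimple algebra it is perfect, and
    [perfect_nil] applies. *)
Lemma levi_split : exists S0 S1 : {vspace LS},
  [/\ lie_ideal S0, lie_ideal S1, (S0 + S1 = fullv)%VS, (S0 :&: S1 = 0)%VS
    & (forall s z, s \in S0 -> z \in R -> [Lie subval s, z] = 0)
      /\ (forall s, s \in S1 ->
            (forall y, y \in N -> [Lie subval s, y] \in N2) -> s = 0)].
Proof.
have [S0 S0P] : exists U : {vspace LS},
    forall s, s \in U <-> forall y, y \in N -> [Lie subval s, y] \in N2.
  apply: vspace_of => [y _|a s s' h h' y yN]; first by rewrite linear0 lie0l mem0v.
  by rewrite subval_linear liePl rpredD ?rpredZ ?h ?h'.
have I0 : lie_ideal S0.
  move=> s s' /S0P h; apply/S0P => y yN; rewrite subval_lie.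
  have -> : [Lie [Lie subval s, subval s'], y] = [Lie subval s, [Lie subval s', y]] -
     [Lie subval s', [Lie subval s, y]] by rewrite (jacobiD (subval s)) addrK.
  by apply: rpredB; [apply/IN2/h | apply/h/IN].
have [S1 [I1 S01 cap]] := perp_decomp RS I0 (sub0v _).
have {}cap : (S0 :&: S1 = 0)%VS by apply/eqP; rewrite -subv0.
exists S0, S1; split=> //; split=> [|s s1 /S0P s0]; last first.
  by apply/eqP; rewrite -memv0 -cap memv_cap s0.
have P0 := radical0_perfect RS I0.
have [Q [rQ [pi [pir pis pi0]]]] := @subquotient_rep _ _ _ levi_rep R 0%VS
  ltac:(by move=> s v vR; apply: IR)
  ltac:(by move=> s v; rewrite !memv0 => /eqP ->; rewrite act0r) (sub0v R).
have sN : subalg N := ideal_subalg IN.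
have CR k : (iter k (liev N) N <= R)%VS := subv_trans (lcs_sub sN k) NsR.
have nilS0 : acts_nil rQ S0.
  case: (NR) => _ [k k0] _; exists k.+1.
  (* The chain R, N, [N, N], ... in the representation on R. *)
  pose F i : {vspace Q} := if i is j.+1 then (pi @: iter j (liev N) N)%VS else fullv.
  apply/eqP; rewrite -subv0; have <- : F k.+1 = 0%VS by rewrite /F k0 limg0.
  apply: act_chain_sub => // -[|i] s q sS0.
    move=> _; have [v vR <-] := pis q; rewrite -pir //; apply: memv_img.
    exact: bracketR_N.
  move=> /memv_imgP[v vC ->]; rewrite -pir; last exact: (subvP (CR i)).
  apply: memv_img; rewrite -[levi_rep _ _]/([Lie subval s, v]) -ad_repE -act_opE.
  apply: (lcs_der sN) vC => [a b _ _|a aN]; rewrite !act_opE /=; first exact: jacobiD.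
  by have /S0P := sS0; apply.
move=> s z sS0 zR; have := perfect_nil P0 nilS0 (pi z) sS0; rewrite -pir // => /eqP.
by rewrite pi0 ?memv0 ?IR // => /eqP.
Qed.
End LeviAction.

Section Adapted.
Variables (K : numClosedFieldType) (t : nat) (L : finLieType K) (f : 'Hom(free_nil K t, L)).
Local Notation n := (free_nil K t).
Local Notation m := (fn_m K t).
Local Notation n2 := (liev fullv (fullv : {vspace n})).
Hypotheses (finj : injective f) (fH : forall x y, f [Lie x, y] = [Lie f x, f y]).
Hypothesis (NR : is_nilradical (limg f)).

(** In the application phi is an S-equivariant projector onto [N, N], and its kernel
    is stable under S.  Subtracting from each generator its component in [N, N]
    defines an endomorphism th of n that is the identity modulo [n, n].  It is
    surjective because n is nilpotent, hence bijective, and f o th sends m into the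
    kernel of phi. *)
Lemma adapted_embedding (phi : 'End(L)) :
  (forall v, phi v \in liev (limg f) (limg f)) ->
  (forall v, v \in liev (limg f) (limg f) -> phi v = v) ->
  exists f' : 'Hom(n, L), [/\ lker f' == 0%VS, limg f' = limg f,
     forall x y, f' [Lie x, y] = [Lie f' x, f' y] & forall y, y \in m -> phi (f' y) = 0].
Proof.
move=> ph1 ph2; have [IN nN _] := NR.
have fk : lker f == 0%VS by apply/lker0P.
have N2N : (liev (limg f) (limg f) <= limg f)%VS by apply: liev_sub => x y _; apply: IN.
have ph_gen y : phi (phi y) = phi y by rewrite ph2.
pose v i : n := (f^-1)%VF (f (fn_gen K t i) - phi (f (fn_gen K t i))).
have vE i : f (v i) = f (fn_gen K t i) - phi (f (fn_gen K t i)).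
  by rewrite limg_lfunVK // rpredB ?memv_img ?memvf // (subvP N2N).
have [th [thH thE]] := free_nil_hom v.
have img2 : (f @: n2)%VS = liev (limg f) (limg f) by rewrite img_liev.
have thfull : limg th = fullv.
  apply: subalg_gen_full.
  - exact: (img_nilpotent_inj fH fk).
  - move=> _ _ /memv_imgP[x _ ->] /memv_imgP[y _ ->]; by rewrite -thH memv_img ?memvf.
  apply/eqP; rewrite eqEsubv subvf /= -{1}(fn_gen_span K t) subv_add addvSr andbT.
  apply/span_subvP => _ /codomP[i ->].
  have : phi (f (fn_gen K t i)) \in (f @: n2)%VS by rewrite img2.
  move=> /memv_imgP[q qn2 qE].
  have -> : fn_gen K t i = th (fn_gen K t i) + q.
    by apply: finj; rewrite linearD /= thE vE qE subrK.
  by rewrite memv_add ?memv_img ?memvf.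
have thk : lker th == 0%VS.
  rewrite -dimv_eq0; have := limg_ker_dim th fullv; rewrite thfull capfv => E.
  by rewrite -(eqn_add2r (\dim (fullv : {vspace n}))) E add0n.
exists (f \o th)%VF; split.
- apply/lker0P => x y; rewrite !comp_lfunE => /finj; by have /lker0P := thk; apply.
- by rewrite limg_comp thfull.
- by move=> x y; rewrite !comp_lfunE thH fH.
move=> y ym; have : (m <= lker (phi \o (f \o th)))%VS.
  apply/span_subvP => _ /codomP[i ->]; rewrite memv_ker !comp_lfunE thE vE linearB /= ph_gen.
  by rewrite subrr.
by move=> /subvP/(_ y ym); rewrite !memv_ker !comp_lfunE => /eqP.
Qed.
End Adapted.

(** * The Levi factor that acts on the abelianized nilradical *)

Lemma dim_sublie (K : fieldType) (L : finLieType K) (S : {vspace L}) (hS : subalg S) :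
  \dim {: sublie hS} = \dim S.
Proof. by rewrite dimvf. Qed.

Section Pullback.
Variables (K : numClosedFieldType) (t : nat) (L : finLieType K) (f : 'Hom(free_nil K t, L)).
Local Notation n := (free_nil K t).
Hypotheses (fk : lker f == 0%VS) (fH : forall x y, f [Lie x, y] = [Lie f x, f y]).
Hypothesis (IN : lie_ideal (limg f)).

Let finj : injective f. Proof. by apply/lker0P. Qed.

(** The derivation of n that ad x induces through the embedding f. *)
Definition ad_pull (x : L) : 'End(n) := locked (f^-1 \o (act_op (ad_rep L) x \o f))%VF.

Lemma ad_pullE x y : f (ad_pull x y) = [Lie x, f y].
Proof. by rewrite /ad_pull -lock !comp_lfunE act_opE limg_lfunVK // IN // memv_img ?memvf. Qed.

Lemma ad_pull_der x : lie_der (ad_pull x).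
Proof. by move=> y z; apply: finj; rewrite linearD /= !fH !ad_pullE fH jacobiD. Qed.

Lemma ad_pull_linear : linear ad_pull.
Proof.
move=> a x y; apply/lfunP => z; apply: finj.
by rewrite add_lfunE scale_lfunE linearP /= !ad_pullE liePl.
Qed.

Lemma ad_pull_lie x y : ad_pull [Lie x, y] = lfun_comm (ad_pull x) (ad_pull y).
Proof.
apply/lfunP => z; apply: finj; rewrite lfun_commE linearB /= !ad_pullE.
by rewrite (jacobiD x) addrK.
Qed.
End Pullback.

Section NonDirect.
Variables (K : numClosedFieldType) (t : nat) (L : finLieType K) (f : 'Hom(free_nil K t, L)).
Local Notation n := (free_nil K t).
Local Notation m := (fn_m K t).
Local Notation n2 := (liev fullv (fullv : {vspace n})).
Local Notation N := (limg f).
Hypotheses (fk : lker f == 0%VS) (fH : forall x y, f [Lie x, y] = [Lie f x, f y]).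
Hypothesis (NR : is_nilradical N).
Variables (R S : {vspace L}) (hS : subalg S).
Local Notation LS := (sublie hS).
Hypothesis RR : is_radical R.
Hypotheses (SR : (S + R = fullv)%VS) (SR0 : (S :&: R = 0)%VS).
Variables (S0 S1 : {vspace LS}).
Hypotheses (I0 : lie_ideal S0) (I1 : lie_ideal S1).
Hypotheses (S01 : (S0 + S1 = fullv)%VS) (cap : (S0 :&: S1 = 0)%VS).
Hypothesis S0R : forall s z, s \in S0 -> z \in R -> [Lie subval s, z] = 0.
Hypothesis S1N : forall s, s \in S1 ->
  (forall y, y \in N -> [Lie subval s, y] \in liev N N) -> s = 0.
Variable phi : 'End(L).
Hypotheses (ph1 : forall v, phi v \in liev N N)
  (ph2 : forall v, v \in liev N N -> phi v = v)
  (ph3 : forall s v, s \in S -> phi [Lie s, v] = [Lie s, phi v]).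
Hypothesis fm : forall y, y \in m -> phi (f y) = 0.

Let finj : injective f. Proof. by apply/lker0P. Qed.
Let IN : lie_ideal N. Proof. by case: NR. Qed.
Let IR : lie_ideal R. Proof. by case: RR. Qed.
Let IN2 : lie_ideal (liev N N) := liev_ideal IN IN.
Let NsR : (N <= R)%VS := nilradical_sub_radical RR NR.
Let N2N : (liev N N <= N)%VS. Proof. by apply: liev_sub => x y _; apply: IN. Qed.
Let RS : is_radical (0%VS : {vspace LS}) := levi_radical0 hS RR SR SR0.
Let fN y : f y \in N. Proof. by rewrite memv_img ?memvf. Qed.

Local Notation D := (ad_pull f).
Let DE x y : f (D x y) = [Lie x, f y]. Proof. exact: ad_pullE. Qed.

Lemma mem_n2 y : (y \in n2) = (f y \in liev N N).
Proof.
rewrite -img_liev //; apply/idP/idP => [yn|/memv_imgP[z zn /finj ->] //].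
exact: memv_img.
Qed.

Lemma mem_m y : (y \in m) = (phi (f y) == 0).
Proof.
apply/idP/eqP => [/fm //|y0].
have : y \in (m + n2)%VS by rewrite fn_gen_span memvf.
move=> /memv_addP[u um [v vn yE]]; move: y0; rewrite yE linearD linearD /= fm // add0r.
rewrite ph2 -?mem_n2 // => fv0; rewrite (_ : v = 0) ?addr0 //.
by apply: finj; rewrite fv0 linear0.
Qed.

Lemma D_m s y : s \in S -> y \in m -> D s y \in m.
Proof. by move=> sS; rewrite !mem_m DE ph3 // => /eqP ->; rewrite lie0r. Qed.

(** The trace of the action on m is a linear form on LS that vanishes on brackets,
    and LS is perfect. *)
Lemma D_Der10 (s : LS) : D (subval s) \in fn_Der10 K t.
Proof.
pose d x : 'End(subvs_of m) := (linfun (vsproj m) \o (D (subval (x : LS)) \o fn_incl m))%VF.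
have dE x u : vsval (d x u) = D (subval x) (vsval u).
  have iE : fn_incl m u = vsval u by rewrite lfunE.
  rewrite 2!comp_lfunE iE [linfun _ _]lfunE /= vsprojK //.
  by apply: D_m; [apply: subvalP | apply: subvsP].
have dl : linear (fun x => lfun_trace (d x)).
  move=> a x y; have -> : d (a *: x + y) = a *: d x + d y.
    apply/lfunP => u; apply: val_inj; rewrite /= dE add_lfunE scale_lfunE /= !dE.
    by rewrite ad_pull_linear // add_lfunE scale_lfunE.
  by rewrite linearP.
apply/fn_Der10P; exists (d s).
  have [U UP] := linear_kernel dl; apply/UP.
  have : s \in liev fullv (fullv : {vspace LS}).
    by apply: (subvP (radical0_perfect RS (@idealf K LS))); apply: memvf.
  move: s; apply/subvP/liev_sub => a b _ _; apply/UP.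
  have -> : d [Lie a, b] = (d a \o d b)%VF - (d b \o d a)%VF.
    apply/lfunP => u; apply: val_inj; rewrite [LHS]dE subval_lie ad_pull_lie // lfun_commE.
    by rewrite add_lfunE opp_lfunE (comp_lfunE (d a)) (comp_lfunE (d b)) [RHS]linearB /= !dE.
  by rewrite linearB /= lfun_traceC subrr.
apply: fn_hat_uniq => [|u]; first exact: ad_pull_der.
by rewrite comp_lfunE [RHS]lfunE /= dE.
Qed.

Hypothesis S1n0 : S1 != 0%VS.
Let hS0 : subalg S0 := ideal_subalg I0.
Let hS1 : subalg S1 := ideal_subalg I1.

(** S1 embeds in the derivations of degree 1 and trace zero, which form a space of
    dimension at most 3, while S1 has dimension at least 3.  The inverse tau is
    extended to all endomorphisms of n to avoid a subtype. *)
Lemma sl2_iso : exists tau : 'End(n) -> L,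
  [/\ linear tau, forall F, F \in fn_Der10 K t -> D (tau F) = F,
     forall F, exists2 s, s \in S1 & tau F = subval s,
     forall s, s \in S1 -> tau (D (subval s)) = subval s
    & forall F G, F \in fn_Der10 K t -> G \in fn_Der10 K t ->
      tau (lfun_comm F G) = [Lie tau F, tau G]].
Proof.
have [E EE] : exists E : 'Hom(sublie hS1, 'End(n)), forall s, E s = D (subval (subval s)).
  by apply: linfun_ex => a x y; rewrite !subval_linear ad_pull_linear.
have Ek : lker E == 0%VS.
  rewrite -subv0; apply/subvP => s; rewrite memv_ker memv0 EE => /eqP s0.
  apply/eqP; apply: subval_inj; rewrite linear0; apply: S1N; first exact: subvalP.
  by move=> _ /memv_imgP[y _ ->]; rewrite -DE s0 lfunE linear0 mem0v.
have Eimg : limg E = fn_Der10 K t.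
  apply/eqP; rewrite eqEdim; apply/andP; split.
    by apply/subvP => _ /memv_imgP[s _ ->]; rewrite EE D_Der10.
  apply: leq_trans (dim_Der10 K t) _; rewrite limg_dim_eq ?(eqP Ek) ?capv0 // dim_sublie.
  exact: perfect_dim (radical0_perfect RS I1).
have EK : cancel E (E^-1)%VF := lker0_lfunK Ek.
have tau1 F : F \in fn_Der10 K t -> D (subval (subval ((E^-1)%VF F))) = F.
  by move=> F1; rewrite -EE limg_lfunVK // Eimg.
have tau2 s : s \in S1 -> subval (subval ((E^-1)%VF (D (subval s)))) = subval s.
  by move=> s1; rewrite -(subprojK hS1 s1) -EE EK.
exists (fun F => subval (subval ((E^-1)%VF F))); split=> //.
- by move=> a F G; rewrite linearP !subval_linear.
- by move=> F; exists (subval ((E^-1)%VF F)) => //; apply: subvalP.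
move=> F G F1 G1; rewrite -{1}(tau1 F F1) -{1}(tau1 G G1) -ad_pull_lie // -!subval_lie.
by rewrite tau2 // subvalP.
Qed.

(** The map c induced by x on m, the complement of [n, n], commutes with sl(m)
    because x commutes with S and S1 acts as sl(m). *)
Lemma ad_pull_scalar x : (forall s, s \in S -> [Lie x, s] = 0) ->
  exists l : K, forall y, y \in m -> D x y - l *: y \in n2.
Proof.
move=> xS; have [tau [_ tau1 tauS _ _]] := sl2_iso.
(* The projection of n to m along [n, n]. *)
pose p : 'End(n) := (f^-1 \o ((\1 - phi) \o f))%VF.
have pE y : f (p y) = f y - phi (f y).
  rewrite !comp_lfunE add_lfunE opp_lfunE id_lfunE limg_lfunVK // rpredB ?fN //.
  exact: (subvP N2N).
have pm y : p y \in m by rewrite mem_m pE linearB /= [phi (phi _)]ph2 // subrr.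
pose c : 'End(subvs_of m) := (linfun (vsproj m) \o (p \o (D x \o fn_incl m)))%VF.
have cE u : vsval (c u) = p (D x (vsval u)).
  have iE : fn_incl m u = vsval u by rewrite lfunE.
  rewrite (comp_lfunE (linfun (vsproj m))) (comp_lfunE p) (comp_lfunE (D x)) iE.
  by rewrite [linfun _ _]lfunE /= vsprojK.
have [e e0 u|l cl] := @sl_center _ _ c.
  have [s s1 sE] := tauS (fn_hat_in e).
  have eD : fn_hat_in e = D (subval s).
    by rewrite -sE tau1 //; apply/fn_Der10P; exists e.
  have sS : subval s \in S := subvalP s.
  apply: val_inj; rewrite [LHS]cE [RHS](esym (fn_hat_inE e (c u))) cE -fn_hat_inE eD; apply: finj.
  rewrite pE !DE pE !DE lieBr -ph3 //.
  have -> : [Lie x, [Lie subval s, f (vsval u)]] =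
      [Lie subval s, [Lie x, f (vsval u)]].
    by rewrite (jacobiD x) xS // lie0l add0r.
  by [].
exists l => y ym; have := cE (vsproj m y); rewrite cl /= vsprojK // => ->.
by rewrite mem_n2 linearB /= pE opprB addrC subrK.
Qed.

Lemma ad_pull_small x : x \in R -> (forall y, y \in m -> D x y \in n2) -> x \in N.
Proof.
move=> xR xm; apply: (nil_element_mem RR NR xR) => _ /memv_imgP[y _ ->].
have : y \in (m + n2)%VS by rewrite fn_gen_span memvf.
move=> /memv_addP[u um [v vn ->]]; rewrite linearD lieDr rpredD //.
  by rewrite -DE -mem_n2 xm.
by rewrite IN2 // -mem_n2.
Qed.

Let s0T : finLieType K := sublie hS0.

(** A is the part of R in the kernel of an S-equivariant projector psi onto N.  It
    commutes with S because [S, A] is in N as well as in the kernel of psi.  The map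
    Psi puts S0, S1 = sl(m) and N together, and is injective modulo A because
    L is the direct sum of S0, S1, N and A. *)
Lemma assembly : exists (Psi : 'Hom((s0T * g2 K t)%type, L)) (A : {vspace L}),
  [/\ forall u v, Psi [Lie u, v] = [Lie Psi u, Psi v],
      forall u z, z \in A -> Psi u + z = 0 -> u = 0 /\ z = 0,
      forall y, exists u, exists2 z, z \in A & y = Psi u + z,
      (A <= R)%VS
    & [/\ forall z, z \in A -> z \in N -> z = 0,
      forall z s, z \in A -> s \in S -> [Lie z, s] = 0,
      forall z u, z \in A -> [Lie z, Psi u] = f (D z u.2.2)
    & forall (p : g2 K t), p.1 = 0 -> Psi (0, p) = f p.2]].
Proof.
have [tau [taul tau1 tauS tau2 tauH]] := sl2_iso.
have tauS' F : tau F \in S by have [s _ ->] := tauS F; apply: subvalP.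
have tau0 : tau 0 = 0 by rewrite -(subrr (0 : 'End(n))) -scaleN1r addrC taul scaleN1r addNr.
have [psi [ps1 ps2 ps3]] := levi_projector hS RR SR SR0 IN.
pose A := (R :&: lker psi)%VS.
have NA z : z \in A -> z \in N -> z = 0.
  by rewrite memv_cap memv_ker => /andP[_ /eqP z0] zN; rewrite -(ps2 z zN).
have AS z s : z \in A -> s \in S -> [Lie z, s] = 0.
  rewrite memv_cap memv_ker => /andP[zR /eqP z0] sS.
  rewrite lieC -(ps2 [Lie s, z]) ?ps3 // ?z0 ?lie0r ?oppr0 //.
  exact: (bracketR_N RR NR s zR).
have [Psi PsiE] : exists Psi : 'Hom((s0T * g2 K t)%type, L), forall u,
    Psi u = subval (subval u.1) + (tau (vsval u.2.1) + f u.2.2).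
  apply: linfun_ex => a u v /=; rewrite taul linearP !scalerDr.
  by rewrite [X in _ + X = _]addrACA [LHS]addrACA.
exists Psi, A; split=> //.
- move=> [a [F x]] [b [G y]]; rewrite !PsiE.
  set p : g2 K t := (F, x); set q : g2 K t := (G, y).
  have -> : vsval [Lie p, q].1 = lfun_comm (vsval F) (vsval G) by apply: g2_br1.
  have -> : [Lie p, q].2 = vsval F y - vsval G x + [Lie x, y] by [].
  have F1 := subvsP F; have G1 := subvsP G.
  rewrite /= !subval_lie tauH // linearD linearB /= fH.
  have z1 c H : [Lie subval (subval (c : s0T)), tau H] = 0.
    have [s s1 ->] := tauS H; rewrite -subval_lie.
    have -> : [Lie subval c, s] = 0; last by rewrite linear0.
    apply/eqP; rewrite -memv0 -cap memv_cap I1 // andbT.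
    by apply: lie_idealr => //; apply: subvalP.
  have z2 c w : [Lie subval (subval (c : s0T)), f w] = 0.
    by apply: S0R; [apply: subvalP | apply: (subvP NsR)].
  have z3 c H : [Lie tau H, subval (subval (c : s0T))] = 0 by rewrite lieC z1 oppr0.
  have z4 c w : [Lie f w, subval (subval (c : s0T))] = 0 by rewrite lieC z2 oppr0.
  have z5 H w : H \in fn_Der10 K t -> [Lie tau H, f w] = f (H w).
    by move=> H1; rewrite -DE tau1.
  rewrite !lieDl !lieDr !z1 !z2 !z3 !z4 !addr0 !add0r z5 // (lieC (f x) (tau _)) z5 //.
  by rewrite !addrA.
- move=> [a [F y]] z zA; rewrite PsiE /= => E.
  have [s s1 sE] := tauS (vsval F).
  have zR : z \in R by move: zA; rewrite memv_cap => /andP[].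
  have E1 : subval (subval a + s) = - (f y + z).
    by rewrite linearD /= -sE; apply/eqP; rewrite -addr_eq0 -E !addrA.
  have E2 : subval (subval a + s) = 0.
    apply/eqP; rewrite -memv0 -SR0 memv_cap subvalP E1 rpredN rpredD //.
    by apply: (subvP NsR).
  have E3 : subval a + s = 0 by apply: subval_inj; rewrite E2 linear0.
  have E4 : subval a = 0.
    apply/eqP; rewrite -memv0 -cap memv_cap subvalP /=.
    by move/eqP: E3; rewrite addr_eq0 => /eqP ->; rewrite rpredN.
  have E5 : s = 0 by rewrite -E3 E4 add0r.
  have F0 : F = 0.
    apply: val_inj; rewrite /= -(tau1 _ (subvsP F)) sE E5 linear0.
    apply/lfunP => w; apply: finj; by rewrite DE lie0l lfunE linear0.
  have E6 : f y + z = 0 by apply/eqP; rewrite -oppr_eq0 -E1 E2.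
  have z0 : z = 0.
    apply: NA => //; move/eqP: E6; rewrite addrC addr_eq0 => /eqP ->.
    by rewrite rpredN.
  split=> //; have a0 : a = 0 by apply: subval_inj; rewrite E4 linear0.
  have y0 : y = 0 by apply: finj; rewrite linear0 -E6 z0 addr0.
  by rewrite a0 F0 y0.
- move=> y; have : y \in (S + R)%VS by rewrite SR memvf.
  move=> /memv_addP[s sS [z zR ->]].
  have : subproj hS s \in (S0 + S1)%VS by rewrite S01 memvf.
  move=> /memv_addP[a aS [b bS sE]].
  have psN : psi z \in N := ps1 z.
  exists (subproj hS0 a, (vsproj (fn_Der10 K t) (D (subval b)), (f^-1)%VF (psi z))).
  exists (z - psi z).
    rewrite memv_cap memv_ker linearB /= [psi (psi z)]ps2 // subrr eqxx andbT rpredB //.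
    exact: (subvP NsR).
  rewrite PsiE /= subprojK // vsprojK ?D_Der10 // tau2 // limg_lfunVK //.
  have sE' : s = subval a + subval b by rewrite -{1}(subprojK hS sS) sE linearD.
  by rewrite sE' -!addrA [psi z + _]addrC subrK.
- exact: capvSl.
split=> //.
- move=> z [a [F y]] zA; rewrite PsiE /= !lieDr AS ?subvalP // AS ?tauS' // !add0r.
  by rewrite DE.
by move=> [F y] /= F0; rewrite PsiE /= F0 !linear0 tau0 !add0r.
Qed.

End NonDirect.

(** * Classification *)

(** Any algebraically closed field with a conjugation will do.  For case c) the
    generator of A is scaled to act as the identity modulo [n, n]; its action is
    then the identity derivation plus a derivation d that raises degrees, and d
    centralizes sl(m) because A commutes with S. *)
Theorem nonsolvable_free_nilradical (K : numClosedFieldType) (t : nat) (ht : (1 <= t)%N)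
    (g : finLieType K) (g_nonsolvable : ~ solvable_lie g)
    (g_nilrad : has_nilradical g (free_nil K t)) :
  (exists s r : finLieType K,
     [/\ semisimple_lie s, solvable_lie r, has_nilradical r (free_nil K t)
       & lie_isog g (s * r)%type])
  \/ (exists s : finLieType K,
        (null_lie s \/ semisimple_lie s) /\ lie_isog g (s * g2 K t)%type)
  \/ (exists s : finLieType K,
        (null_lie s \/ semisimple_lie s) /\
        exists (d : 'End(free_nil K t))
               (hd : der_cent (fn_Der10 K t) d),
          d \in fn_N K t /\ lie_isog g (s * gdelta hd)%type).
Proof.
have [R RR] := radical_exists g.
have [S [hS SR SR0]] := levi RR.
have [f0 [f0inj f0H NR0]] := g_nilrad.
have [S0 [S1 [I0 I1 S01 cap [S0R S1N]]]] := levi_split hS RR NR0 SR SR0.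
have [S10|S1n0] := eqVneq S1 0%VS.
  left; apply: (direct_case g_nonsolvable g_nilrad RR hS SR SR0) => s x sS xR.
  by rewrite -(subprojK hS sS) S0R // -[S0]addv0 -S10 S01 memvf.
right.
have IN2 : lie_ideal (liev (limg f0) (limg f0)) by case: NR0 => IN _ _; apply: liev_ideal.
have [phi [ph1 ph2 ph3]] := levi_projector hS RR SR SR0 IN2.
have [f [fk fimg fH fm]] := adapted_embedding f0inj f0H NR0 ph1 ph2.
rewrite -fimg in NR0 S1N ph1 ph2.
have RS : is_radical (0%VS : {vspace (sublie hS)}) := levi_radical0 hS RR SR SR0.
pose hS0 : subalg S0 := ideal_subalg I0.
have ss0 : null_lie (sublie hS0) \/ semisimple_lie (sublie hS0).
  apply: radical0_semisimple; apply: (summand_radical0 hS0 RS S01) => a b aS bS.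
  apply/eqP; rewrite -memv0 -cap memv_cap I0 //=.
  exact: lie_idealr.
have IN : lie_ideal (limg f) by case: NR0.
have [Psi [A [PH Pinj Psurj AR [AN AS AP P0]]]] :=
  assembly fk fH NR0 RR SR SR0 I0 I1 S01 cap S0R S1N ph2 ph3 fm S1n0.
have scalar z : z \in A -> exists l : K, forall y, y \in fn_m K t ->
    ad_pull f z y - l *: y \in liev fullv fullv.
  move=> zA; apply: (ad_pull_scalar fk fH NR0 RR SR SR0 I1 S1N ph1 ph2 ph3 fm S1n0).
  by move=> s sS; apply: AS.
have small z : z \in A ->
    (forall y, y \in fn_m K t -> ad_pull f z y \in liev fullv fullv) -> z = 0.
  move=> zA zm; apply: AN => //; apply: (ad_pull_small fk fH NR0 RR) => //.
  exact: (subvP AR).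
have [A0|An0] := eqVneq A 0%VS.
  left; exists (sublie hS0); split=> //; apply: (lie_isog_inv (psi := Psi)) => //.
    rewrite -subv0; apply/subvP => u; rewrite memv_ker memv0 => /eqP u0.
    by have [->] := Pinj u 0 (mem0v _) (etrans (addr0 _) u0).
  apply/eqP; rewrite eqEsubv subvf; apply/subvP => y _.
  have [u [z + ->]] := Psurj y; rewrite A0 memv0 => /eqP ->.
  by rewrite addr0 memv_img ?memvf.
right; exists (sublie hS0); split=> //.
pose x0 := vpick A; have x0A : x0 \in A := memv_pick A.
have x0n : x0 != 0 by rewrite vpick0.
have [l0 l0P] := scalar x0 x0A.
have l0n : l0 != 0.
  apply: contraNneq x0n => l00; apply/eqP; apply: small => // y ym.
  by have := l0P y ym; rewrite l00 scale0r subr0.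
pose x := l0^-1 *: x0; have xA : x \in A by rewrite rpredZ.
have xn : x != 0 by rewrite scaler_eq0 invr_eq0 (negPf l0n).
have adl := ad_pull_linear fk IN.
have ad0 : ad_pull f 0 = 0.
  by have := adl (-1) 0 0; rewrite scaler0 addr0 scaleN1r addNr.
have adZ a z : ad_pull f (a *: z) = a *: ad_pull f z.
  by have := adl a z 0; rewrite !addr0 ad0 addr0.
have xP y : y \in fn_m K t -> ad_pull f x y - y \in liev fullv fullv.
  move=> ym; rewrite adZ scale_lfunE -[X in _ - X](scalerK l0n) -scalerBr.
  by rewrite rpredZ // l0P.
have Ax z : z \in A -> exists c : K, z = c *: x.
  move=> zA; have [l lP] := scalar z zA; exists l; apply/eqP; rewrite -subr_eq0; apply/eqP.
  apply: small => [|y ym]; first by rewrite rpredB ?rpredZ.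
  have -> : z - l *: x = - l *: x + z by rewrite addrC scaleNr.
  rewrite adl add_lfunE scale_lfunE scaleNr addrC.
  have -> : ad_pull f z y - l *: ad_pull f x y =
      (ad_pull f z y - l *: y) - l *: (ad_pull f x y - y).
    by rewrite scalerBr opprB addrA subrK.
  by rewrite rpredB ?rpredZ ?lP ?xP.
have Dx_cent : der_cent (fn_Der10 K t) (ad_pull f x).
  split=> [|E E1]; first exact: ad_pull_der.
  have [tau [_ tau1 tauS _ _]] := sl2_iso fk fH NR0 RR SR SR0 I1 S1N ph2 ph3 fm S1n0.
  have [s _ sE] := tauS E; rewrite -(tau1 E E1) -ad_pull_lie // sE AS ?subvalP //.
pose d : 'End(free_nil K t) := ad_pull f x - fn_id K t.
have hd : der_cent (fn_Der10 K t) d.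
  rewrite /d -scaleN1r; apply: der_centD => //; have [iD iC] := fn_id_cent K t.
  split=> [|E E1]; first exact: lie_derZ.
  by rewrite -[-1 *: _]addr0 lfun_commPl iC // scaler0 add0r lfun_comm0l.
exists d, hd; split.
  apply: mem_fn_N => // [|u um]; first by case: hd.
  have := xP u um; rewrite add_lfunE opp_lfunE.
  by have := fn_idE (vsproj (fn_m K t) u); rewrite vsprojK // => ->.
have [Xi XiE] : exists Xi : 'Hom((sublie hS0 * gdelta hd)%type, g),
   forall u, Xi u = Psi (u.1, u.2.1) + (u.2.2 : K) *: x.
  apply: linfun_ex => a u v /=; rewrite -[(_ , _)]/(a *: (u.1, u.2.1) + (v.1, v.2.1)).
  by rewrite linearP scalerDl -scalerA scalerDr addrACA.
apply: (lie_isog_inv (psi := Xi)).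
- rewrite -subv0; apply/subvP => -[a [p c]]; rewrite memv_ker memv0 XiE /= => /eqP u0.
  have cxA : (c : K) *: x \in A by rewrite rpredZ.
  have [[-> p0] /eqP] := Pinj (a, p) _ cxA u0.
  rewrite scaler_eq0 (negPf xn) orbF => /eqP ->; by rewrite p0.
- apply/eqP; rewrite eqEsubv subvf; apply/subvP => y _.
  have [[a p] [z zA ->]] := Psurj y; have [c ->] := Ax z zA.
  have -> : Psi (a, p) + c *: x = Xi (a, (p, c)) by rewrite XiE.
  by rewrite memv_img ?memvf.
move=> [a [p c]] [b [q e]]; rewrite !XiE /=.
have idd : fn_id K t + d = ad_pull f x by rewrite addrC subrK.
have G r : Psi (0, gdelta_ad d r) = f (ad_pull f x r.2).
  by rewrite P0 ?lfunE //= idd.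
have := PH (a, p) (b, q); set w := lie (a, p) (b, q) => PHw.
have brE : ([Lie a, b], [Lie (p, c) : gdelta hd, (q, e)].1) =
   w + ((c : K) *: (0, gdelta_ad d q) - (e : K) *: (0, gdelta_ad d p)).
  by congr (_, _); rewrite /= !scaler0 subr0 addr0.
have expand u1 u2 u3 : Psi (u1 + ((c : K) *: u2 - (e : K) *: u3)) =
    Psi u1 + ((c : K) *: Psi u2 - (e : K) *: Psi u3).
  by rewrite linearD linearB !linearZ.
rewrite brE scale0r addr0; apply: (etrans (expand _ _ _)).
have -> : [Lie Psi (a, p) + (c : K) *: x, Psi (b, q) + (e : K) *: x] =
    [Lie Psi (a, p), Psi (b, q)] +
    ((c : K) *: f (ad_pull f x q.2) - (e : K) *: f (ad_pull f x p.2)).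
  have px : [Lie Psi (a, p), x] = - f (ad_pull f x p.2) by rewrite lieC (AP x (a, p)).
  have xq : [Lie x, Psi (b, q)] = f (ad_pull f x q.2) by rewrite (AP x (b, q)).
  rewrite lieDl !lieDr !(lieZl c) !(lieZr e) liexx !scaler0 addr0 px xq scalerN.
  by rewrite -addrA [- _ + _]addrC.
by congr (_ + (_ *: _ - _ *: _)); [exact: PHw | exact: G | exact: G].
Qed.

Unset Implicit Arguments.
Local Open Scope complex_scope.

Theorem lemma4p1 (R : realType) (t : nat) (ht : (1 <= t)%N)
    (g : finLieType R[i]) (g_nonsolvable : ~ solvable_lie g)
    (g_nilrad : has_nilradical g (free_nil R[i] t)) :
  (exists s r : finLieType R[i],
     [/\ semisimple_lie s, solvable_lie r, has_nilradical r (free_nil R[i] t)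
       & lie_isog g (s * r)%type])
  \/ (exists s : finLieType R[i],
        (null_lie s \/ semisimple_lie s) /\ lie_isog g (s * g2 R[i] t)%type)
  \/ (exists s : finLieType R[i],
        (null_lie s \/ semisimple_lie s) /\
        exists (d : 'End(free_nil R[i] t))
               (hd : der_cent (fn_Der10 R[i] t) d),
          d \in fn_N R[i] t /\ lie_isog g (s * gdelta hd)%type).
Proof. exact: (@nonsolvable_free_nilradical R[i] t ht g g_nonsolvable g_nilrad). Qed.
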